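(* For each integer $n\ge 2$ let $\mu_n$ be a Borel probability measure on hyperbolic space $\mathbb{H}^n$ that is radial about the origin $o$, let $X_n=(\operatorname{supp}\mu_n,d_{\mathbb{H}},\mu_n)$, and let $\mathbf{R}_n$ be the distance to $o$ of a random point with distribution $\mu_n$. Let $s_n>0$ with $s_n\to0$, and suppose that deterministic radii $\rho_n>0$ satisfy $$s_n(\mathbf{R}_n-\rho_n)\longrightarrow 0\quad\text{in probability.}$$ Put $a_{n,\rho_n}=s_n\log\frac{\sinh\rho_n}{\sqrt n}$ and suppose that $a_{n,\rho_n}\to a\in[-\infty,+\infty)$. Then $$\mathcal{P}(s_nX_n)\longrightarrow\mathcal{P}_{\le 2a_+}\quad\text{weakly.}$$ Moreover, for each $n$ let $H_n\subset\mathbb{H}^n$ be a totally geodesic hyperplane through $o$, and let $u_{H_n}$ be the signed distance from $H_n$, positive on one chosen side. Then $$(s_nu_{H_n})_*\mu_n\longrightarrow\tfrac12\delta_{-a_+}+\tfrac12\delta_{a_+}\quad\text{in distribution.}$$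
   Context: $(\mathbb{H}^n,d_{\mathbb{H}})$ is the hyperbolic space of constant curvature $-1$ with a fixed origin $o$. A Borel probability measure on $\mathbb{H}^n$ is radial about $o$ if it is invariant under every isometry of $\mathbb{H}^n$ fixing $o$. For $a\in\mathbb{R}$, $a_+=\max\{a,0\}$, and $(-\infty)_+=0$. An mm-space is a triple $(X,d_X,\mu_X)$ (written $X$) with $(X,d_X)$ a complete separable metric space and $\mu_X$ a Borel probability measure on $X$. mm-spaces are considered up to mm-isomorphism (an isometry between the supports carrying one measure to the other), so $\mu_X$ is taken to have full support. For $s>0$, $sX=(X,s\,d_X,\mu_X)$. $X$ dominates $Y$, written $Y\prec X$, if there is a $1$-Lipschitz map $f\colon X\to Y$ with $f_*\mu_X=\mu_Y$. Box distance: for a closed set $S\subset X\times Y$ put $\operatorname{dis}S=\sup_{(x,y),(x',y')\in S}|d_X(x,x')-d_Y(y,y')|$; then $\Box(X,Y)=\inf_{\pi,S}\max\{1-\pi(S),\operatorname{dis}S\}$ over all couplings $\pi$ of $\mu_X,\mu_Y$ and all closed $S\subset X\times Y$. A pyramid is a nonempty $\Box$-closed family $\mathcal{Q}$ of mm-spaces such that $X\in\mathcal{Q}$ and $Y\prec X$ imply $Y\in\mathcal{Q}$, and any $X,X'\in\mathcal{Q}$ are both dominated by some $Y\in\mathcal{Q}$. $\mathcal{P}(X)$ is the pyramid of all mm-spaces dominated by $X$; for $D\ge0$, $\mathcal{P}_{\le D}$ is the pyramid of all mm-spaces of diameter at most $D$. Pyramids $\mathcal{Q}_n$ converge weakly to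 a pyramid $\mathcal{Q}$ if (1) every $Y\in\mathcal{Q}$ is the $\Box$-limit of some $Y_n\in\mathcal{Q}_n$, and (2) whenever $Y_{n_k}\in\mathcal{Q}_{n_k}$ along a subsequence and $\Box(Y_{n_k},Y)\to0$, then $Y\in\mathcal{Q}$. *)

(* Defs.v *)
From HB Require Import structures.
From mathcomp Require Import all_boot all_order all_algebra.
From mathcomp Require Import all_classical all_reals all_analysis.
From mathcomp Require Import ring lra.

Set Implicit Arguments.
Unset Strict Implicit.
Unset Printing Implicit Defensive.

Import Order.TTheory GRing.Theory Num.Theory.
Import numFieldNormedType.Exports.

Local Open Scope classical_set_scope.
Local Open Scope ring_scope.

Notation borel T := (g_sigma_algebraType (@open T)).

Definition separable (T : topologicalType) :=
  exists2 A : set T, countable A & dense A.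

HB.mixin Record Topological_isSeparable T & Topological T := {
  separable_subproof : separable T
}.

#[short(type="separableTopologicalType")]
HB.structure Definition SeparableTopological :=
  {T of Topological T & Topological_isSeparable T}.

(* Complete separable metric spaces. The base point is required by completeType
   and measurableType and carries no meaning here. *)
#[short(type="csMetricType")]
HB.structure Definition CSMetric (R : numDomainType) :=
  {T of Metric R T & Complete T & Topological_isSeparable T}.

Section separability.
Context {R : realType}.

Lemma exists_invS_lt (e : R) : 0 < e -> exists k : nat, k.+1%:R^-1 < e.
Proof.
move=> e0; have [k _ /(_ k (leqnn k))] := near_infty_natSinv_lt (PosNum e0).
by exists k.
Qed.

Lemma separable_of_map (S : ptopologicalType) (T : pseudoMetricType R)
    (phi : S -> T) :
  (forall x (U : set S), nbhs x U ->
    exists2 e : R, 0 < e & phi @^-1` ball (phi x) e `<=` U) ->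
  separable T -> separable S.
Proof.
move=> phiP [A cA dA].
pose B (p : T * nat) := phi @^-1` ball p.1 (p.2.+1%:R^-1 : R).
exists ((fun p => xget point (B p)) @` (A `*` setT)).
  apply: sub_countable (card_image_le _ _) _.
  by apply: countableX => //; exact: countableP.
move=> U [x Ux] oU.
have [e e0 eU] := phiP x U (open_nbhs_nbhs (conj oU Ux)).
have [k ke] : exists k : nat, k.+1%:R^-1 < e / 2.
  by apply: exists_invS_lt; rewrite divr_gt0.
have k0 : 0 < k.+1%:R^-1 :> R by rewrite invr_gt0 ltr0n.
have [a [xa Aa]] : (interior (ball (phi x) (k.+1%:R^-1 : R)) `&` A) !=set0.
  apply: dA; last exact: open_interior.
  by exists (phi x); apply: nbhsx_ballx.
have {}xa := interior_subset xa.
have Bx : B (a, k) x by rewrite /B /=; exact: ball_sym.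
have Bz : B (a, k) (xget point (B (a, k))) := xgetI _ Bx.
exists (xget point (B (a, k))); split; last by exists (a, k).
apply: eU => /=; rewrite (splitr e).
apply: (@ball_triangle _ _ a); first exact: le_ball (ltW ke) _ xa.
exact: le_ball (ltW ke) _ Bz.
Qed.

End separability.

Lemma separable_rV (R : realType) m : separable 'rV[R]_m.
Proof.
exists (range (map_mx ratr : 'rV[rat]_m -> 'rV[R]_m)).
  by apply: sub_countable (card_image_le _ _) _; exact: countableP.
move=> U [v Uv] oU.
have /nbhs_ballP[e /= e0 eU] := open_nbhs_nbhs (conj oU Uv).
have /choice[q qP] : forall j, exists q : rat, ball (v ord0 j) e (ratr q).
  move=> j; have [x [xb [q _ qx]]] : (ball (v ord0 j) e `&` (@ratr R @` setT)) !=set0.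
    apply: dense_rat; last exact: ball_open.
    by exists (v ord0 j); exact: ballxx.
  by exists q; rewrite qx.
exists (map_mx ratr (\row_j q j)); split; last by exists (\row_j q j).
by apply: eU; split => // i j; rewrite !mxE ord1; exact: qP.
Qed.

Section scaling.
Context {R : realType}.

Definition scaled (s : {posnum R}) (T : Type) : Type := T.

Variables (s : {posnum R}) (T : csMetricType R).

HB.instance Definition _ := Complete.copy (scaled s T) T.

HB.instance Definition _ :=
  Topological_isSeparable.Build (scaled s T) (separable_subproof (s := T)).

Definition scaled_ball (x : T) (e : R) : set T := ball x (s%:num^-1 * e).

Let scaled_ball_center (x : T) (e : R) : 0 < e -> scaled_ball x e x.
Proof. by move=> e0; apply: ballxx; rewrite mulr_gt0. Qed.

Let scaled_ball_sym (x y : T) (e : R) : scaled_ball x e y -> scaled_ball y e x.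
Proof. exact: ball_sym. Qed.

Let scaled_ball_triangle (x y z : T) (e1 e2 : R) :
  scaled_ball x e1 y -> scaled_ball y e2 z -> scaled_ball x (e1 + e2) z.
Proof. by rewrite /scaled_ball mulrDr; exact: ball_triangle. Qed.

Let scaled_entourageE : @entourage (scaled s T) = entourage_ scaled_ball.
Proof.
rewrite -[LHS]/(@entourage T) -(@entourage_ballE R T).
apply/seteqP; split=> A [e /= e0 eA].
  exists (s%:num * e) => /=; first by rewrite mulr_gt0.
  by move=> xy; rewrite /scaled_ball mulKf //; exact: eA.
by exists (s%:num^-1 * e) => //=; rewrite mulr_gt0.
Qed.

HB.instance Definition _ := Uniform_isPseudoMetric.Build R (scaled s T)
  scaled_ball_center scaled_ball_sym scaled_ball_triangle scaled_entourageE.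

Let scaled_dist (x y : scaled s T) : R := s%:num * mdist (x : T) (y : T).

Let scaled_dist_ge0 x y : 0 <= scaled_dist x y.
Proof. by rewrite mulr_ge0 // mdist_ge0. Qed.

Let scaled_dist_positivity x y : scaled_dist x y = 0 -> x = y.
Proof.
by move/eqP; rewrite mulf_eq0 gt_eqF //= => /eqP; exact: mdist_positivity.
Qed.

Let scaled_ballEmdist (x : scaled s T) d :
  ball x d = [set y | scaled_dist x y < d].
Proof.
rewrite /ball /= /scaled_ball ballEmdist; apply/seteqP.
by split=> y /=; rewrite /scaled_dist ltr_pdivlMl.
Qed.

HB.instance Definition _ := PseudoMetric_isMetric.Build R (scaled s T)
  scaled_dist_ge0 scaled_dist_positivity scaled_ballEmdist.

End scaling.

Section support.
Context {R : realType} {T : csMetricType R} (mu : probability (borel T) R).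
Local Open Scope ereal_scope.

Definition support : set T := [set x | forall U, open U -> U x -> 0 < mu U].

Lemma measurable_open (U : set T) : open U -> measurable (U : set (borel T)).
Proof. exact: sub_sigma_algebra. Qed.

Lemma closed_support : closed support.
Proof.
rewrite -[support]setCK; apply: open_closedC; rewrite openE => x /= /existsNP.
move=> [U /not_implyP[oU /not_implyP[Ux U0]]].
rewrite /interior; apply: filterS (open_nbhs_nbhs (conj oU Ux)) => y Uy.
by move=> /(_ U oU Uy).
Qed.

Lemma measurable_support : measurable (support : set (borel T)).
Proof.
rewrite -[support]setCK; apply: measurableC; apply: measurable_open.
exact: closed_openC closed_support.
Qed.

Lemma measure_supportC : mu (~` support) = 0.
Proof.
have [A /countable_injP[f fA] dA] := separable_subproof (s := T).
pose g i := xget point [set a | A a /\ f a = i].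
have gf a : A a -> g (f a) = a.
  move=> Aa; have [Ag fg] : A (g (f a)) /\ f (g (f a)) = f a.
    exact: (@xgetI _ point [set b | A b /\ f b = f a] a (conj Aa erefl)).
  by apply: fA; rewrite ?inE.
pose B i k : set T := interior (ball (g i) (k.+1%:R^-1 : R)).
pose C i k : set T := if mu (B i k) == 0 then B i k else set0.
have nC i k : mu.-negligible (C i k : set (borel T)).
  rewrite /C; case: ifPn => [/eqP B0|_]; last exact: negligible_set0.
  exists (B i k); split => //.
  by apply: measurable_open; exact: open_interior.
have nCC : mu.-negligible (\bigcup_i \bigcup_k C i k : set (borel T)).
  by do 2!apply: negligible_bigcup => ?.
apply/negligibleP; first by apply: measurableC; exact: measurable_support.
apply: negligibleS nCC.
move=> x /= /existsNP[U /not_implyP[oU /not_implyP[Ux U0]]].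
have {}U0 : mu U = 0.
  by apply/eqP; rewrite -measure_le0 leNgt; apply/negP.
have /nbhs_ballP[e /= e0 eU] := open_nbhs_nbhs (conj oU Ux).
have [k ke] : exists k : nat, (k.+1%:R^-1 < e / 2)%R.
  by apply: exists_invS_lt; rewrite divr_gt0.
have k0 : (0 < k.+1%:R^-1 :> R)%R by rewrite invr_gt0 ltr0n.
have [a [xa Aa]] : (interior (ball x (k.+1%:R^-1 : R)) `&` A) !=set0.
  apply: dA; last exact: open_interior.
  by exists x; apply: nbhsx_ballx.
have {}xa := interior_subset xa.
exists (f a) => //; exists k => //.
suff B0 : mu (B (f a) k) = 0.
  rewrite /C B0 eqxx /B gf // ballEmdist /interior.
  apply/nbhs_ballP; exists (k.+1%:R^-1 - mdist a x)%R => /=.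
    by rewrite subr_gt0; move: xa; rewrite ballEmdist /= metric_sym.
  move=> y; rewrite ballEmdist /= => xy.
  apply: le_lt_trans (metric_triangle a x y) _.
  by rewrite -ltrBrDl.
apply/eqP; rewrite -measure_le0 -U0; apply: le_measure; rewrite ?inE.
- by apply: measurable_open; exact: open_interior.
- exact: measurable_open.
- rewrite /B gf // => y /interior_subset ay; apply: eU; rewrite (splitr e).
  apply: (@ball_triangle _ _ a); first exact: le_ball (ltW ke) _ xa.
  exact: le_ball (ltW ke) _ ay.
Qed.

Lemma measure_support : mu support = 1.
Proof.
have := probability_setC mu (measurableC measurable_support).
by rewrite setCK measure_supportC sube0.
Qed.

Lemma support_neq0 : support !=set0.
Proof.
apply/set0P/eqP => S0; have := measure_support.
by rewrite S0 measure0 => /esym/eqP; rewrite onee_eq0.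
Qed.

Definition supp_space : Type := set_type support.

HB.instance Definition _ := PseudoMetric.copy supp_space (set_type support).

Definition supp_val (x : supp_space) : T := val x.

Lemma supp_valP x : support (supp_val x). Proof. exact: set_valP. Qed.

Lemma supp_val_inj : injective supp_val. Proof. exact: val_inj. Qed.

HB.instance Definition _ :=
  isPointed.Build supp_space (SigSub (mem_set (projT2 (cid support_neq0)))).

Let supp_complete (F : set_system supp_space) :
  ProperFilter F -> cauchy F -> cvg F.
Proof.
move=> PF /(@cauchy_ballP R supp_space) cF.
pose G := supp_val @ F.
have PG : ProperFilter G by exact: fmap_proper_filter.
have cG : cauchy G.
  apply/(@cauchy_ballP R T) => e e0; rewrite near_map2; exact: cF.
have [x Gx] : exists x : T, G --> x by apply/cvg_ex; exact: cauchy_cvg.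
have Sx : support x.
  rewrite ((closure_id support).1 closed_support).
  move=> B /Gx; rewrite /G /= nbhs_simpl /= => FB.
  have [y By] := filter_ex FB; exists (supp_val y); split => //.
  exact: supp_valP.
apply/cvg_ex; exists (SigSub (mem_set Sx) : supp_space).
apply/cvg_ballP => e e0; exact: (cvg_ball Gx).
Qed.

HB.instance Definition _ := Uniform_isComplete.Build supp_space supp_complete.

Let supp_separable : separable supp_space.
Proof.
apply: (@separable_of_map R supp_space T supp_val).
  by move=> x U /nbhs_ballP[e /= e0 eU]; exists e.
exact: separable_subproof.
Qed.

HB.instance Definition _ :=
  Topological_isSeparable.Build supp_space supp_separable.

Let supp_dist (x y : supp_space) : R := mdist (supp_val x) (supp_val y).

Let supp_dist_ge0 x y : (0 <= supp_dist x y)%R.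
Proof. exact: mdist_ge0. Qed.

Let supp_dist_positivity x y : supp_dist x y = 0%R -> x = y.
Proof. by move/mdist_positivity/supp_val_inj. Qed.

Let supp_ballEmdist (x : supp_space) d :
  ball x d = [set y | (supp_dist x y < d)%R].
Proof.
have -> : ball x d = val @^-1` (ball (val x) d) :> set supp_space by [].
by rewrite ballEmdist.
Qed.

HB.instance Definition _ := PseudoMetric_isMetric.Build R supp_space
  supp_dist_ge0 supp_dist_positivity supp_ballEmdist.

Definition supp_measure (A : set (borel supp_space)) : \bar R :=
  mu (supp_val @` A).

Let measurable_image (A : set (borel supp_space)) :
  measurable A -> measurable (supp_val @` A : set (borel T)).
Proof.
pose M := [set B : set supp_space |
  measurable (supp_val @` B : set (borel T))].
have valT : supp_val @` setT = support.
  apply/seteqP; split => [_ [x _ <-]|x Sx]; first exact: supp_valP.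
  by exists (SigSub (mem_set Sx)).
have : smallest (sigma_algebra setT) (@open supp_space) `<=` M.
  apply: smallest_sub.
    split.
    - by rewrite /M /= image_set0; exact: measurable0.
    - move=> B MB; rewrite /M /=.
      have -> : supp_val @` (setT `\` B) =
          support `\` supp_val @` B.
        rewrite -valT; apply/seteqP; split => [_ [x [_ nBx] <-]|_ [[x _ <-] nBx]].
          by split; [exists x | move=> [y By /supp_val_inj yx]; apply: nBx; rewrite -yx].
        by exists x => //; split => // Bx; apply: nBx; exists x.
      by apply: measurableD => //; exact: measurable_support.
    - move=> F MF; rewrite /M /= image_bigcup.
      by apply: bigcupT_measurable => i; exact: MF.
  move=> _ [U oU <-]; rewrite /M /=.
  suff -> : supp_val @` (set_val @^-1` U) = U `&` support.
    by apply: measurableI; [exact: measurable_open|exact: measurable_support].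
  apply/seteqP; split => [_ [x Ux <-]|x [Ux Sx]].
    by split; [exact: Ux|exact: supp_valP].
  by exists (SigSub (mem_set Sx)).
by move=> + mA; apply.
Qed.

Let supp_measure0 : supp_measure set0 = 0.
Proof. by rewrite /supp_measure image_set0 measure0. Qed.

Let supp_measure_ge0 A : 0 <= supp_measure A.
Proof. exact: measure_ge0. Qed.

Let supp_measure_sigma_additive : semi_sigma_additive supp_measure.
Proof.
move=> F mF tF mUF; rewrite /supp_measure image_bigcup.
apply: measure_semi_sigma_additive.
- by move=> i; exact: measurable_image.
- apply/trivIsetP => i j _ _ ij; move/trivIsetP/(_ _ _ I I ij): tF => tF.
  rewrite -subset0 => _ [[x Fx <-] [y Fy /supp_val_inj yx]].
  by rewrite yx in Fy; have : (F i `&` F j) x by []; rewrite tF.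
- by rewrite -image_bigcup; exact: measurable_image.
Qed.

HB.instance Definition _ := isMeasure.Build _ _ _ supp_measure
  supp_measure0 supp_measure_ge0 supp_measure_sigma_additive.

Let supp_measureT : supp_measure setT = 1.
Proof.
rewrite -measure_support /supp_measure; congr (mu _).
apply/seteqP; split => [_ [x _ <-]|x Sx]; first exact: supp_valP.
by exists (SigSub (mem_set Sx)).
Qed.

HB.instance Definition _ :=
  Measure_isProbability.Build _ _ _ supp_measure supp_measureT.

Lemma supp_measure_full (U : set supp_space) :
  open U -> U !=set0 -> 0 < supp_measure U.
Proof.
move=> [V oV <-] [x Vx]; rewrite /supp_measure.
have -> : supp_val @` (set_val @^-1` V) = V `&` support.
  apply/seteqP; split => [_ [y Vy <-]|y [Vy Sy]].
    by split; [exact: Vy|exact: supp_valP].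
  by exists (SigSub (mem_set Sy)).
have -> : mu (V `&` support) = mu V.
  have mV := measurable_open oV.
  rewrite -[V in RHS](setIT V) -(setvU support) setIUr setUC measureU; first last.
  - by rewrite setIACA setICr setI0.
  - by apply: measurableI => //; apply: measurableC; exact: measurable_support.
  - by apply: measurableI => //; exact: measurable_support.
  rewrite -[LHS]adde0; congr (_ + _); apply/esym.
  apply: subset_measure0 (@subIsetr _ _ _) measure_supportC.
    by apply: measurableI => //; apply: measurableC; exact: measurable_support.
  by apply: measurableC; exact: measurable_support.
exact: (supp_valP oV Vx).
Qed.

End support.
Arguments supp_measure {R T} mu A.

Section hyperbolic_functions.
Context {R : realType}.
Implicit Types t u : R.

Definition sinh t : R := (expR t - expR (- t)) / 2.

Definition arcosh t : R := ln (t + Num.sqrt (t ^+ 2 - 1)).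

Let P t := t + Num.sqrt (t ^+ 2 - 1).

Let P_ge1 t : 1 <= t -> 1 <= P t.
Proof. by move=> t1; rewrite /P (le_trans t1) // lerDl sqrtr_ge0. Qed.

Let P_le t u : 1 <= t -> t <= u -> P t <= P u.
Proof.
move=> t1 tu; rewrite lerD // ler_wsqrtr // lerD2r lerXn2r // nnegrE; lra.
Qed.

Lemma expR_arcosh t : 1 <= t -> expR (arcosh t) = t + Num.sqrt (t ^+ 2 - 1).
Proof. by move=> t1; rewrite lnK // posrE (lt_le_trans _ (P_ge1 t1)). Qed.

Lemma arcosh_ge0 t : 1 <= t -> 0 <= arcosh t.
Proof. by move=> t1; rewrite ln_ge0 // P_ge1. Qed.

Lemma arcosh1 : arcosh 1 = 0.
Proof. by rewrite /arcosh expr1n subrr sqrtr0 addr0 ln1. Qed.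

Lemma arcosh_triangle a b c : 1 <= a -> 1 <= b -> 1 <= c ->
  (a * b - c) ^+ 2 <= (a ^+ 2 - 1) * (b ^+ 2 - 1) ->
  arcosh c <= arcosh a + arcosh b.
Proof.
move=> a1 b1 c1 abc.
have a2 : 0 <= a ^+ 2 - 1 by nra.
have b2 : 0 <= b ^+ 2 - 1 by nra.
set p := Num.sqrt (a ^+ 2 - 1); set q := Num.sqrt (b ^+ 2 - 1).
have p0 : 0 <= p by exact: sqrtr_ge0.
have q0 : 0 <= q by exact: sqrtr_ge0.
have pE : p ^+ 2 = a ^+ 2 - 1 by rewrite sqr_sqrtr.
have qE : q ^+ 2 = b ^+ 2 - 1 by rewrite sqr_sqrtr.
have cab : c <= a * b + p * q.
  rewrite -lerBlDl; apply: le_trans (ler_norm _) _.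
  rewrite -(@ler_pXn2r _ 2) ?nnegrE ?mulr_ge0 // exprMn pE qE.
  by rewrite real_normK ?num_real // -sqrrN opprB.
have PE : P (a * b + p * q) = P a * P b.
  rewrite /P -/p -/q.
  have -> : (a * b + p * q) ^+ 2 - 1 = (a * q + b * p) ^+ 2.
    have -> : (a * b + p * q) ^+ 2 - 1 =
      a ^+ 2 * b ^+ 2 + 2 * (a * b * p * q) + p ^+ 2 * q ^+ 2 - 1 by ring.
    have -> : (a * q + b * p) ^+ 2 =
      a ^+ 2 * q ^+ 2 + 2 * (a * b * p * q) + b ^+ 2 * p ^+ 2 by ring.
    by rewrite pE qE; ring.
  by rewrite sqrtr_sqr ger0_norm; [ring|nra].
have gt0 t : 1 <= t -> P t \is Num.pos.
  by move=> /P_ge1; rewrite posrE; exact: lt_le_trans.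
rewrite /arcosh -!/(P _) -lnM ?gt0 // -PE ler_ln ?gt0 ?P_le //.
by rewrite (le_trans c1).
Qed.

Lemma continuous_arcosh1 : {for 1, continuous arcosh}.
Proof.
rewrite /continuous_at /arcosh.
apply: (@continuous_comp _ _ _ P (@ln R)).
  rewrite /P; apply: cvgD; first exact: cvg_id.
  apply: continuous_comp; last exact: sqrt_continuous.
  by apply: cvgB; [exact: exprn_continuous|exact: cvg_cst].
by apply: continuous_ln; rewrite (lt_le_trans _ (P_ge1 _)).
Qed.

End hyperbolic_functions.

Section lorentz_form.
Context {R : realType} {n : nat}.
Implicit Types u v w : 'rV[R]_n.+1.

(* Coordinate 0 is the time coordinate. *)
Definition lform u v : R :=
  \sum_(i < n) u 0 (lift ord0 i) * v 0 (lift ord0 i) - u 0 0 * v 0 0.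

Let dot u v : R := \sum_(i < n) u 0 (lift ord0 i) * v 0 (lift ord0 i).

Lemma lformC u v : lform u v = lform v u.
Proof.
by rewrite /lform mulrC; congr (_ - _); apply: eq_bigr => i _; exact: mulrC.
Qed.

Lemma lformDl u v w : lform (u + v) w = lform u w + lform v w.
Proof.
rewrite /lform mxE mulrDl addrACA -opprD -big_split; congr (_ - _).
by apply: eq_bigr => i _; rewrite mxE mulrDl.
Qed.

Lemma lformZl (a : R) u w : lform (a *: u) w = a * lform u w.
Proof.
rewrite /lform mxE mulrBr mulrA mulr_sumr; congr (_ - _).
by apply: eq_bigr => i _; rewrite mxE mulrA.
Qed.

Lemma lformDr u v w : lform u (v + w) = lform u v + lform u w.
Proof. by rewrite lformC lformDl !(lformC u). Qed.

Lemma lformZr (a : R) u w : lform u (a *: w) = a * lform u w.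
Proof. by rewrite lformC lformZl lformC. Qed.

Let dot_ge0 u : 0 <= dot u u.
Proof. by apply: sumr_ge0 => i _; rewrite -expr2 sqr_ge0. Qed.

Let lformE u v : lform u v = dot u v - u 0 0 * v 0 0. Proof. by []. Qed.

Let discriminant (a b c : R) :
  (forall s t : R, 0 <= a * s ^+ 2 + 2 * b * s * t + c * t ^+ 2) ->
  b ^+ 2 <= a * c.
Proof.
move=> H.
have a0 : 0 <= a by have := H 1 0; rewrite expr1n expr0n /=; lra.
have c0 : 0 <= c by have := H 0 1; rewrite expr1n expr0n /=; lra.
have h1 : 0 <= c * (a * c - b ^+ 2) by have := H c (- b); nra.
have h2 : 0 <= a * (a * c - b ^+ 2) by have := H (- b) a; nra.
have h3 : 0 <= (a + c) * (a * c - b ^+ 2) by nra.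
rewrite -subr_ge0; have [ac|] := ltrP 0 (a + c).
  by rewrite -(pmulr_rge0 _ ac).
move=> ac; have a00 : a = 0 by lra.
have c00 : c = 0 by lra.
by have := H 1 (- b); rewrite a00 c00; nra.
Qed.

Let dot_cs u v : dot u v ^+ 2 <= dot u u * dot v v.
Proof.
apply: discriminant => s t.
have -> : dot u u * s ^+ 2 + 2 * dot u v * s * t + dot v v * t ^+ 2 =
    dot (s *: u + t *: v) (s *: u + t *: v).
  rewrite /dot mulr_suml mulr_sumr !mulr_suml -!big_split /=.
  by apply: eq_bigr => i _; rewrite !mxE; ring.
exact: dot_ge0.
Qed.

Definition is_hyp u := (lform u u == -1) && (0 < u 0 0).

Lemma is_hyp_form u : is_hyp u -> lform u u = -1.
Proof. by case/andP => /eqP. Qed.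

Lemma is_hyp_gt0 u : is_hyp u -> 0 < u 0 0. Proof. by case/andP. Qed.

Let is_hyp_dot u : is_hyp u -> dot u u = u 0 0 ^+ 2 - 1.
Proof. by move=> /is_hyp_form; rewrite lformE; lra. Qed.

Lemma is_hyp_ge1 u : is_hyp u -> 1 <= u 0 0.
Proof.
move=> hu; have := dot_ge0 u; have := is_hyp_gt0 hu; rewrite is_hyp_dot //.
nra.
Qed.

Lemma lform_hyp_ge1 u v : is_hyp u -> is_hyp v -> 1 <= - lform u v.
Proof.
move=> hu hv; have u1 := is_hyp_ge1 hu; have v1 := is_hyp_ge1 hv.
have := dot_cs u v; rewrite !is_hyp_dot // lformE => cs.
suff : `|dot u v| <= u 0 0 * v 0 0 - 1.
  by move=> /(le_trans (ler_norm _)); lra.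
have uv : 1 <= u 0 0 * v 0 0 by nra.
rewrite -(@ler_pXn2r _ 2) ?nnegrE //; last lra.
rewrite real_normK ?num_real //; have := sqr_ge0 (u 0 0 - v 0 0); nra.
Qed.

(* A vector orthogonal to a point of the hyperboloid is spacelike, and its
   Euclidean size is controlled by its Lorentz norm. *)
Let dot_orth u w : is_hyp u -> lform w u = 0 ->
  w 0 0 ^+ 2 <= dot w w /\ dot w w <= u 0 0 ^+ 2 * lform w w.
Proof.
move=> hu; rewrite !lformE => /eqP; rewrite subr_eq0 => /eqP wu.
have := dot_cs w u; rewrite wu (is_hyp_dot hu) => cs.
have u1 := is_hyp_ge1 hu; have w0 := dot_ge0 w.
have h : dot w w <= u 0 0 ^+ 2 * (dot w w - w 0 0 * w 0 0) by nra.
split => //; have : 0 <= u 0 0 ^+ 2 * (dot w w - w 0 0 * w 0 0) by lra.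
by rewrite pmulr_rge0; [lra|nra].
Qed.

Lemma lform_orth_ge0 u w : is_hyp u -> lform w u = 0 -> 0 <= lform w w.
Proof. by move=> hu /(dot_orth hu)[]; rewrite lformE; lra. Qed.

Lemma lform_hyp_triangle u v w : is_hyp u -> is_hyp v -> is_hyp w ->
  (lform u v * lform v w + lform u w) ^+ 2 <=
    (lform u v ^+ 2 - 1) * (lform v w ^+ 2 - 1).
Proof.
move=> hu hv hw.
have vv := is_hyp_form hv; have uu := is_hyp_form hu; have ww := is_hyp_form hw.
pose a := u + lform u v *: v; pose b := w + lform v w *: v.
have av : lform a v = 0 by rewrite /a lformDl lformZl vv; ring.
have bv : lform b v = 0 by rewrite /b lformDl lformZl vv lformC; ring.
have Ea x : lform x a = lform x u + lform u v * lform x v.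
  by rewrite -lformZr -lformDr.
have Eb x : lform x b = lform x w + lform v w * lform x v.
  by rewrite -lformZr -lformDr.
have -> : lform u v * lform v w + lform u w = lform a b.
  by rewrite Eb av /a lformDl lformZl; ring.
have -> : lform u v ^+ 2 - 1 = lform a a.
  by rewrite Ea av /a lformDl lformZl uu (lformC v u); ring.
have -> : lform v w ^+ 2 - 1 = lform b b.
  by rewrite Eb bv /b lformDl lformZl ww; ring.
clearbody a b; apply: discriminant => s t.
have -> : lform a a * s ^+ 2 + 2 * lform a b * s * t + lform b b * t ^+ 2 =
    lform (s *: a + t *: b) (s *: a + t *: b).
  by rewrite !(lformDl, lformDr, lformZl, lformZr) (lformC b a); ring.
by apply: (lform_orth_ge0 hv); rewrite lformDl !lformZl av bv; ring.
Qed.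

Lemma hyp_coord_le u v i : is_hyp u -> is_hyp v ->
  `|u 0 i - v 0 i| <= v 0 0 * (expR (arcosh (- lform u v)) - 1).
Proof.
move=> hu hv; have t1 := lform_hyp_ge1 hu hv; rewrite expR_arcosh //.
set t := - lform u v in t1 *; pose w := u - t *: v.
have vv := is_hyp_form hv; have v1 := is_hyp_ge1 hv.
have wv : lform w v = 0.
  by rewrite /w -scaleNr lformDl lformZl vv /t; ring.
have ww : lform w w = t ^+ 2 - 1.
  have -> : lform w w = lform w u + (- t) * lform w v.
    by rewrite -lformZr -lformDr scaleNr.
  rewrite wv /w -scaleNr lformDl lformZl (is_hyp_form hu) (lformC v u) /t.
  by ring.
have [w0 w1] := dot_orth hv wv.
have coord_le (x : 'rV[R]_n.+1) (d : R) :
    x 0 0 ^+ 2 <= d ^+ 2 -> dot x x <= d ^+ 2 -> 0 <= d -> `|x 0 i| <= d.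
  move=> x0 xd d0; rewrite -(@ler_pXn2r _ 2) ?nnegrE //.
  rewrite real_normK ?num_real //; case: (unliftP ord0 i) => [j|] -> //.
  apply: le_trans xd; rewrite /dot (bigD1 j) //= -expr2 lerDl.
  by apply: sumr_ge0 => k _; rewrite -expr2 sqr_ge0.
have t2 : 0 <= t ^+ 2 - 1 by nra.
set r := Num.sqrt (t ^+ 2 - 1).
have r0 : 0 <= r by exact: sqrtr_ge0.
have rE : r ^+ 2 = t ^+ 2 - 1 by rewrite sqr_sqrtr.
have wi : `|w 0 i| <= v 0 0 * r.
  apply: coord_le; last by rewrite mulr_ge0 //; lra.
    by rewrite exprMn rE -ww; exact: le_trans w1.
  by rewrite exprMn rE -ww.
have vi : `|v 0 i| <= v 0 0.
  by apply: coord_le; rewrite ?is_hyp_dot //; lra.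
have -> : u 0 i - v 0 i = w 0 i + (t - 1) * v 0 i by rewrite !mxE; ring.
apply: le_trans (ler_normD _ _) _; rewrite normrM (@ger0_norm _ (t - 1)).
  have := normr_ge0 (v 0 i); nra.
lra.
Qed.

End lorentz_form.

Section hyperbolic_space.
Context (R : realType) (n : nat).

(* The hyperboloid model of the n-dimensional hyperbolic space of constant
   curvature -1. *)
Record hyp : Type := Hyp {
  hyp_val :> 'rV[R]_n.+1;
  hyp_valP : is_hyp hyp_val
}.

HB.instance Definition _ := [isSub for hyp_val].
HB.instance Definition _ := [Choice of hyp by <:].

Let is_hyp_base : is_hyp (delta_mx 0 0 : 'rV[R]_n.+1).
Proof.
rewrite /is_hyp /lform big1 => [|i _]; last by rewrite !mxE mul0r.
by rewrite !mxE /= mulr1 sub0r eqxx ltr01.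
Qed.

HB.instance Definition _ := isPointed.Build hyp (Hyp is_hyp_base).

Definition hdist (x y : hyp) : R := arcosh (- lform x y).

Let hdistxx x : hdist x x = 0.
Proof. by rewrite /hdist (is_hyp_form (hyp_valP x)) opprK arcosh1. Qed.

Let hdist_positivity x y : hdist x y = 0 -> x = y.
Proof.
move=> xy0; apply/val_inj/rowP => i; apply/eqP; rewrite -subr_eq0 -normr_le0.
apply: le_trans (hyp_coord_le i (hyp_valP x) (hyp_valP y)) _.
by rewrite -/(hdist x y) xy0 expR0 subrr mulr0.
Qed.

Let hdist_sym x y : hdist x y = hdist y x.
Proof. by rewrite /hdist lformC. Qed.

Let hdist_triangle y x z : hdist x z <= hdist x y + hdist y z.
Proof.
have [hx hy hz] := And3 (hyp_valP x) (hyp_valP y) (hyp_valP z).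
apply: arcosh_triangle; rewrite ?lform_hyp_ge1 // !sqrrN mulrNN opprK.
exact: lform_hyp_triangle.
Qed.

HB.instance Definition _ :=
  isMetric.Build R hyp hdistxx hdist_positivity hdist_sym hdist_triangle.

Let cvg_sumr (I : Type) (r : seq I) (T : Type) (F : set_system T)
    {FF : Filter F} (f : I -> T -> R) (l : I -> R) :
  (forall i, f i @ F --> l i) ->
  (fun x => \sum_(i <- r) f i x) @ F --> \sum_(i <- r) l i.
Proof.
move=> fl; elim: r => [|i r IHr].
  by under eq_fun do rewrite big_nil; rewrite big_nil; exact: cvg_cst.
by under eq_fun do rewrite big_cons; rewrite big_cons; exact: cvgD.
Qed.

Lemma cvg_lform (T : Type) (F : set_system T) {FF : Filter F}
    (f g : T -> 'rV[R]_n.+1) (u v : 'rV[R]_n.+1) :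
  f @ F --> u -> g @ F --> v ->
  (fun t => lform (f t) (g t)) @ F --> lform u v.
Proof.
move=> fu gv.
have cf i : (fun t => f t 0 i) @ F --> u 0 i.
  exact: (cvg_comp _ _ fu (@coord_continuous R _ _ 0 i u)).
have cg i : (fun t => g t 0 i) @ F --> v 0 i.
  exact: (cvg_comp _ _ gv (@coord_continuous R _ _ 0 i v)).
apply: cvgB; last exact: cvgM.
by apply: cvg_sumr => i; exact: cvgM.
Qed.

Lemma continuous_lform (u : 'rV[R]_n.+1) : continuous (lform u).
Proof.
move=> v; apply: (@cvg_lform _ (nbhs v) _ (fun=> u) id u v).
  exact: cvg_cst.
exact: cvg_id.
Qed.

Lemma near_hyp (x : hyp) (e : R) : 0 < e ->
  \forall v \near (x : 'rV[R]_n.+1), `|arcosh (- lform x v)| < e.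
Proof.
move=> e0.
have : (fun v => arcosh (- lform x v)) @ (x : 'rV[R]_n.+1) --> (0 : R).
  have <- : arcosh (- lform x x) = 0 by exact: hdistxx.
  apply: (@continuous_comp _ _ _ (fun v => - lform x v) arcosh).
    exact: (cvgN (@continuous_lform (hyp_val x) (hyp_val x))).
  rewrite (is_hyp_form (hyp_valP x)) opprK; exact: continuous_arcosh1.
by move=> /cvgr0Pnorm_lt; apply.
Qed.

Let hyp_complete (F : set_system hyp) : ProperFilter F -> cauchy F -> cvg F.
Proof.
move=> PF /(@cauchy_ballP R hyp) cF.
pose G := hyp_val @ F.
have PG : ProperFilter G by exact: fmap_proper_filter.
have [z Fz] : exists z, \forall x \near F, hdist z x < 1.
  have [[A B] [/= FA FB] AB] := cF 1 ltr01.
  have [z Az] := filter_ex FA.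
  by exists z; apply: filterS FB => x Bx; have := AB (z, x) (conj Az Bx).
have z1 := is_hyp_ge1 (hyp_valP z).
pose M := z 0 0 * expR 1.
have M0 : 0 < M by rewrite mulr_gt0 ?expR_gt0 //; lra.
have zM x : hdist z x < 1 -> x 0 0 <= M.
  move=> zx; have := hyp_coord_le 0 (hyp_valP x) (hyp_valP z).
  rewrite -/(hdist x z) hdist_sym => /(le_trans (ler_norm _)).
  rewrite mulrBr mulr1 lerBlDr subrK => /le_trans; apply.
  by rewrite /M ler_pM2l ?ler_expR ?ltW //; lra.
have cG : cauchy G.
  apply/(@cauchy_ballP R) => e e0; rewrite near_map2.
  pose d := ln (1 + e / M).
  have eM : 0 < e / M by rewrite divr_gt0.
  have d0 : 0 < d by rewrite ln_gt0 // ltrDl.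
  have [[A B] [/= FA FB] AB] := cF d d0.
  exists (A, B `&` [set x | hdist z x < 1]).
    by split => //=; exact: filterI.
  move=> [x y] [/= Ax [By zy]]; split => // i j; rewrite ord1.
  have xy : hdist x y < d by have := AB (x, y) (conj Ax By).
  rewrite /ball /=.
  apply: le_lt_trans (hyp_coord_le j (hyp_valP x) (hyp_valP y)) _.
  have yM := zM _ zy; have y1 := is_hyp_ge1 (hyp_valP y).
  have xy1 : 1 <= expR (hdist x y).
    by rewrite -expR0 ler_expR arcosh_ge0 // lform_hyp_ge1 ?hyp_valP.
  apply: (@le_lt_trans _ _ (M * (expR (hdist x y) - 1))).
    by rewrite ler_wpM2r // subr_ge0.
  rewrite mulrC -ltr_pdivlMr // ltrBlDl.
  rewrite -(@lnK _ (1 + e / M)) ?ltr_expR //.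
  by rewrite posrE; lra.
have [v Gv] : exists v : 'rV[R]_n.+1, G --> v by apply/cvg_ex; exact: cauchy_cvg.
have hv : is_hyp v.
  rewrite /is_hyp; apply/andP; split.
    have lv : (fun x : hyp => lform x x) @ F --> lform v v.
      exact: (@cvg_lform _ F _ hyp_val hyp_val v v Gv Gv).
    apply/eqP; apply: (@closed_cvg _ _ F _ (fun x : hyp => lform x x)
      (fun y => y = -1) (@closed_eq R (-1)) _ _ lv).
    by apply: nearW => x; exact: is_hyp_form (hyp_valP x).
  apply: (@lt_le_trans _ _ 1) => //.
  apply: (@closed_cvg _ _ F _ (fun x : hyp => x 0 0) (fun y => 1 <= y)
    (@closed_ge R 1) _ _ (cvg_comp _ _ Gv (@coord_continuous R _ _ 0 0 v))).
  by apply: nearW => x; exact: is_hyp_ge1 (hyp_valP x).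
apply/cvg_ex; exists (Hyp hv).
apply/(@cvg_ballP R hyp) => e e0.
have := Gv _ (near_hyp (Hyp hv) e0).
move=> FB; apply: (@filterS _ F _ _ _ _ FB) => x /=.
rewrite ballEmdist /=; by move=> /(le_lt_trans (ler_norm _)).
Qed.

HB.instance Definition _ := Uniform_isComplete.Build hyp hyp_complete.

Let hyp_separable : separable hyp.
Proof.
apply: (@separable_of_map R hyp 'rV[R]_n.+1 hyp_val); last exact: separable_rV.
move=> x U /nbhs_ballP[e /= e0 eU].
have /nbhs_ballP[d /= d0 dU] := near_hyp x e0.
exists d => // y xy; apply: eU; have := dU _ xy.
by move=> /(le_lt_trans (ler_norm _)).
Qed.

HB.instance Definition _ := Topological_isSeparable.Build hyp hyp_separable.

End hyperbolic_space.

Lemma hyp_mdistE (R : realType) (n : nat) (x y : hyp R n) :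
  mdist x y = arcosh (- lform x y).
Proof. by []. Qed.

Lemma scaled_mdistE (R : realType) (s : {posnum R}) (T : csMetricType R)
    (x y : scaled s T) : mdist x y = s%:num * mdist (x : T) (y : T).
Proof. by []. Qed.

Lemma supp_mdistE (R : realType) (T : csMetricType R)
    (mu : probability (borel T) R) (x y : supp_space mu) :
  mdist x y = mdist (supp_val x) (supp_val y).
Proof. by []. Qed.

Section mm_spaces.
Context {R : realType}.
Local Open Scope ereal_scope.

Record mmSpace := MMSpace {
  mm_space :> csMetricType R;
  mm_measure : probability (borel mm_space) R;
  mm_full_support : forall U : set mm_space,
    open U -> U !=set0 -> 0 < mm_measure U
}.

Definition mm_supp (T : csMetricType R) (mu : probability (borel T) R) :
    mmSpace :=
  @MMSpace (supp_space mu) (supp_measure mu) (@supp_measure_full R T mu).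

Definition mm_scale (s : {posnum R}) (X : mmSpace) : mmSpace :=
  @MMSpace (scaled s X) (mm_measure X) (@mm_full_support X).

(* dominates X Y means Y ≺ X. *)
Definition dominates (X Y : mmSpace) : Prop := exists f : X -> Y,
  (forall x x', (mdist (f x) (f x') <= mdist x x')%R) /\
  (forall A : set (borel Y), measurable A ->
    mm_measure X (f @^-1` A) = mm_measure Y A).

Definition is_coupling (X Y : mmSpace)
    (pi : probability (borel (X * Y)%type) R) : Prop :=
  (forall A : set (borel X), measurable A ->
    pi (fst @^-1` A) = mm_measure X A) /\
  (forall B : set (borel Y), measurable B ->
    pi (snd @^-1` B) = mm_measure Y B).

Definition distortion (X Y : mmSpace) (S : set (X * Y)) : \bar R :=
  ereal_sup [set `|mdist p.1 q.1 - mdist p.2 q.2|%R%:E | p in S & q in S].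

(* S = set0 contributes the value 1, so box is a real number in [0, 1]. *)
Definition box (X Y : mmSpace) : \bar R :=
  ereal_inf [set r | exists (pi : probability (borel (X * Y)%type) R)
                            (S : set (X * Y)),
    [/\ is_coupling pi, closed S & r = maxe (1 - pi S) (distortion S)]].

(* Families of mm-spaces are predicates rather than terms of type set mmSpace:
   mmSpace is too large for the universe of set. *)
Definition mmFamily := mmSpace -> Prop.

Definition box_closed (Q : mmFamily) : Prop := forall Y,
  (forall e : R, (0 < e)%R -> exists2 Z, Q Z & box Z Y < e%:E) -> Q Y.

Definition is_pyramid (Q : mmFamily) : Prop :=
  [/\ exists X, Q X,
      box_closed Q,
      forall X Y, Q X -> dominates X Y -> Q Y &
      forall X X', Q X -> Q X' ->
        exists Y, [/\ Q Y, dominates Y X & dominates Y X']].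

Definition pyramid_of (X : mmSpace) : mmFamily := fun Y => dominates X Y.

Definition diameter (X : mmSpace) : \bar R :=
  ereal_sup [set (mdist x y)%:E | x in [set: X] & y in [set: X]].

Definition pyramid_le (D : R) : mmFamily := fun X => diameter X <= D%:E.

(* Weak convergence of pyramids; the two clauses do not involve the axioms of
   is_pyramid and are stated for arbitrary families. *)
Definition pyramid_cvg (Q : nat -> mmFamily) (Q0 : mmFamily) : Prop :=
  (forall Y, Q0 Y -> exists Z : nat -> mmSpace,
    (forall n, Q n (Z n)) /\ box (Z n) Y @[n --> \oo] --> 0) /\
  (forall (k : nat -> nat) (Z : nat -> mmSpace) Y,
    {homo k : i j / (i < j)%N} -> (forall i, Q (k i) (Z i)) ->
    box (Z i) Y @[i --> \oo] --> 0 -> Q0 Y).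

End mm_spaces.
Arguments mmSpace : clear implicits.
Arguments mmFamily : clear implicits.

Section hyperbolic_geometry.
Context {R : realType} {n : nat}.

Definition isometry (g : hyp R n -> hyp R n) : Prop :=
  bijective g /\ forall x y, mdist (g x) (g y) = mdist x y.

Definition radial (o : hyp R n) (mu : probability (borel (hyp R n)) R) : Prop :=
  forall g, isometry g -> g o = o ->
  forall A : set (borel (hyp R n)), measurable A -> mu (g @^-1` A) = mu A.

(* For v spacelike (0 < lform v v) these sets are exactly the totally geodesic
   hyperplanes; v also selects the side {x | 0 < lform x v}. *)
Definition hyperplane (v : 'rV[R]_n.+1) : set (hyp R n) :=
  [set x | lform x v = 0].

Definition signed_dist (v : 'rV[R]_n.+1) (x : hyp R n) : R :=
  let d := inf [set mdist x y | y in hyperplane v] in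
  if 0 <= lform x v then d else - d.

End hyperbolic_geometry.

Section distributions.
Context {R : realType}.

Definition cvg_in_distribution (nu : nat -> set R -> \bar R)
    (nu0 : set R -> \bar R) : Prop :=
  forall f : R -> R, continuous f -> (exists M, forall x, `|f x| <= M) ->
  (\int[nu n]_x (f x)%:E)%E @[n --> \oo] --> (\int[nu0]_x (f x)%:E)%E.

Definition half_dirac (a b : R) : {measure set R -> \bar R} :=
  measure_add (mscale (2^-1)%:nng \d_a) (mscale (2^-1)%:nng \d_b).

(* a_+ for a < +oo, with (-oo)_+ = 0. *)
Definition pos_part (a : \bar R) : R := fine (maxe a 0%E).

End distributions.

(* Main.v *)
Require Import Defs.
From HB Require Import structures.
From mathcomp Require Import all_boot all_order all_algebra.
From mathcomp Require Import all_classical all_reals all_analysis.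
From mathcomp Require Import measurable_realfun ring lra.

Set Implicit Arguments.
Unset Strict Implicit.
Unset Printing Implicit Defensive.

Import Order.TTheory GRing.Theory Num.Theory.
Import numFieldNormedType.Exports.

Local Open Scope classical_set_scope.
Local Open Scope ring_scope.

(** Why the theorem holds. Write [alpha = pos_part a]. A point of the hyperbolic space
   is described by its distance [r] to [o] and by a unit vector, its direction
   ([chart], [dir]). Radiality says that the law of the direction is invariant
   under reflections, conditionally on [r]. By the hyperbolic law of cosines
   ([expR_mdist_le], [expR_mdist_ge]), two points of radius [r] whose directions
   are at distance [c] have hyperbolic distance about [2 * log (1 + c * sinh r)].
   Directions in dimension [n] have two scales: generic ones are at distance of
   order [1], but everything that concentration of measure sees happens at
   distance [1 / sqrt n]. Since [s_n * log (1 + sinh rho_n / sqrt n)] tends to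
   [alpha] ([near_log1p]), the latter scale becomes the distance [2 * alpha] after
   multiplication by [s_n], where multiplicative constants disappear because
   [s_n] tends to [0].

   Upper bound. Any two sets of mass at least [delta] contain points whose
   directions are at distance [O(1 / sqrt (delta * n))] ([close_directions]). This
   is concentration on the sphere ([mean_concentration]), obtained by polarization:
   among the [1]-Lipschitz functions with given moments, one that maximises the
   correlation with a coordinate must be a nondecreasing function of it, since
   otherwise exchanging values across a mirror would improve it, and a coordinate
   has variance [1 / n]. Working with near maximisers and reflections avoids all
   compactness and any explicit measure on the sphere. So two sets of mass
   [delta] are at scaled distance at most [2 * alpha + o(1)] ([near_separation]),
   and this separation bound passes to dominated spaces and to limits for the box
   distance ([box_separation], [limit_diameter]).

   Lower bound. Differences of coordinates of the direction are rarely smaller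
   than [c / sqrt n] ([small_coordinate]), so that the cells on which the [i]-th of
   [N] coordinates is the largest by such a margin have equal masses, almost full
   total mass, and mutual scaled distance at least [2 * alpha - o(1)]
   ([near_separated_cells]). A space [Y] of diameter at most [2 * alpha] is cut into
   small pieces, to which the cells are distributed in proportion to the masses.
   The distances to the pieces of [Y], read on the cells, are [1]-Lipschitz because
   the cells are so far apart; they extend to the whole space, and the metric that
   they induce there gives a dominated space close to [Y] ([near_approximation],
   [box_le_cells]).

   Signed distance. The distance to a hyperplane is about the logarithm of [sinh r]
   times a coordinate, which has order [1 / sqrt n]; after scaling its absolute
   value tends to [alpha] ([near_signed_dist]). Reflection in the hyperplane makes
   the law of the signed distance symmetric, which fixes the limit
   ([cvg_signed_dist]). *)

(** * Euclidean geometry of the sphere *)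

Section euclid.
Context {R : realType} {n : nat}.
Implicit Types (u v w x y z : 'rV[R]_n) (a : R).

Definition dot u v : R := \sum_i u 0 i * v 0 i.

Definition enorm u : R := Num.sqrt (dot u u).

Lemma dotC u v : dot u v = dot v u.
Proof. by apply: eq_bigr => i _; rewrite mulrC. Qed.

Lemma dotDl u v w : dot (u + v) w = dot u w + dot v w.
Proof. by rewrite /dot -big_split; apply: eq_bigr => i _; rewrite mxE mulrDl. Qed.

Lemma dotZl a u w : dot (a *: u) w = a * dot u w.
Proof. by rewrite /dot mulr_sumr; apply: eq_bigr => i _; rewrite mxE mulrA. Qed.

Lemma dotDr u v w : dot u (v + w) = dot u v + dot u w.
Proof. by rewrite dotC dotDl !(dotC u). Qed.

Lemma dotZr a u w : dot u (a *: w) = a * dot u w.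
Proof. by rewrite dotC dotZl dotC. Qed.

Lemma dotNl u w : dot (- u) w = - dot u w.
Proof. by rewrite -scaleN1r dotZl mulN1r. Qed.

Lemma dotNr u w : dot u (- w) = - dot u w.
Proof. by rewrite dotC dotNl dotC. Qed.

Lemma dot0l w : dot 0 w = 0.
Proof. by rewrite -(scale0r 0) dotZl mul0r. Qed.

Definition dotE := (dotDl, dotDr, dotZl, dotZr, dotNl, dotNr).

Lemma dot_ge0 u : 0 <= dot u u.
Proof. by apply: sumr_ge0 => i _; rewrite -expr2 sqr_ge0. Qed.

Lemma dot_eq0 u : dot u u = 0 -> u = 0.
Proof.
move=> u0; apply/rowP => i; rewrite mxE; apply/eqP; rewrite -sqrf_eq0.
have := u0; rewrite /dot => /psumr_eq0P => /(_ _ i isT); rewrite -expr2 => -> //.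
by move=> j _; rewrite -expr2 sqr_ge0.
Qed.

Lemma enorm_ge0 u : 0 <= enorm u. Proof. exact: sqrtr_ge0. Qed.

Lemma sqr_enorm u : enorm u ^+ 2 = dot u u.
Proof. by rewrite sqr_sqrtr // dot_ge0. Qed.

Lemma enorm_eq0 u : enorm u = 0 -> u = 0.
Proof. by move=> u0; apply: dot_eq0; rewrite -sqr_enorm u0 expr0n. Qed.

Lemma enorm_gt0 u : u != 0 -> 0 < enorm u.
Proof.
by move=> u0; rewrite lt_def enorm_ge0 andbT; apply: contraNneq u0 => /enorm_eq0 ->.
Qed.

Lemma enorm0 : enorm 0 = 0. Proof. by rewrite /enorm dot0l sqrtr0. Qed.

Lemma enormZ a u : enorm (a *: u) = `|a| * enorm u.
Proof.
rewrite /enorm dotZl dotZr mulrA -expr2 sqrtrM ?sqr_ge0 //.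
by rewrite sqrtr_sqr.
Qed.

Lemma enormN u : enorm (- u) = enorm u.
Proof. by rewrite -scaleN1r enormZ normrN1 mul1r. Qed.

Lemma enormC u v : enorm (u - v) = enorm (v - u).
Proof. by rewrite -enormN opprB. Qed.

Lemma cauchy_schwarz_sqr u v : dot u v ^+ 2 <= dot u u * dot v v.
Proof.
have [v0|vn0] := eqVneq (dot v v) 0.
  by rewrite v0 (dot_eq0 v0) dotC dot0l expr0n mulr0.
have vp : 0 < dot v v by rewrite lt_def vn0 dot_ge0.
have := dot_ge0 (dot v v *: u - dot u v *: v).
have -> : dot (dot v v *: u - dot u v *: v) (dot v v *: u - dot u v *: v) =
  dot v v * (dot u u * dot v v - dot u v ^+ 2) by rewrite !dotE (dotC v u); ring.
by rewrite pmulr_rge0 // subr_ge0.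
Qed.

Lemma cauchy_schwarz u v : `|dot u v| <= enorm u * enorm v.
Proof.
rewrite -(@ler_pXn2r _ 2) ?nnegrE ?mulr_ge0 ?enorm_ge0 //.
by rewrite real_normK ?num_real // exprMn !sqr_enorm cauchy_schwarz_sqr.
Qed.

Lemma ler_enormD u v : enorm (u + v) <= enorm u + enorm v.
Proof.
have dn := ler_norm (dot u v); have cs := cauchy_schwarz u v.
rewrite -(@ler_pXn2r _ 2) ?nnegrE ?addr_ge0 ?enorm_ge0 // sqr_enorm !dotE.
rewrite (dotC v u) sqrrD !sqr_enorm.
lra.
Qed.

Lemma ler_enormB u v w : enorm (u - w) <= enorm (u - v) + enorm (v - w).
Proof. by rewrite (le_trans _ (ler_enormD _ _)) // addrA subrK. Qed.

Lemma enorm_unit u : dot u u = 1 -> enorm u = 1.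
Proof. by rewrite /enorm => ->; rewrite sqrtr1. Qed.

Definition normalize u : 'rV[R]_n := (enorm u)^-1 *: u.

Lemma normalize_unit u : u != 0 -> dot (normalize u) (normalize u) = 1.
Proof.
by move=> /enorm_gt0/lt0r_neq0 un; rewrite !dotE -sqr_enorm expr2; field.
Qed.

Lemma normalizeB_unit u v : v != u ->
  dot (normalize (u - v)) (normalize (u - v)) = 1.
Proof. by move=> vu; rewrite normalize_unit // subr_eq0 eq_sym. Qed.

Lemma normalizeK u : enorm u *: normalize u = u.
Proof.
have [->|u0] := eqVneq u 0; first by rewrite /normalize !scaler0.
by rewrite scalerA divff ?scale1r // gt_eqF // enorm_gt0.
Qed.

Lemma dist_unit u v : dot u u = 1 -> dot v v = 1 ->
  enorm (u - v) ^+ 2 = 2 - 2 * dot u v.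
Proof. by move=> u1 v1; rewrite sqr_enorm !dotE u1 v1 (dotC v u); ring. Qed.

Lemma enorm_le2 u v : dot u u = 1 -> dot v v = 1 -> enorm (u - v) <= 2.
Proof.
move=> u1 v1; apply: le_trans (ler_enormD _ _) _.
by rewrite enormN !enorm_unit.
Qed.

Definition refl u v : 'rV[R]_n := v - (2 * dot v u) *: u.

Lemma dot_refl u v w : dot u u = 1 -> dot (refl u v) (refl u w) = dot v w.
Proof. by move=> u1; rewrite /refl !dotE (dotC u w) u1; ring. Qed.

Lemma dot_refll u v w : dot (refl u v) w = dot v (refl u w).
Proof. by rewrite /refl !dotE (dotC u w); ring. Qed.

Lemma reflK u v : dot u u = 1 -> refl u (refl u v) = v.
Proof.
move=> u1; rewrite /refl !dotE u1 -addrA -opprD -scalerDl.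
have -> : 2 * dot v u + 2 * (dot v u - 2 * dot v u * 1) = 0 by ring.
by rewrite scale0r subr0.
Qed.

Lemma reflB u v w : refl u (v - w) = refl u v - refl u w.
Proof.
rewrite /refl !dotE.
rewrite mulrBr scalerBl; apply/rowP => i; rewrite !mxE; ring.
Qed.

Lemma reflZ u a v : refl u (a *: v) = a *: refl u v.
Proof. by rewrite /refl !dotE scalerBr scalerA; congr (_ - _ *: _); ring. Qed.

Lemma enorm_refl u v : dot u u = 1 -> enorm (refl u v) = enorm v.
Proof. by move=> u1; rewrite /enorm dot_refl. Qed.

Lemma refl_orth u v : dot v u = 0 -> refl u v = v.
Proof. by rewrite /refl => ->; rewrite mulr0 scale0r subr0. Qed.

(** Reflection in the perpendicular bisector of two points of a sphere. *)
Lemma refl_swap x y : x != y -> dot x x = dot y y ->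
  refl (normalize (y - x)) x = y.
Proof.
move=> xy xxyy.
have yx0 : y - x != 0 by rewrite subr_eq0 eq_sym.
have d0 : enorm (y - x) != 0 by rewrite gt_eqF // enorm_gt0.
rewrite /refl /normalize scalerA !dotE.
have -> : 2 * ((enorm (y - x))^-1 * (dot x y - dot x x)) / enorm (y - x) = -1.
  have E : enorm (y - x) ^+ 2 = - (2 * (dot x y - dot x x)).
    by rewrite sqr_enorm !dotE (dotC y x) -xxyy; ring.
  apply: (mulIf d0); apply: (mulIf d0); rewrite divfK // mulN1r mulNr -expr2 E.
  by rewrite opprK -mulrA mulrAC mulVf // mul1r.
by rewrite scaleN1r opprK addrC subrK.
Qed.

Definition lip1 (f : 'rV[R]_n -> R) := forall v w, `|f v - f w| <= enorm (v - w).

Lemma lip1_dist y : lip1 (fun v => enorm (v - y)).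
Proof.
move=> v w; rewrite ler_norml.
have := ler_enormB v w y; have := ler_enormB w v y; rewrite (enormC w v); lra.
Qed.

(** The unit vectors of the coordinate axes, indexed by [nat] so that no
   dependence on the dimension shows; only those with [i < n] are unit. *)
Definition axis (i : nat) : 'rV[R]_n := \row_j (j == i :> nat)%:R.

Lemma dot_axisr v (i : 'I_n) : dot v (axis i) = v 0 i.
Proof.
rewrite /dot (bigD1 i) //= mxE eqxx mulr1 big1 ?addr0 // => j ji.
by rewrite mxE (inj_eq val_inj) (negbTE ji) mulr0.
Qed.

Lemma dot_axis i j : (i < n)%N -> dot (axis i) (axis j) = (i == j)%:R.
Proof.
move=> i_n; rewrite dotC (dot_axisr _ (Ordinal i_n)) mxE /=.
by [].
Qed.

Lemma axis_unit i : (i < n)%N -> dot (axis i) (axis i) = 1.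
Proof. by move=> i_n; rewrite dot_axis // eqxx. Qed.

Lemma sum_dot_axis v : \sum_(i < n) dot v (axis i) ^+ 2 = dot v v.
Proof. by apply: eq_bigr => i _; rewrite dot_axisr expr2. Qed.

(** The functions integrated against an invariant mean: only their values on the
   unit sphere matter, and a common constant bounds them and their Lipschitz
   constant so that the class is stable under products. *)
Definition sphere_lip (f : 'rV[R]_n -> R) := exists K,
  (forall v, dot v v = 1 -> `|f v| <= K) /\
  (forall v w, dot v v = 1 -> dot w w = 1 -> `|f v - f w| <= K * enorm (v - w)).

Lemma sphere_lip_cst c : sphere_lip (fun=> c).
Proof.
exists `|c|; split => // v w _ _.
by rewrite subrr normr0 mulr_ge0 ?enorm_ge0.
Qed.

Lemma sphere_lipD f g :
  sphere_lip f -> sphere_lip g -> sphere_lip (fun v => f v + g v).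
Proof.
move=> [K [fK fL]] [M [gM gL]]; exists (K + M); split => [v v1|v w v1 w1].
  by apply: le_trans (ler_normD _ _) _; rewrite lerD ?fK ?gM.
rewrite opprD addrACA mulrDl; apply: le_trans (ler_normD _ _) _.
by rewrite lerD ?fL ?gL.
Qed.

Lemma sphere_lipM f g :
  sphere_lip f -> sphere_lip g -> sphere_lip (fun v => f v * g v).
Proof.
move=> [K [fK fL]] [M [gM gL]].
exists (K * M + K * M); split => [v v1|v w v1 w1].
  have := fK v v1; have := gM v v1.
  have := normr_ge0 (f v); have := normr_ge0 (g v); rewrite normrM; nra.
have -> : f v * g v - f w * g w = f v * (g v - g w) + g w * (f v - f w) by ring.
apply: le_trans (ler_normD _ _) _; rewrite !normrM mulrDl; apply: lerD.
  by rewrite -mulrA ler_pM ?fK ?gL.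
by rewrite [K * M]mulrC -mulrA ler_pM ?gM ?fL.
Qed.

Lemma sphere_lipZ c f : sphere_lip f -> sphere_lip (fun v => c * f v).
Proof. exact: (sphere_lipM (sphere_lip_cst c)). Qed.

Lemma sphere_lipB f g :
  sphere_lip f -> sphere_lip g -> sphere_lip (fun v => f v - g v).
Proof.
move=> hf /(sphere_lipZ (-1)) /(sphere_lipD hf) h.
by under eq_fun do rewrite -[_ - _]/(_ + - _) -mulN1r.
Qed.

Lemma sphere_lipX f k : sphere_lip f -> sphere_lip (fun v => f v ^+ k).
Proof.
move=> hf; elim: k => [|k IH].
  by under eq_fun do rewrite expr0; exact: sphere_lip_cst.
by under eq_fun do rewrite exprS; exact: sphere_lipM.
Qed.

Lemma sphere_lip_sum (J : Type) (r : seq J) (f : J -> 'rV[R]_n -> R) :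
  (forall j, sphere_lip (f j)) -> sphere_lip (fun v => \sum_(j <- r) f j v).
Proof.
move=> fr; elim: r => [|j r IH].
  by under eq_fun do rewrite big_nil; exact: sphere_lip_cst.
by under eq_fun do rewrite big_cons; exact: sphere_lipD.
Qed.

Lemma sphere_lip_refl u f : dot u u = 1 ->
  sphere_lip f -> sphere_lip (fun v => f (refl u v)).
Proof.
move=> u1 [K [fK fL]]; exists K; split => [v v1|v w v1 w1].
  by apply: fK; rewrite dot_refl.
rewrite -(enorm_refl (v - w) u1) reflB.
by apply: fL; rewrite dot_refl.
Qed.

Lemma sphere_lip_dot e : sphere_lip (fun v => dot v e).
Proof.
exists (enorm e); split => [v v1|v w v1 w1].
  by apply: le_trans (cauchy_schwarz _ _) _; rewrite enorm_unit // mul1r.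
rewrite -dotNl -dotDl; apply: le_trans (cauchy_schwarz _ _) _.
by rewrite mulrC.
Qed.

Lemma lip1_sphere_lip f : lip1 f -> sphere_lip f.
Proof.
move=> fl; exists (`|f 0| + 1); split => [v v1|v w v1 w1].
  have := fl v 0; rewrite subr0 enorm_unit // => fv.
  have := ler_normD (f v - f 0) (f 0); rewrite subrK; lra.
apply: le_trans (fl v w) _; rewrite mulrDl mul1r lerDr mulr_ge0 //.
exact: enorm_ge0.
Qed.

End euclid.

(** * Reflection-invariant means on the sphere *)

(** What is used of the law of the direction of a random point: it is a positive
   functional invariant under reflections. This determines its low moments
   without any construction of the uniform measure on the sphere. *)
Record invariant_mean (R : realType) (n : nat) (I : ('rV[R]_n -> R) -> R) :
    Prop := {
  mean_add : forall f g, sphere_lip f -> sphere_lip g ->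
    I (fun v => f v + g v) = I f + I g;
  mean_scale : forall c f, sphere_lip f -> I (fun v => c * f v) = c * I f;
  mean_le : forall f g, sphere_lip f -> sphere_lip g ->
    (forall v, dot v v = 1 -> f v <= g v) -> I f <= I g;
  mean_refl : forall u f, dot u u = 1 -> sphere_lip f ->
    I (fun v => f (refl u v)) = I f
}.

Section invariant_mean.
Context {R : realType} {n : nat} (I : ('rV[R]_n -> R) -> R).
Hypothesis IM : invariant_mean I.
Implicit Types (u v w x y z e : 'rV[R]_n) (f g : 'rV[R]_n -> R).

Local Notation mass := (I (fun=> 1)).

Lemma mean_eq f g : sphere_lip f -> sphere_lip g ->
  (forall v, dot v v = 1 -> f v = g v) -> I f = I g.
Proof.
move=> hf hg fg; apply/eqP; rewrite eq_le.
by apply/andP; split; apply: (mean_le IM) => // v v1; rewrite fg.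
Qed.

Lemma mean_cst c : I (fun=> c) = c * mass.
Proof.
rewrite -(mean_scale IM); last exact: sphere_lip_cst.
by under [in RHS]eq_fun do rewrite mulr1.
Qed.

Lemma mean_sub f g : sphere_lip f -> sphere_lip g ->
  I (fun v => f v - g v) = I f - I g.
Proof.
move=> hf hg; rewrite -[in RHS]mulN1r -(mean_scale IM) // -(mean_add IM) //.
  by under [in RHS]eq_fun do rewrite mulN1r.
exact: sphere_lipZ.
Qed.

Lemma mean_sum (J : Type) (r : seq J) (f : J -> 'rV[R]_n -> R) :
  (forall j, sphere_lip (f j)) ->
  I (fun v => \sum_(j <- r) f j v) = \sum_(j <- r) I (f j).
Proof.
move=> fr; elim: r => [|j r IH].
  rewrite big_nil; under eq_fun do rewrite big_nil.
  by rewrite mean_cst mul0r.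
rewrite big_cons; under eq_fun do rewrite big_cons.
by rewrite (mean_add IM) ?IH //; exact: sphere_lip_sum.
Qed.

Lemma mass_ge0 : 0 <= mass.
Proof.
have := mean_cst 0; rewrite mul0r => <-.
by apply: (mean_le IM) => *; rewrite ?ler01 //; exact: sphere_lip_cst.
Qed.

Lemma sphere_lip_dot2 k l e e' :
  sphere_lip (fun v => dot v e ^+ k * dot v e' ^+ l).
Proof.
by apply: sphere_lipM; apply: sphere_lipX; exact: sphere_lip_dot.
Qed.

(** Two reflections carry any orthonormal pair to any other one, so mixed moments
   depend on nothing but the exponents. *)
Lemma mean_moment2 k l e e' d d' :
  dot e e = 1 -> dot e' e' = 1 -> dot e e' = 0 ->
  dot d d = 1 -> dot d' d' = 1 -> dot d d' = 0 ->
  I (fun v => dot v e ^+ k * dot v e' ^+ l) =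
  I (fun v => dot v d ^+ k * dot v d' ^+ l).
Proof.
move=> e1 e'1 ee' d1 d'1 dd'.
have [g [g1 [gd ge]]] : exists e'', [/\ dot e'' e'' = 1, dot d e'' = 0 &
    I (fun v => dot v e ^+ k * dot v e' ^+ l) =
    I (fun v => dot v d ^+ k * dot v e'' ^+ l)].
  have [ed|ed] := eqVneq d e; first by exists e'; rewrite ed.
  have u1 : dot (normalize (e - d)) (normalize (e - d)) = 1.
    exact: normalizeB_unit.
  have ud : refl (normalize (e - d)) d = e by rewrite refl_swap // d1.
  have ue : refl (normalize (e - d)) e = d by rewrite -[X in refl _ X]ud reflK.
  exists (refl (normalize (e - d)) e'); split.
  - by rewrite dot_refl.
  - by rewrite -dot_refll ud.
  - rewrite -(mean_refl IM u1); last exact: sphere_lip_dot2.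
    by under [in LHS]eq_fun do rewrite !dot_refll ue.
rewrite ge; have [->//|gd'] := eqVneq g d'.
have u1 : dot (normalize (d' - g)) (normalize (d' - g)) = 1.
  exact: normalizeB_unit.
rewrite -(mean_refl IM u1); last exact: sphere_lip_dot2.
under [in LHS]eq_fun do rewrite !dot_refll refl_swap ?g1 ?d'1 // refl_orth
  ?[dot d _]dotZr ?[dot d (_ - _)]dotDr ?dotNr ?gd ?dd' ?subrr ?mulr0 //.
by [].
Qed.

Lemma mean_moment k e d : dot e e = 1 -> dot d d = 1 ->
  I (fun v => dot v e ^+ k) = I (fun v => dot v d ^+ k).
Proof.
move=> e1 d1; have [->//|ed] := eqVneq e d.
have u1 : dot (normalize (d - e)) (normalize (d - e)) = 1.
  exact: normalizeB_unit.
rewrite -(mean_refl IM u1); last by apply: sphere_lipX; exact: sphere_lip_dot.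
by under [in LHS]eq_fun do rewrite dot_refll refl_swap ?e1 ?d1 //.
Qed.

(** The squares of the [n] coordinates sum to [1] on the sphere. *)
Lemma mean_sqr e : dot e e = 1 -> n%:R * I (fun v => dot v e ^+ 2) = mass.
Proof.
move=> e1; transitivity (I (fun v => \sum_(i < n) dot v (axis i) ^+ 2)).
  rewrite mean_sum => [|i]; last by apply: sphere_lipX; exact: sphere_lip_dot.
  rewrite (eq_bigr (fun=> I (fun v => dot v e ^+ 2))) => [|i _].
    by rewrite sumr_const card_ord mulr_natl.
  by apply: mean_moment => //; exact: axis_unit.
apply: mean_eq.
- apply: sphere_lip_sum => i; apply: sphere_lipX; exact: sphere_lip_dot.
- exact: sphere_lip_cst.
- by move=> v v1; rewrite sum_dot_axis.
Qed.

(** Rotating the axes by an eighth of a turn relates the two fourth moments: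
   [((x + y) / sqrt 2) ^ 4 + ((x - y) / sqrt 2) ^ 4] has the mean of
   [x ^ 4 + y ^ 4]. *)
Lemma mean_pow4 e e' : dot e e = 1 -> dot e' e' = 1 -> dot e e' = 0 ->
  I (fun v => dot v e ^+ 4) = 3 * I (fun v => dot v e ^+ 2 * dot v e' ^+ 2).
Proof.
move=> e1 e'1 ee'; pose c : R := Num.sqrt 2^-1.
have cE : c ^+ 2 = 2^-1 by rewrite sqr_sqrtr.
have d1 : dot (c *: (e + e')) (c *: (e + e')) = 1.
  by rewrite !dotE e1 e'1 ee' dotC ee' -[RHS](@mulVf _ 2) // -cE; ring.
have d'1 : dot (c *: (e - e')) (c *: (e - e')) = 1.
  by rewrite !dotE e1 e'1 ee' dotC ee' -[RHS](@mulVf _ 2) // -cE; ring.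
set b := I (fun v => dot v e ^+ 2 * _); set q := I _.
have lipX k x : sphere_lip (fun v => dot v x ^+ k).
  by apply: sphere_lipX; exact: sphere_lip_dot.
have : q + q = I (fun v => dot v (c *: (e + e')) ^+ 4) +
               I (fun v => dot v (c *: (e - e')) ^+ 4).
  by congr (_ + _); exact: mean_moment.
rewrite -(mean_add IM) //.
have -> : I (fun v => dot v (c *: (e + e')) ^+ 4 + dot v (c *: (e - e')) ^+ 4) =
    I (fun v => 2^-1 * (dot v e ^+ 4) + (2^-1 * (dot v e' ^+ 4) +
       3 * (dot v e ^+ 2 * dot v e' ^+ 2))).
  congr (I _); apply/funext => v; rewrite !dotE.
  have -> : (c * (dot v e + dot v e')) ^+ 4 =
    c ^+ 2 ^+ 2 * (dot v e + dot v e') ^+ 4 by ring.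
  have -> : (c * (dot v e - dot v e')) ^+ 4 =
    c ^+ 2 ^+ 2 * (dot v e - dot v e') ^+ 4 by ring.
  by rewrite cE; field.
have lip2 := sphere_lip_dot2 2 2 e e'.
rewrite !(mean_add IM) ?(mean_scale IM) //; do ?[
  exact: sphere_lipZ|apply: sphere_lipD; exact: sphere_lipZ].
rewrite -[I (fun v => dot v e' ^+ 4)](@mean_moment 4 e e') // -/b -/q.
by move=> h; lra.
Qed.

Lemma mean_block_sqr m : (m <= n)%N -> (1 < n)%N ->
  I (fun v => (\sum_(i < m) dot v (axis i) ^+ 2) ^+ 2) =
  m%:R * (m%:R + 2) * I (fun v => dot v (axis 0) ^+ 2 * dot v (axis 1) ^+ 2).
Proof.
move=> mn n1; set b := I (fun v => _ * _).
have ax (i : 'I_m) : (i < n)%N by exact: leq_trans (ltn_ord i) mn.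
have n0 : (0 < n)%N by exact: ltn_trans n1.
transitivity (I (fun v => \sum_(i < m) \sum_(j < m)
    dot v (axis i) ^+ 2 * dot v (axis j) ^+ 2)).
  congr (I _); apply/funext => v; rewrite expr2 mulr_suml.
  by apply: eq_bigr => i _; rewrite mulr_sumr.
rewrite mean_sum => [|i]; last first.
  by apply: sphere_lip_sum => j; exact: sphere_lip_dot2.
rewrite (eq_bigr (fun=> (m%:R + 2) * b)) => [|i _].
  by rewrite sumr_const card_ord -[LHS]mulr_natl mulrA.
rewrite mean_sum => [|j]; last exact: sphere_lip_dot2.
rewrite (bigD1 i) //=.
rewrite (eq_bigr (fun=> b)) => [|j ji]; last first.
  apply: mean_moment2; rewrite ?axis_unit ?dot_axis //.
  by rewrite eq_sym (inj_eq val_inj) (negbTE ji).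
rewrite sumr_const cardC1 card_ord.
under [in X in X + _]eq_fun do rewrite -exprD.
rewrite (@mean_moment 4 _ (axis 0)) ?axis_unit // (@mean_pow4 (axis 0) (axis 1))
  ?axis_unit ?dot_axis // -/b.
case: m {mn ax} i => [[]//|m] _; rewrite -mulr_natl -natr1; ring.
Qed.

(** The second moment of a block is exact and its fourth moment nearly that of
   independent coordinates, hence the small variance. *)
Lemma mean_block_var m : (m <= n)%N -> (1 < n)%N ->
  I (fun v => (\sum_(i < m) dot v (axis i) ^+ 2 - m%:R / n%:R) ^+ 2) <=
  2 * m%:R / n%:R ^+ 2 * mass.
Proof.
move=> mn n1; set b := I (fun v => dot v (axis 0) ^+ 2 * dot v (axis 1) ^+ 2).
have n0 : 0 < n%:R :> R by rewrite ltr0n ltnW.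
have lipS : sphere_lip (fun v : 'rV[R]_n => \sum_(i < m) dot v (axis i) ^+ 2).
  by apply: sphere_lip_sum => i; apply: sphere_lipX; exact: sphere_lip_dot.
have bE : n%:R * (n%:R + 2) * b = mass.
  rewrite -mean_block_sqr //; apply: mean_eq.
  - apply: sphere_lipX; apply: sphere_lip_sum => i.
    by apply: sphere_lipX; exact: sphere_lip_dot.
  - exact: sphere_lip_cst.
  - by move=> v v1; rewrite sum_dot_axis v1 expr1n.
have SE : I (fun v => \sum_(i < m) dot v (axis i) ^+ 2) = m%:R / n%:R * mass.
  rewrite mean_sum => [|i]; last by apply: sphere_lipX; exact: sphere_lip_dot.
  rewrite (eq_bigr (fun=> mass / n%:R)) => [|i _].
    by rewrite sumr_const card_ord -[LHS]mulr_natl; ring.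
  rewrite -(@mean_sqr (axis i)); first by rewrite mulrC mulKf // gt_eqF.
  by apply: axis_unit; exact: leq_trans (ltn_ord i) mn.
have -> : I (fun v => (\sum_(i < m) dot v (axis i) ^+ 2 - m%:R / n%:R) ^+ 2) =
    I (fun v => (\sum_(i < m) dot v (axis i) ^+ 2) ^+ 2 +
      ((- 2 * (m%:R / n%:R)) * (\sum_(i < m) dot v (axis i) ^+ 2) +
      (m%:R / n%:R) ^+ 2)).
  by congr (I _); apply/funext => v; ring.
have lipZS := sphere_lipZ (- 2 * (m%:R / n%:R)) lipS.
rewrite (mean_add IM); first last.
- by apply: sphere_lipD => //; exact: sphere_lip_cst.
- exact: sphere_lipX.
rewrite (mean_add IM) //; last exact: sphere_lip_cst.
rewrite (mean_scale IM) //.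
rewrite mean_block_sqr // -/b mean_cst SE.
have b0 : 0 <= b.
  have := mass_ge0; rewrite -bE pmulr_rge0 // mulr_gt0 //; lra.
rewrite -bE.
have -> : m%:R * (m%:R + 2) * b + (- 2 * (m%:R / n%:R) *
    (m%:R / n%:R * (n%:R * (n%:R + 2) * b)) +
    (m%:R / n%:R) ^+ 2 * (n%:R * (n%:R + 2) * b)) =
    (m%:R * (m%:R + 2) - m%:R ^+ 2 * (1 + 2 / n%:R)) * b.
  by field; rewrite gt_eqF.
have -> : 2 * m%:R / n%:R ^+ 2 * (n%:R * (n%:R + 2) * b) =
    (2 * m%:R * (1 + 2 / n%:R)) * b.
  by field; rewrite gt_eqF.
rewrite ler_wpM2r //.
have : 0 <= 2 / n%:R :> R by rewrite divr_ge0 // ltW.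
have : 0 <= m%:R :> R by [].
nra.
Qed.

End invariant_mean.

(** * Polarization and concentration *)

Section polarization.
Context {R : realType} {n : nat}.
Implicit Types (u v w x y z e : 'rV[R]_n) (f g : 'rV[R]_n -> R).

Definition polarize u f v : R :=
  if 0 <= dot v u then Num.max (f v) (f (refl u v))
  else Num.min (f v) (f (refl u v)).

(** On each pair of mirror points the values are kept or exchanged, so that every
   integral of a function of the values is unchanged. *)
Lemma polarize_pair u f v : dot u u = 1 ->
  polarize u f v = f v /\ polarize u f (refl u v) = f (refl u v) \/
  polarize u f v = f (refl u v) /\ polarize u f (refl u v) = f v.
Proof.
move=> u1; rewrite /polarize reflK //.
have -> : dot (refl u v) u = - dot v u by rewrite /refl !dotE u1; ring.
rewrite oppr_ge0.
have [v0|v0|v0] := ltrgt0P (dot v u).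
- by rewrite /Num.max /Num.min; case: ltrgtP => h; [right|left|left].
- by rewrite /Num.max /Num.min; case: ltrgtP => h; [left|right|left].
- by rewrite refl_orth // maxxx; left.
Qed.

(** When [v] and [w] lie on different sides of the mirror, all four distances
   between [{v, refl u v}] and [{w, refl u w}] are at most [enorm (v - w)]. *)
Lemma lip1_polarize u f : dot u u = 1 -> lip1 f -> lip1 (polarize u f).
Proof.
move=> u1 fl v w.
have h1 := fl v w.
have h2 : `|f (refl u v) - f (refl u w)| <= enorm (v - w).
  by apply: le_trans (fl _ _) _; rewrite -reflB enorm_refl.
have h3 : dot v u * dot w u <= 0 -> `|f v - f (refl u w)| <= enorm (v - w).
  move=> s; apply: le_trans (fl _ _) _.
  rewrite -(@ler_pXn2r _ 2) ?nnegrE ?enorm_ge0 // !sqr_enorm -subr_ge0.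
  have -> : dot (v - w) (v - w) - dot (v - refl u w) (v - refl u w) =
      - (4 * (dot v u * dot w u)).
    by rewrite /refl !dotE u1 (dotC u v) (dotC w v) (dotC u w); ring.
  by lra.
have h4 : dot v u * dot w u <= 0 -> `|f (refl u v) - f w| <= enorm (v - w).
  move=> s; apply: le_trans (fl _ _) _.
  rewrite -(@ler_pXn2r _ 2) ?nnegrE ?enorm_ge0 // !sqr_enorm -subr_ge0.
  have -> : dot (v - w) (v - w) - dot (refl u v - w) (refl u v - w) =
      - (4 * (dot v u * dot w u)).
    by rewrite /refl !dotE u1 (dotC u v) (dotC w v) (dotC u w); ring.
  by lra.
move: h1 h2 h3 h4; rewrite /polarize /Num.max /Num.min !ler_norml.
case: (leP 0 (dot v u)) => vu; case: (leP 0 (dot w u)) => wu.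
- move=> h1 h2 _ _; case: ltP => a; case: ltP => b; lra.
- move=> h1 h2 /(_ ltac:(nra)) h3 /(_ ltac:(nra)) h4.
  case: ltP => a; case: ltP => b; lra.
- move=> h1 h2 /(_ ltac:(nra)) h3 /(_ ltac:(nra)) h4.
  case: ltP => a; case: ltP => b; lra.
- move=> h1 h2 _ _; case: ltP => a; case: ltP => b; lra.
Qed.

(** The increase of the correlation with the height [dot v e] under polarization,
   summed over a pair of mirror points: it is nonnegative pointwise when the
   normal [u] of the mirror points upward. *)
Definition moment_gain u e f v : R :=
  polarize u f v * dot v e + polarize u f (refl u v) * dot (refl u v) e -
  (f v * dot v e + f (refl u v) * dot (refl u v) e).

Lemma dot_refl_gap u e v : dot v e - dot (refl u v) e = 2 * dot v u * dot u e.
Proof. by rewrite /refl !dotE; ring. Qed.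

Lemma moment_gainE u e f v : dot u u = 1 -> 0 <= dot v u ->
  moment_gain u e f v =
  Num.max 0 (f (refl u v) - f v) * (2 * dot v u * dot u e).
Proof.
move=> u1 v0; rewrite -dot_refl_gap /moment_gain.
have := v0; rewrite le_eqVlt => /predU1P[/esym v0'|{}v0].
  by rewrite refl_orth // /polarize v0' lexx refl_orth // maxxx !subrr maxxx mul0r.
rewrite /polarize reflK // ltW //.
have -> : dot (refl u v) u = - dot v u by rewrite /refl !dotE u1; ring.
rewrite oppr_ge0 leNgt v0 /=.
rewrite /Num.max /Num.min subr_gt0.
by case: ltrgtP => h; rewrite ?h; ring.
Qed.

Lemma moment_gain_refl u e f v : dot u u = 1 ->
  moment_gain u e f (refl u v) = moment_gain u e f v.
Proof. by move=> u1; rewrite /moment_gain reflK //; ring. Qed.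

Lemma moment_gain_ge0 u e f v : dot u u = 1 -> 0 <= dot u e ->
  0 <= moment_gain u e f v.
Proof.
move=> u1 ue; wlog v0 : v / 0 <= dot v u => [H|].
  have [/H//|v0] := leP 0 (dot v u).
  rewrite -moment_gain_refl // H // /refl !dotE u1; lra.
by rewrite moment_gainE // !mulr_ge0 // le_max lexx.
Qed.

End polarization.

Section concentration.
Context {R : realType} {n : nat} (I : ('rV[R]_n -> R) -> R).
Hypothesis IM : invariant_mean I.
Implicit Types (u v w x y z e : 'rV[R]_n) (f g : 'rV[R]_n -> R).

Local Notation mass := (I (fun=> 1)).

Lemma mean_polarize u f (h : R -> R) : dot u u = 1 -> lip1 f ->
  (forall g, lip1 g -> sphere_lip (fun v => h (g v))) ->
  I (fun v => h (polarize u f v)) = I (fun v => h (f v)).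
Proof.
move=> u1 fl hl; have pl := lip1_polarize u1 fl.
have sym g : lip1 g -> I (fun v => h (g v) + h (g (refl u v))) =
    2 * I (fun v => h (g v)).
  move=> gl; rewrite (mean_add IM); [|exact: hl|].
    by rewrite (mean_refl IM u1 (hl _ gl)); ring.
  by apply: (sphere_lip_refl (f := fun v => h (g v)) u1); exact: hl.
apply: (@mulfI _ 2) => //; rewrite -!sym //; congr (I _).
by apply/funext => v; case: (polarize_pair f v u1) => -[-> ->] //; rewrite addrC.
Qed.

Lemma mean_moment_gain u e f : dot u u = 1 -> lip1 f ->
  sphere_lip (moment_gain u e f) /\
  I (moment_gain u e f) =
    2 * (I (fun v => polarize u f v * dot v e) - I (fun v => f v * dot v e)).
Proof.
move=> u1 fl; have pl := lip1_polarize u1 fl.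
have hm g : lip1 g -> sphere_lip (fun v => g v * dot v e).
  by move=> gl; apply: sphere_lipM (lip1_sphere_lip gl) (sphere_lip_dot e).
have hs g : lip1 g ->
    sphere_lip (fun v => g v * dot v e + g (refl u v) * dot (refl u v) e).
  by move=> /hm gl; apply: sphere_lipD => //; exact: (sphere_lip_refl u1 gl).
split; first by apply: sphere_lipB; exact: hs.
rewrite (mean_sub IM (hs _ pl) (hs _ fl)).
have sym g : lip1 g ->
    I (fun v => g v * dot v e + g (refl u v) * dot (refl u v) e) =
    2 * I (fun v => g v * dot v e).
  move=> /hm gl; rewrite (mean_add IM) //; last exact: (sphere_lip_refl u1 gl).
  by rewrite (mean_refl IM u1 gl); ring.
by rewrite !sym //; ring.
Qed.

Definition bump (r : R) y v : R := Num.max 0 (r - enorm (v - y)).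

Lemma lip1_bump r y : lip1 (bump r y).
Proof.
move=> v w; have := lip1_dist y v w; rewrite /bump /Num.max !ler_norml.
by case: ltP => a; case: ltP => b; lra.
Qed.

(** Reflections move any bump to any other one, so that an invariant mean with
   mass near one point has the same mass near all points. *)
Lemma bump_lb r : 0 < r ->
  (exists2 z, dot z z = 1 & forall r, 0 < r -> 0 < I (bump r z)) ->
  exists2 c, 0 < c & forall y, dot y y = 1 -> c <= I (bump r y).
Proof.
move=> r0 [z z1 Iz]; exists (I (bump r z)); first exact: Iz.
move=> y y1; have [->//|zy] := eqVneq z y.
have u1 : dot (normalize (y - z)) (normalize (y - z)) = 1.
  exact: normalizeB_unit.
rewrite -(mean_refl IM u1); last exact: (lip1_sphere_lip (lip1_bump r z)).
rewrite (_ : (fun v => _) = bump r y) //; apply/funext => v.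
rewrite /bump -[in RHS](@refl_swap _ _ z y) ?z1 ?y1 //.
by rewrite -(enorm_refl (v - refl _ z) u1) reflB reflK.
Qed.

(** Among the [1]-Lipschitz functions with the same first two moments as [f],
   one that nearly maximises the correlation with the height [dot v e] is
   nearly a nondecreasing function of the height: otherwise polarization would
   increase the correlation by a fixed amount. *)
Lemma nearly_monotone_rearrangement e f (eps : R) : dot e e = 1 -> lip1 f ->
  (exists2 z, dot z z = 1 & forall r, 0 < r -> 0 < I (bump r z)) -> 0 < eps ->
  exists g, [/\ lip1 g, forall c, I (fun v => (g v - c) ^+ 2) =
     I (fun v => (f v - c) ^+ 2) & forall x y, dot x x = 1 -> dot y y = 1 ->
     dot x e + eps <= dot y e -> g x <= g y + eps].
Proof.
move=> e1 fl Iz eps0.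
have [K [fK _]] := lip1_sphere_lip fl.
pose class g := [/\ lip1 g, forall v, dot v v = 1 -> `|g v| <= K &
  forall c, I (fun v => (g v - c) ^+ 2) = I (fun v => (f v - c) ^+ 2)].
pose F g := I (fun v => g v * dot v e).
pose S := [set F g | g in class].
have hm g : lip1 g -> sphere_lip (fun v => g v * dot v e).
  by move=> gl; apply: sphere_lipM (lip1_sphere_lip gl) (sphere_lip_dot e).
have K0 : 0 <= K by rewrite (le_trans (normr_ge0 (f e))) // fK.
have supS : has_sup S.
  split; first by exists (F f), f.
  exists (K * mass) => _ [g [gl gK _] <-].
  rewrite -(mean_cst IM); apply: (mean_le IM); [exact: hm|exact: sphere_lip_cst|].
  move=> v v1; apply: le_trans (ler_norm _) _; rewrite normrM -[K]mulr1.
  rewrite ler_pM ?gK //; apply: le_trans (cauchy_schwarz _ _) _.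
  by rewrite !enorm_unit // mulr1.
have class_pol g u : dot u u = 1 -> class g -> class (polarize u g).
  move=> u1 [gl gK gm]; split.
  - exact: lip1_polarize.
  - move=> v v1; case: (polarize_pair g v u1) => -[-> _]; apply: gK => //.
    by rewrite dot_refl.
  - move=> c; rewrite -gm; apply: (mean_polarize (h := fun t => (t - c) ^+ 2)) => //.
    move=> h hl; apply: sphere_lipX; apply: sphere_lipB (sphere_lip_cst c).
    exact: lip1_sphere_lip.
have eps4 : 0 < eps / 4 by rewrite divr_gt0.
(* [c] bounds below the means of the bumps of width [eps / 4]; if the conclusion
   fails at [x] and [y], polarization gains at least [eps ^+ 2 / 4 * c] *)
have [c c0 cI] := bump_lb eps4 Iz.
have q0 : 0 < eps ^+ 2 / 4 * c by rewrite mulr_gt0 // divr_gt0 // exprn_gt0.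
have [_ [g gC <-] gS] := sup_adherent q0 supS.
have [gl gK gm] := gC; exists g; split => // x y x1 y1 xy.
rewrite leNgt; apply/negP => gxy.
have neq : x != y by apply: contraTneq xy => ->; rewrite -ltNge; lra.
set u := normalize (y - x).
have u1 : dot u u = 1 by exact: normalizeB_unit.
have ux : refl u x = y by rewrite refl_swap // x1.
have uy : refl u y = x by rewrite -ux reflK.
have d2 := enorm_le2 y1 x1.
have d0 : 0 < enorm (y - x).
  by rewrite enorm_gt0 // subr_eq0 eq_sym.
have ge2 a : 0 <= a -> a / 2 <= a / enorm (y - x).
  by move=> a0; rewrite ler_wpM2l // lef_pV2 ?posrE.
have ue : eps / 2 <= dot u e.
  have -> : dot u e = (dot y e - dot x e) / enorm (y - x).
    by rewrite /u /normalize !dotE mulrC.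
  have xy0 : 0 <= dot y e - dot x e by lra.
  by apply: le_trans (ge2 _ xy0); lra.
have dyu : dot y u = enorm (y - x) / 2.
  have sq := sqr_enorm (y - x); have : dot (y - x) (y - x) = 2 * dot y (y - x).
    by rewrite !dotE x1 y1 (dotC y x); ring.
  rewrite -sq /u /normalize dotZr => h.
  by apply: (mulfI (lt0r_neq0 d0)); rewrite mulVKf ?gt_eqF //; lra.
have yx_eps : eps <= enorm (y - x).
  apply: (@le_trans _ _ (dot (y - x) e)); first by rewrite !dotE; lra.
  apply: le_trans (ler_norm _) _; apply: le_trans (cauchy_schwarz _ _) _.
  by rewrite (enorm_unit e1) mulr1.
have yu : eps / 2 <= dot y u by rewrite dyu; lra.
have [gain_lip gainE] := mean_moment_gain e u1 gl.
have gain_lb : eps ^+ 2 / 2 * c <= I (moment_gain u e g).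
  apply: le_trans (_ : eps ^+ 2 / 2 * I (bump (eps / 4) y) <= _).
    by rewrite ler_wpM2l ?cI // divr_ge0 // sqr_ge0.
  have bl := lip1_sphere_lip (lip1_bump (eps / 4) y).
  rewrite -(mean_scale IM) //; apply: (mean_le IM) => //.
    exact: sphere_lipZ.
  move=> v v1; rewrite /bump /Num.max; case: ltP => vy; last first.
    by rewrite mulr0 moment_gain_ge0 //; lra.
  have vu : eps / 4 <= dot v u.
    have := cauchy_schwarz (v - y) u; rewrite (enorm_unit u1) mulr1 dotDl dotNl.
    by rewrite ler_norml; lra.
  rewrite moment_gainE //; last lra.
  have g1 := gl v y; have g2 := gl (refl u v) x.
  rewrite -uy -reflB enorm_refl // in g2; rewrite uy in g2.
  have gap : eps / 2 <= g (refl u v) - g v by move: g1 g2; rewrite !ler_norml; lra.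
  have M : eps / 2 <= Num.max 0 (g (refl u v) - g v) by rewrite le_max gap orbT.
  have P : eps ^+ 2 / 4 <= 2 * dot v u * dot u e by nra.
  have v0 := enorm_ge0 (v - y).
  apply: le_trans (_ : eps / 2 * (eps ^+ 2 / 4) <= _); first by nra.
  by apply: ler_pM => //; [lra|rewrite divr_ge0 // sqr_ge0].
have : F (polarize u g) <= sup S.
  by apply: ub_le_sup; [exact: supS.2|exists (polarize u g) => //; exact: class_pol].
move: gainE gain_lb; rewrite -/(F g) -/(F (polarize u g)) => -> ; lra.
Qed.

(** Concentration on the sphere: [1]-Lipschitz functions have variance
   [O(1 / n)]. A function that is nearly nondecreasing in the height deviates
   from its value at a point of the equator by a multiple of the height, and the
   height has second moment [1 / n]. *)
Lemma mean_concentration f : (1 < n)%N -> lip1 f ->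
  (exists2 z, dot z z = 1 & forall r, 0 < r -> 0 < I (bump r z)) ->
  exists c, I (fun v => (f v - c) ^+ 2) <= 26 / n%:R * mass.
Proof.
move=> n1 fl Iz; pose e : 'rV[R]_n := axis 0; pose x0 : 'rV[R]_n := axis 1.
have n0 : 0 < n%:R :> R by rewrite ltr0n ltnW.
have e1 : dot e e = 1 by rewrite axis_unit // ltnW.
have x01 : dot x0 x0 = 1 by rewrite axis_unit.
have x0e : dot x0 e = 0 by rewrite dotC dot_axis // ltnW.
pose eps : R := Num.sqrt n%:R^-1.
have eps0 : 0 < eps by rewrite sqrtr_gt0 invr_gt0.
have epsE : eps ^+ 2 = n%:R^-1 by rewrite sqr_sqrtr // invr_ge0 ltW.
have [g [gl gm gmon]] := nearly_monotone_rearrangement e1 fl Iz eps0.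
exists (g x0); rewrite -gm.
(* a point of prescribed height on the meridian through x0 *)
have meridian h : `|h| <= 1 -> exists y, [/\ dot y y = 1, dot y e = h &
    enorm (y - x0) <= 2 * `|h|].
  move=> h1; have h21 : 0 <= 1 - h ^+ 2.
    by rewrite subr_ge0 -real_normK ?num_real // exprn_ile1.
  have y1 : dot (Num.sqrt (1 - h ^+ 2) *: x0 + h *: e)
      (Num.sqrt (1 - h ^+ 2) *: x0 + h *: e) = 1.
    rewrite !dotE x01 e1 x0e (dotC e) x0e.
    transitivity (Num.sqrt (1 - h ^+ 2) ^+ 2 + h ^+ 2); first by ring.
    by rewrite sqr_sqrtr //; ring.
  exists (Num.sqrt (1 - h ^+ 2) *: x0 + h *: e); split => //.
    by rewrite !dotE x0e e1; ring.
  rewrite -(@ler_pXn2r _ 2) ?nnegrE ?mulr_ge0 ?enorm_ge0 // dist_unit //.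
  rewrite !dotE x01 (dotC e) x0e exprMn real_normK ?num_real //.
  have := sqr_sqrtr h21; have := sqrtr_ge0 (1 - h ^+ 2).
  move: (Num.sqrt _) => q q0 q2.
  have q1 : q <= 1 by nra.
  nra.
(* [g v] lies between the values of [g] at points of slightly larger and slightly
   smaller height on the meridian, both close to [x0] *)
have dev v : dot v v = 1 -> `|g v - g x0| <= 2 * `|dot v e| + 3 * eps.
  move=> v1; set h := dot v e.
  have [big|small] := leP 1 (`|h| + eps).
    apply: le_trans (gl _ _) _; apply: le_trans (enorm_le2 v1 x01) _; lra.
  have hh : 0 <= `|h| := normr_ge0 h.
  have [y [y1 ye yx]] : exists y, [/\ dot y y = 1, dot y e = `|h| + eps &
      enorm (y - x0) <= 2 * (`|h| + eps)].
    have [|y [? ? ?]] := @meridian (`|h| + eps); first by rewrite ger0_norm; lra.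
    by exists y; split => //; rewrite -(@ger0_norm _ (`|h| + eps)) //; lra.
  have [z [z1 ze zx]] : exists z, [/\ dot z z = 1, dot z e = - (`|h| + eps) &
      enorm (z - x0) <= 2 * (`|h| + eps)].
    have [|z [? ? zx]] := @meridian (- (`|h| + eps)).
      by rewrite normrN ger0_norm; lra.
    exists z; split => //; move: zx; rewrite normrN (@ger0_norm _ (`|h| + eps)) //.
    by lra.
  have [hl hu] : - `|h| <= h /\ h <= `|h| by apply/andP; rewrite -ler_norml.
  have a1 : g v <= g y + eps by apply: gmon; rewrite // ye -/h; lra.
  have a2 : g z <= g v + eps by apply: gmon; rewrite // ze -/h; lra.
  have b1 := gl y x0; have b2 := gl z x0.
  move: b1 b2; rewrite !ler_norml; lra.
have lipe : sphere_lip (fun v => 8 * dot v e ^+ 2).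
  by apply: sphere_lipZ; apply: sphere_lipX; exact: sphere_lip_dot.
apply: le_trans (_ : I (fun v => 8 * dot v e ^+ 2 + 18 * eps ^+ 2) <= _).
  apply: (mean_le IM).
  - apply: sphere_lipX; apply: sphere_lipB (sphere_lip_cst _).
    exact: lip1_sphere_lip.
  - by apply: sphere_lipD => //; exact: sphere_lip_cst.
  - move=> v v1; have := dev v v1; rewrite -(real_normK (num_real (g v - g x0))).
    rewrite -(real_normK (num_real (dot v e))).
    have := normr_ge0 (g v - g x0); have := normr_ge0 (dot v e).
    move: `|g v - g x0| `|dot v e| => a b b0 a0 ab.
    have := sqr_ge0 (2 * b - 3 * eps); nra.
rewrite (mean_add IM) //; last exact: sphere_lip_cst.
rewrite (mean_scale IM); last by apply: sphere_lipX; exact: sphere_lip_dot.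
rewrite (mean_cst IM) epsE.
have -> : I (fun v => dot v e ^+ 2) = mass / n%:R.
  by rewrite -(mean_sqr IM e1) mulrC mulKf // gt_eqF.
lra.
Qed.

End concentration.

(** * A Euclidean chart of hyperbolic space *)

Section lorentz.
Context {R : realType} {n : nat}.
Implicit Types (x y u v : 'rV[R]_n.+1).

Lemma lformNl u w : lform (- u) w = - lform u w :> R.
Proof. by rewrite -scaleN1r lformZl mulN1r. Qed.

Lemma lformNr u w : lform u (- w) = - lform u w :> R.
Proof. by rewrite lformC lformNl lformC. Qed.

Definition lE := (@lformDl R n, @lformDr R n, @lformZl R n, @lformZr R n, lformNl, lformNr).

(** The convention [x / 0 = 0] makes this the identity for an isotropic [u]. *)
Definition lorentz_refl u x := x - (2 * lform x u / lform u u) *: u.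

Lemma lform_lorentz_refl u x y :
  lform (lorentz_refl u x) (lorentz_refl u y) = lform x y.
Proof.
rewrite /lorentz_refl !lE (lformC u y).
have [->|u0] := eqVneq (lform u u) 0; first by rewrite invr0; ring.
by field.
Qed.

Lemma lorentz_reflK u : involutive (lorentz_refl u).
Proof.
move=> x; rewrite /lorentz_refl !lE.
have [->|u0] := eqVneq (lform u u) 0.
  by rewrite invr0 !mulr0 !scale0r !subr0.
rewrite -addrA -opprD -scalerDl.
rewrite (_ : 2 * _ / _ + _ = 0) ?scale0r ?subr0 //.
by field.
Qed.

Lemma lform_lorentz_refll u x y :
  lform (lorentz_refl u x) y = lform x (lorentz_refl u y).
Proof. by rewrite -[LHS](lform_lorentz_refl u) lorentz_reflK. Qed.

Definition pole : 'rV[R]_n.+1 := delta_mx 0 0.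

Definition spatial x : 'rV[R]_n := \row_i x 0 (lift ord0 i).

Definition spacetime (t : R) (p : 'rV[R]_n) : 'rV[R]_n.+1 :=
  \row_j (if unlift ord0 j is Some i then p 0 i else t).

Lemma lform_spatial x y :
  lform x y = dot (spatial x) (spatial y) - x 0 0 * y 0 0.
Proof. by rewrite /lform; congr (_ - _); apply: eq_bigr => i _; rewrite !mxE. Qed.

Lemma lform_pole x : lform x pole = - x 0 0.
Proof.
rewrite lform_spatial (_ : spatial pole = 0).
  by rewrite dotC dot0l !mxE /= mulr1 sub0r.
by apply/rowP => i; rewrite !mxE /= .
Qed.

Lemma spatial_spacetime t p : spatial (spacetime t p) = p.
Proof. by apply/rowP => i; rewrite !mxE liftK. Qed.

Lemma time_spacetime t p : spacetime t p 0 0 = t.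
Proof. by rewrite mxE unlift_none. Qed.

Lemma spacetimeE x : spacetime (x 0 0) (spatial x) = x.
Proof. by apply/rowP => j; rewrite !mxE; case: unliftP => [i|] ->; rewrite ?mxE. Qed.

Lemma pole_hyp : is_hyp pole.
Proof. by rewrite /is_hyp lform_pole !mxE /= eqxx ltr01. Qed.

End lorentz.

Section model.
Context {R : realType} {n : nat}.
Implicit Types (p q w : 'rV[R]_n).

(** The time coordinate of the point of the hyperboloid above [p]. *)
Definition cosh_of p : R := Num.sqrt (1 + dot p p).

Lemma sqr_cosh_of p : cosh_of p ^+ 2 = 1 + dot p p.
Proof. by rewrite sqr_sqrtr // addr_ge0 // dot_ge0. Qed.

Lemma cosh_of_ge1 p : 1 <= cosh_of p.
Proof.
rewrite -(@ler_pXn2r _ 2) ?nnegrE ?sqrtr_ge0 // sqr_cosh_of expr1n.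
by rewrite lerDl dot_ge0.
Qed.

Context (o : hyp R n).

Let to_pole := lorentz_refl (hyp_val o - pole).

Let to_pole_o : to_pole o = pole.
Proof.
have oo := is_hyp_form (hyp_valP o); have pp := is_hyp_form (@pole_hyp R n).
rewrite /to_pole /lorentz_refl.
have E : lform (hyp_val o - pole) (hyp_val o - pole) = 2 * lform o (hyp_val o - pole).
  by rewrite !lE oo pp (lformC pole); ring.
have [u0|u0] := eqVneq (lform o (hyp_val o - pole)) 0.
  have : o = Hyp (@pole_hyp R n).
    apply: mdist_positivity; rewrite hyp_mdistE /=.
    move/eqP: u0; rewrite !lE oo -opprD oppr_eq0 addrC addr_eq0 => /eqP ->.
    by rewrite opprK arcosh1.
  move=> -> /=; rewrite subrr.
  by rewrite scaler0 subr0.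
by rewrite E divff ?mulf_neq0 // scale1r opprB addrC subrK.
Qed.

(** Space coordinates after moving [o] to the pole: a chart of the hyperbolic
   space by the Euclidean space in which [o] is the origin, distances to [o] are
   the inverse hyperbolic sines of norms, and rotations about [o] are linear. *)
Definition chart (x : hyp R n) : 'rV[R]_n := spatial (to_pole x).

Let time_to_pole (x : 'rV[R]_n.+1) : to_pole x 0 0 = - lform x o.
Proof.
apply: oppr_inj; rewrite -lform_pole opprK.
by rewrite /to_pole lform_lorentz_refll -/to_pole -to_pole_o /to_pole lorentz_reflK.
Qed.

Lemma dist_o_cosh (x : hyp R n) : - lform x o = cosh_of (chart x).
Proof.
have x1 := lform_hyp_ge1 (hyp_valP x) (hyp_valP o).
apply/eqP; rewrite -(@eqrXn2 _ 2) ?sqrtr_ge0 //; last by apply: le_trans x1.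
have := is_hyp_form (hyp_valP x).
rewrite -(lform_lorentz_refl (hyp_val o - pole)) -/to_pole lform_spatial -/(chart x).
rewrite !time_to_pole sqr_cosh_of => h; apply/eqP.
by move: h; rewrite -expr2; lra.
Qed.

Lemma chartE (x y : hyp R n) :
  - lform x y = cosh_of (chart x) * cosh_of (chart y) - dot (chart x) (chart y).
Proof.
rewrite -(lform_lorentz_refl (hyp_val o - pole)) -/to_pole lform_spatial.
by rewrite !time_to_pole !dist_o_cosh opprB.
Qed.

Lemma chart_o : chart o = 0.
Proof.
by rewrite /chart to_pole_o; apply/rowP => i; rewrite !mxE.
Qed.

Let unchart_hyp p : is_hyp (to_pole (spacetime (cosh_of p) p)).
Proof.
set z := spacetime _ _.
have zz : lform z z = -1.
  rewrite lform_spatial spatial_spacetime time_spacetime -expr2 sqr_cosh_of; ring.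
have hz : is_hyp z.
  by rewrite /is_hyp zz eqxx time_spacetime (lt_le_trans ltr01) ?cosh_of_ge1.
rewrite /is_hyp /to_pole lform_lorentz_refl zz eqxx -/to_pole time_to_pole.
exact: lt_le_trans (lform_hyp_ge1 hz (hyp_valP o)).
Qed.

Definition unchart p : hyp R n := Hyp (unchart_hyp p).

Lemma unchartK : cancel unchart chart.
Proof. by move=> p; rewrite /chart /= /to_pole lorentz_reflK spatial_spacetime. Qed.

Lemma chartK : cancel chart unchart.
Proof.
move=> x; apply: val_inj; rewrite /= -dist_o_cosh -time_to_pole spacetimeE.
by rewrite /to_pole lorentz_reflK.
Qed.

Lemma chart_eq0 x : (chart x == 0) = (x == o).
Proof. by rewrite -chart_o (inj_eq (can_inj chartK)). Qed.

Lemma mdist_chart x y : mdist x y =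
  arcosh (cosh_of (chart x) * cosh_of (chart y) - dot (chart x) (chart y)).
Proof. by rewrite hyp_mdistE chartE. Qed.

Lemma expR_mdist_o x : expR (mdist o x) = cosh_of (chart x) + enorm (chart x).
Proof.
rewrite mdist_chart chart_o dot0l subr0 {1}/cosh_of dot0l addr0 sqrtr1 mul1r.
rewrite expR_arcosh ?cosh_of_ge1 // sqr_cosh_of.
by rewrite addrAC subrr add0r.
Qed.

Lemma sinh_mdist_o x : sinh (mdist o x) = enorm (chart x).
Proof.
rewrite /sinh expRN expR_mdist_o.
have c1 := cosh_of_ge1 (chart x); have e0 := enorm_ge0 (chart x).
have E : cosh_of (chart x) ^+ 2 = 1 + enorm (chart x) ^+ 2.
  by rewrite sqr_cosh_of sqr_enorm.
have -> : (cosh_of (chart x) + enorm (chart x))^-1 =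
    cosh_of (chart x) - enorm (chart x).
  apply: (@mulfI _ (cosh_of (chart x) + enorm (chart x))).
    by rewrite gt_eqF //; lra.
  rewrite mulfV; last by rewrite gt_eqF //; lra.
  by rewrite mulrC -subr_sqr E; ring.
by field.
Qed.

(** Reflections of the chart are isometries fixing [o]. *)
Definition hyp_refl w (x : hyp R n) : hyp R n := unchart (refl w (chart x)).

Lemma chart_hyp_refl w x : chart (hyp_refl w x) = refl w (chart x).
Proof. by rewrite unchartK. Qed.

Lemma hyp_reflK w : dot w w = 1 -> involutive (hyp_refl w).
Proof. by move=> w1 x; rewrite /hyp_refl unchartK reflK // chartK. Qed.

Lemma mdist_hyp_refl w x y : dot w w = 1 ->
  mdist (hyp_refl w x) (hyp_refl w y) = mdist x y.
Proof. by move=> w1; rewrite !mdist_chart !chart_hyp_refl /cosh_of !dot_refl. Qed.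

Lemma hyp_refl_o w : hyp_refl w o = o.
Proof.
rewrite /hyp_refl chart_o refl_orth ?dot0l // -chart_o chartK //.
Qed.

Lemma isometry_hyp_refl w : dot w w = 1 -> Defs.isometry (hyp_refl w).
Proof.
move=> w1; split; last by move=> x y; exact: mdist_hyp_refl.
by exists (hyp_refl w); exact: hyp_reflK.
Qed.

(** The unit normal, in the chart, of a hyperplane through [o]. *)
Lemma chart_normal (v : 'rV[R]_n.+1) : 0 < lform v v -> lform v o = 0 ->
  exists w, dot w w = 1 /\
    forall x : hyp R n, lform x v = Num.sqrt (lform v v) * dot (chart x) w.
Proof.
move=> v0 vo.
have E (x : hyp R n) : lform x v = dot (chart x) (spatial (to_pole v)).
  rewrite -(lform_lorentz_refl (hyp_val o - pole)) -/to_pole lform_spatial.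
  by rewrite (time_to_pole v) vo oppr0 mulr0 subr0.
have vv : lform v v = dot (spatial (to_pole v)) (spatial (to_pole v)).
  rewrite -(lform_lorentz_refl (hyp_val o - pole)) -/to_pole lform_spatial.
  by rewrite (time_to_pole v) vo oppr0 mulr0 subr0.
exists (normalize (spatial (to_pole v))); split.
  apply: normalize_unit; apply: contraTneq v0.
  by rewrite vv => ->; rewrite dot0l ltxx.
move=> x; rewrite E vv -/(enorm _) /normalize dotZr mulrA divff ?mul1r //.
by rewrite gt_eqF // sqrtr_gt0 -vv.
Qed.

End model.

(** * Borel sets of metric spaces and real-valued probabilities *)

(** Linear arithmetic is slow when many comparisons are in the context; this
   leaves only those moved to the goal. Extended real ones are kept. *)
Ltac drop_comparisons := repeat match goal with
  | H : is_true (Order.le _ _) |- _ => clear H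
  | H : is_true (@Order.lt _ _ ?x _) |- _ =>
      lazymatch type of x with constructive_ereal.extended _ => fail | _ => clear H end
  | H : @eq _ _ _ |- _ => clear H
  end.

Section borel_maps.
Context {R : realType}.

Lemma near_mdist (T : csMetricType R) (x : T) (P : set T) :
  (\forall y \near x, P y) <-> exists2 e : R, 0 < e & forall y, mdist x y < e -> P y.
Proof.
split=> [/nbhs_ballP[e /= e0 eP]|[e e0 eP]].
  by exists e => // y xy; apply: eP; rewrite ballEmdist.
by apply/nbhs_ballP; exists e => //= y; rewrite ballEmdist => /eP.
Qed.

Lemma mdist_sym (T : csMetricType R) (x y : T) : mdist x y = mdist y x.
Proof. exact: metric_sym. Qed.

Lemma mdist_tri (T : csMetricType R) (y x z : T) :
  mdist x z <= mdist x y + mdist y z.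
Proof. exact: metric_triangle. Qed.

Lemma open_mdist (T : csMetricType R) (U : set T) :
  (forall x, U x -> exists2 e : R, 0 < e & forall y, mdist x y < e -> U y) ->
  open U.
Proof. by move=> h; rewrite openE => x /h /near_mdist. Qed.

Lemma open_mdist_ball (T : csMetricType R) (x : T) (r : R) :
  open [set y | mdist x y < r].
Proof.
apply: open_mdist => y /= xy; exists (r - mdist x y); first by rewrite subr_gt0.
by move=> z yz; apply: le_lt_trans (mdist_tri y x z) _; lra.
Qed.

Lemma measurable_closed_prod (X Y : csMetricType R) (A : set (X * Y)) :
  closed A -> measurable (A : set (borel (X * Y)%type)).
Proof.
move=> cA; rewrite -[A]setCK; apply: measurableC; apply: sub_sigma_algebra.
exact: closed_openC.
Qed.

Lemma measurable_fun_continuous_on (T : csMetricType R) (D : set T)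
    (f : T -> R) : open D ->
  (forall x, D x -> forall e, 0 < e -> \forall y \near x, `|f x - f y| < e) ->
  measurable_fun (D : set (borel T)) (f : borel T -> R).
Proof.
move=> oD fc; apply: (measurability _ (measurable_realfun.RGenOpens.measurableE R)).
move=> _ [_ [a [b ->] <-]]; apply: measurable_open; rewrite openE => x [Dx].
move=> fx; have : open `]a, b[%classic by exact: interval_open.
rewrite openE => /(_ _ fx) /nbhs_ballP[e /= e0 eab].
apply: filterI; first exact: open_nbhs_nbhs.
by apply: filterS (fc x Dx e e0) => y; exact: eab.
Qed.

Lemma measurable_deviation d (T : measurableType d) (f : T -> R) (c e : R) :
  measurable_fun setT f -> measurable [set x | e < `| `|f x| - c|].
Proof.
move=> mf; have mg : measurable_fun setT (fun x => `|f x| - c).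
  by apply: measurable_funB => //; exact: measurableT_comp.
have -> : [set x | e < `| `|f x| - c|] =
    ~` ((fun x => `|f x| - c) @^-1` `[- e, e]%classic).
  apply/seteqP; split => x /=; rewrite in_itv /= -ler_norml ltNge.
    by move=> /negP.
  by move=> ?; apply/negP.
by apply: measurableC; rewrite -[X in measurable X]setTI; exact: mg.
Qed.

Lemma measurable_fun_lip (T : csMetricType R) (f : T -> R) :
  (forall x y, `|f x - f y| <= mdist x y) ->
  measurable_fun (setT : set (borel T)) (f : borel T -> R).
Proof.
move=> fl; apply: measurable_fun_continuous_on => [|x _ e e0]; first exact: openT.
by apply/near_mdist; exists e => // y; exact: le_lt_trans.
Qed.

Lemma open_preimage_lip (T S : csMetricType R) (f : T -> S) (U : set S) :
  (forall x y, mdist (f x) (f y) <= mdist x y) -> open U -> open (f @^-1` U).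
Proof.
move=> fl; rewrite openE => oU; apply: open_mdist => x /oU /near_mdist[e e0 eU].
by exists e => // y /(le_lt_trans (fl x y)); exact: eU.
Qed.

Lemma measurable_preimage_lip (T S : csMetricType R) (f : T -> S) :
  (forall x y, mdist (f x) (f y) <= mdist x y) ->
  measurable_fun (setT : set (borel T)) (f : borel T -> borel S).
Proof.
move=> fl; apply: (@measurability _ _ (borel T) (borel S) setT f (@open S)) => //.
move=> _ [U oU <-]; rewrite setTI; apply: measurable_open.
exact: open_preimage_lip.
Qed.

Lemma measurable_point (T : csMetricType R) (x : T) :
  measurable ([set x] : set (borel T)).
Proof.
rewrite -[[set x]]setCK; apply: measurableC; apply: measurable_open.
apply: open_mdist => y /= yx; exists (mdist y x).
  by rewrite mdist_gt0; apply/eqP.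
by move=> z yz zx; move: yz; rewrite zx ltxx.
Qed.

End borel_maps.

(** Real-valued probabilities, so that linear arithmetic applies. *)
Section real_probability.
Context {R : realType} d {T : measurableType d} (mu : probability T R).
Implicit Types A B : set T.

Definition pr A : R := fine (mu A).

Lemma prE A : measurable A -> (pr A)%:E = mu A.
Proof. by move=> mA; rewrite /pr fineK // fin_num_measure. Qed.

Lemma pr_ge0 A : 0 <= pr A. Proof. by rewrite fine_ge0. Qed.

Lemma le_pr A B : measurable A -> measurable B -> A `<=` B -> pr A <= pr B.
Proof.
move=> mA mB AB; rewrite -lee_fin !prE //.
by apply: le_measure => //; rewrite inE.
Qed.

Lemma prT : pr setT = 1. Proof. by rewrite /pr probability_setT. Qed.

Lemma pr0 : pr set0 = 0. Proof. by rewrite /pr measure0. Qed.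

Lemma pr_le1 A : measurable A -> pr A <= 1.
Proof. by move=> mA; rewrite -prT le_pr. Qed.

Lemma prC A : measurable A -> pr (~` A) = 1 - pr A.
Proof.
move=> mA; apply: EFin_inj; rewrite prE; last exact: measurableC.
by rewrite probability_setC // -prE.
Qed.

Lemma prU_le A B : measurable A -> measurable B -> pr (A `|` B) <= pr A + pr B.
Proof.
move=> mA mB; rewrite -lee_fin EFinD !prE //; last exact: measurableU.
exact: measureU2.
Qed.

Lemma prU A B : measurable A -> measurable B -> A `&` B = set0 ->
  pr (A `|` B) = pr A + pr B.
Proof.
move=> mA mB AB; apply: EFin_inj; rewrite EFinD !prE //; last exact: measurableU.
exact: measureU.
Qed.

Lemma prI_ge A B : measurable A -> measurable B ->
  pr A + pr B - 1 <= pr (A `&` B).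
Proof.
move=> mA mB; have mI := measurableI _ _ mA mB.
have := prU_le (measurableC mA) (measurableC mB).
rewrite -setCI !prC //; lra.
Qed.

Lemma pr_bigcup_le (J : finType) (F : J -> set T) (P : pred J) :
  (forall j, measurable (F j)) ->
  pr (\big[setU/set0]_(j | P j) F j) <= \sum_(j | P j) pr (F j).
Proof.
move=> mF; elim: (index_enum J) => [|j r IH]; first by rewrite !big_nil pr0.
rewrite !big_cons; case: (P j) => //.
apply: le_trans (prU_le _ _) _ => //; last by rewrite lerD2l.
exact: bigsetU_measurable.
Qed.

Lemma pr_bigcup (J : finType) (F : J -> set T) (P : pred J) :
  (forall j, measurable (F j)) ->
  (forall i j x, P i -> P j -> F i x -> F j x -> i = j) ->
  pr (\big[setU/set0]_(j | P j) F j) = \sum_(j | P j) pr (F j).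
Proof.
move=> mF dF; elim: (index_enum J) (index_enum_uniq J) => [|j r IH] /=.
  by move=> _; rewrite !big_nil pr0.
move=> /andP[jr /IH {}IH]; rewrite !big_cons; case: ifP => // Pj.
rewrite -IH prU //; first exact: bigsetU_measurable.
rewrite -subset0 => x [Fj]; rewrite -bigcup_seq_cond => -[i /= /andP[ir Pi] Fi].
by move: jr; rewrite (dF _ _ _ Pj Pi Fj Fi) ir.
Qed.

End real_probability.

(** * Directions of points *)

Lemma enorm_lt (R : realType) n (p : 'rV[R]_n) (e : R) : 0 < e ->
  (forall i, `|p 0 i| <= e / n.+1%:R) -> enorm p < e.
Proof.
move=> e0 H.
rewrite -(@ltr_pXn2r _ 2) ?nnegrE ?enorm_ge0 ?ltW // sqr_enorm /dot.
apply: (@le_lt_trans _ _ (\sum_(i < n) (e / n.+1%:R) ^+ 2)).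
  apply: ler_sum => i _; rewrite -expr2 -real_normK ?num_real //.
  by rewrite ler_pXn2r ?nnegrE ?normr_ge0 // ltW // divr_gt0.
rewrite sumr_const card_ord -[ltLHS]mulr_natr.
have n0 : 0 <= n%:R :> R by rewrite ler0n.
have n1 : 0 < n%:R + 1 :> R by rewrite ltr_wpDl.
rewrite -natr1 expr_div_n mulrAC ltr_pdivrMr ?exprn_gt0 //.
rewrite ltr_pM2l ?exprn_gt0 //; nra.
Qed.

Section chart_topology.
Context {R : realType} {n : nat} (o : hyp R n).
Local Notation chart := (chart o).

Lemma chart_coord i : exists a : 'rV[R]_n.+1,
  forall x : hyp R n, chart x 0 i = lform x a.
Proof.
exists (lorentz_refl (hyp_val o - pole) (spacetime 0 (axis i))) => x.
rewrite -lform_lorentz_refll lform_spatial spatial_spacetime time_spacetime.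
by rewrite mulr0 subr0 dot_axisr.
Qed.

Lemma near_lform (a : 'rV[R]_n.+1) (x : hyp R n) (e : R) : 0 < e ->
  \forall y \near x, `|lform x a - lform (hyp_val y) a| < e.
Proof.
move=> e0; have x1 := is_hyp_ge1 (hyp_valP x).
pose A := 1 + \sum_i `|a 0 i|.
have A0 : 0 < A by rewrite ltr_pwDl // sumr_ge0.
pose M := x 0 0 * A.
have M0 : 0 < M by rewrite mulr_gt0 //; lra.
have d0 : 0 < ln (1 + e / M) by rewrite ln_gt0 // ltrDl divr_gt0.
apply/near_mdist; exists (ln (1 + e / M)) => // y xy.
have xy1 : 1 <= expR (mdist x y) by rewrite -expR0 ler_expR mdist_ge0.
have lt_e : M * (expR (mdist x y) - 1) < e.
  rewrite mulrC -ltr_pdivlMr // ltrBlDl -(@lnK _ (1 + e / M)) ?ltr_expR //.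
  by rewrite posrE addr_gt0 // divr_gt0.
apply: le_lt_trans lt_e.
have cb i : `|y 0 i - x 0 i| <= x 0 0 * (expR (mdist x y) - 1).
  by rewrite mdist_sym hyp_mdistE; apply: hyp_coord_le; exact: hyp_valP.
have -> : lform x a - lform y a = - lform (hyp_val y - hyp_val x) a by rewrite !lE; ring.
rewrite normrN lform_spatial; apply: le_trans (ler_normB _ _) _.
apply: (@le_trans _ _ (\sum_i `|(hyp_val y - hyp_val x) 0 i * a 0 i|)).
  rewrite big_ord_recl addrC lerD2l; apply: le_trans (ler_norm_sum _ _ _) _.
  by apply: ler_sum => i _; rewrite [spatial _ _ _]mxE [spatial a _ _]mxE.
set c := x 0 0 * (expR (mdist x y) - 1).
have -> : M * (expR (mdist x y) - 1) = c + (\sum_i `|a 0 i|) * c.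
  by rewrite /M /A /c; ring.
apply: ler_wpDl; first by rewrite mulr_ge0 ?subr_ge0 //; lra.
rewrite mulr_suml; apply: ler_sum => i _; rewrite normrM mulrC.
by apply: ler_wpM2l => //; have := cb i; rewrite !mxE.
Qed.

Lemma near_chart (x : hyp R n) (e : R) : 0 < e ->
  \forall y \near x, enorm (chart x - chart y) < e.
Proof.
move=> e0; have en0 : 0 < e / n.+1%:R by rewrite divr_gt0.
have H : \forall y \near x, forall i, `|chart x 0 i - chart y 0 i| < e / n.+1%:R.
  apply: (@filter_forall _ 'I_n (fun i y =>
    `|chart x 0 i - chart y 0 i| < e / n.+1%:R) (nbhs x)) => i.
  have [a aE] := chart_coord i.
  by have := near_lform a x en0; apply: filterS => y; rewrite !aE.
apply: filterS H => y H; apply: enorm_lt => // i.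
have -> : (chart x - chart y) 0 i = chart x 0 i - chart y 0 i.
  by rewrite mxE; congr (_ + _); rewrite mxE.
exact: ltW (H i).
Qed.

Definition dir (x : hyp R n) : 'rV[R]_n := normalize (chart x).

Definition off_center : set (hyp R n) := ~` [set o].

Lemma dir_unit x : off_center x -> dot (dir x) (dir x) = 1.
Proof. by move=> xo; apply: normalize_unit; rewrite chart_eq0; apply/eqP. Qed.

Lemma dir_o : dir o = 0.
Proof. by rewrite /dir chart_o /normalize scaler0. Qed.

Lemma chart_dir x : chart x = sinh (mdist o x) *: dir x.
Proof. by rewrite sinh_mdist_o normalizeK. Qed.

Lemma dir_hyp_refl w x : dot w w = 1 -> dir (hyp_refl o w x) = refl w (dir x).
Proof. by move=> w1; rewrite /dir chart_hyp_refl /normalize reflZ enorm_refl. Qed.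

Lemma off_center_hyp_refl w x : dot w w = 1 ->
  off_center (hyp_refl o w x) <-> off_center x.
Proof.
move=> w1; rewrite /off_center /=; split => xo E; apply: xo.
  by rewrite E hyp_refl_o.
by rewrite -(hyp_reflK o w1 x) E hyp_refl_o.
Qed.

Lemma open_off_center : open off_center.
Proof.
apply: open_mdist => x xo; exists (mdist x o).
  by rewrite mdist_gt0; apply/eqP.
by move=> y /[swap] ->; rewrite ltxx.
Qed.

Lemma enorm_normalizeB (p q : 'rV[R]_n) : p != 0 ->
  enorm (normalize p - normalize q) <= 2 * enorm (p - q) / enorm p.
Proof.
move=> p0; have pn0 := enorm_gt0 p0.
rewrite ler_pdivlMr // mulrC.
have -> : enorm p * enorm (normalize p - normalize q) =
    enorm (enorm p *: (normalize p - normalize q)).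
  by rewrite enormZ ger0_norm // ltW.
have -> : enorm p *: (normalize p - normalize q) =
    (p - q) + (enorm q - enorm p) *: normalize q.
  rewrite scalerBr normalizeK scalerBl normalizeK.
  by rewrite addrA subrK.
apply: le_trans (ler_enormD _ _) _; rewrite enormZ.
have q1 : enorm (normalize q) <= 1.
  have [->|q0] := eqVneq q 0; first by rewrite /normalize scaler0 enorm0.
  by rewrite enorm_unit // normalize_unit.
have : `|enorm q - enorm p| <= enorm (p - q).
  have := lip1_dist 0 q p; rewrite !subr0 enormC; exact.
have := normr_ge0 (enorm q - enorm p); have := enorm_ge0 (normalize q).
nra.
Qed.

Lemma near_dir x (e : R) : off_center x -> 0 < e ->
  \forall y \near x, off_center y /\ enorm (dir x - dir y) < e.
Proof.
move=> xo e0; have px : chart x != 0 by rewrite chart_eq0; apply/eqP.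
have pn0 := enorm_gt0 px.
have d0 : 0 < e * enorm (chart x) / 2 by rewrite divr_gt0 // mulr_gt0.
apply: filterI; first exact: open_nbhs_nbhs (conj open_off_center xo).
apply: filterS (near_chart x d0) => y xy.
apply: le_lt_trans (enorm_normalizeB _ px) _.
by rewrite ltr_pdivrMr // mulrC -ltr_pdivlMr.
Qed.

Lemma measurable_off_center : measurable (off_center : set (borel (hyp R n))).
Proof. by apply: measurableC; exact: measurable_point. Qed.

Lemma measurable_dir f : sphere_lip f ->
  measurable_fun (setT : set (borel (hyp R n))) (f \o dir).
Proof.
move=> [K [_ fL]].
rewrite -(setvU [set o]) -/off_center; apply/measurable_funU.
- exact: measurable_off_center.
- exact: measurable_point.
split; last exact: measurable_fun_set1.
apply: measurable_fun_continuous_on; first exact: open_off_center.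
move=> x xo e e0; have K1 : 0 < `|K| + 1 by rewrite ltr_wpDl.
have d0 : 0 < e / (`|K| + 1) by rewrite divr_gt0.
apply: filterS (near_dir xo d0) => y [yo xy] /=.
apply: le_lt_trans (fL _ _ (dir_unit xo) (dir_unit yo)) _.
move: xy; rewrite ltr_pdivlMr // mulrC; apply: le_lt_trans.
rewrite ler_wpM2r ?enorm_ge0 //; have := ler_norm K; lra.
Qed.

Lemma measurable_mdist_o :
  measurable_fun (setT : set (borel (hyp R n))) (fun x => mdist o x).
Proof.
apply: measurable_fun_lip => x y; rewrite ler_norml.
have := mdist_tri x o y; have := mdist_tri y o x; rewrite (mdist_sym y x); lra.
Qed.

End chart_topology.

(** * Directions under a radial measure *)

Section bounded_integrals.
Context {R : realType} d {T : measurableType d} (mu : probability T R).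

Lemma bounded_integrable (D : set T) (f : T -> R) (K : R) : measurable D ->
  measurable_fun D f -> (forall x, D x -> `|f x| <= K) ->
  mu.-integrable D (EFin \o f).
Proof.
move=> mD mf fK; apply: measurable_bounded_integrable => //.
  by rewrite (le_lt_trans (probability_le1 mu mD)) // ltry.
exists K; split; first exact: num_real.
by move=> M KM x Dx; apply: le_trans (fK x Dx) (ltW KM).
Qed.

Lemma markov_pr (D A : set T) (f : T -> R) (c : R) : measurable D ->
  measurable A -> A `<=` D -> mu.-integrable D (EFin \o f) ->
  (forall x, D x -> 0 <= f x) -> (forall x, A x -> c <= f x) ->
  c * pr mu A <= \int[mu]_(x in D) f x.
Proof.
move=> mD mA AD fi f0 fA.
have fAi : mu.-integrable A (EFin \o f) by exact: integrableS fi.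
have ci : mu.-integrable A (EFin \o fun=> c).
  apply: (@bounded_integrable _ _ `|c|) => //; exact: measurable_cst.
apply: (@le_trans _ _ (\int[mu]_(x in A) f x)).
  by rewrite /pr -Rintegral_cst //; apply: le_Rintegral.
rewrite /Rintegral -lee_fin !fineK; try exact: integrable_fin_num.
by apply: ge0_subset_integral => //; exact: measurable_int fi.
Qed.

End bounded_integrals.

Section radial_measure.
Context {R : realType} {n : nat} (o : hyp R n)
  (mu : probability (borel (hyp R n)) R) (mu_rad : radial o mu).
Local Notation dir := (dir o).
Local Notation D := (off_center o).
Local Notation chart := (chart o).
Implicit Types A B : set (borel (hyp R n)).

Lemma measurable_hyp_refl w : dot w w = 1 ->
  measurable_fun (setT : set (borel (hyp R n)))
    (hyp_refl o w : borel (hyp R n) -> borel (hyp R n)).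
Proof. by move=> w1; apply: measurable_preimage_lip => x y; rewrite mdist_hyp_refl. Qed.

Lemma pr_hyp_refl w A : dot w w = 1 -> measurable A ->
  pr mu (hyp_refl o w @^-1` A) = pr mu A.
Proof.
move=> w1 mA; rewrite /pr; congr fine; apply: mu_rad => //.
  exact: isometry_hyp_refl.
exact: hyp_refl_o.
Qed.

Lemma integral_hyp_refl w (f : hyp R n -> R) (K : R) : dot w w = 1 ->
  measurable_fun (setT : set (borel (hyp R n))) f -> (forall x, `|f x| <= K) ->
  (\int[mu]_x (f (hyp_refl o w x))%:E = \int[mu]_x (f x)%:E)%E.
Proof.
move=> w1 mf fK.
pose g : borel (hyp R n) -> borel (hyp R n) := hyp_refl o w.
transitivity (\int[pushforward mu g]_x (f x)%:E)%E.
  rewrite [RHS](integral_pushforward (measurable_hyp_refl w1)) //.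
  - exact/measurable_EFinP.
  - rewrite preimage_setT; apply: (@bounded_integrable _ _ _ _ _ _ K) => //.
    exact: (measurableT_comp mf (measurable_hyp_refl w1)).
apply: eq_measure_integral => [|mg A mA _]; first exact: measurable_hyp_refl.
exact: (mu_rad (isometry_hyp_refl o w1) (hyp_refl_o o w)).
Qed.

(** Points have no direction at [o], so that the total mass is that of the
   complement of [o]. *)
Definition dir_mean (f : 'rV[R]_n -> R) : R := \int[mu]_(x in D) f (dir x).

Lemma integrable_dir f : sphere_lip f -> mu.-integrable D (EFin \o (f \o dir)).
Proof.
move=> fl; have [K [fK _]] := fl; apply: (@bounded_integrable _ _ _ _ _ _ K).
- exact: measurable_off_center.
- by apply: measurable_funTS; exact: measurable_dir.
- by move=> x /dir_unit; exact: fK.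
Qed.

Lemma invariant_dir_mean : invariant_mean dir_mean.
Proof.
have mD := measurable_off_center o.
split.
- move=> f g fl gl; exact: (RintegralD mD (integrable_dir fl) (integrable_dir gl)).
- move=> c f fl; exact: (RintegralZl _ mD (integrable_dir fl)).
- move=> f g fl gl fg.
  apply: (le_Rintegral mD (integrable_dir fl) (integrable_dir gl)).
  by move=> x /dir_unit; exact: fg.
- move=> w f w1 fl; have [K [fK _]] := fl.
  rewrite /dir_mean /Rintegral integral_mkcond [in RHS]integral_mkcond.
  congr fine; pose F x := if x \in D then f (dir x) else 0.
  have FE x : ((fun x => (f (dir x))%:E) \_ D) x = (F x)%:E.
    by rewrite patchE /F; case: ifP.
  have -> : (fun x => (f (refl w (dir x)))%:E) \_ D =
      fun x => (F (hyp_refl o w x))%:E.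
    apply/funext => x; rewrite patchE /F dir_hyp_refl //.
    have -> : (hyp_refl o w x \in D) = (x \in D).
      by apply/idP/idP; rewrite !inE => /off_center_hyp_refl; apply.
    by case: ifP.
  under [RHS]eq_integral do rewrite FE.
  apply: (@integral_hyp_refl _ _ `|K|) => // [|x].
    rewrite (_ : F = (f \o dir) \_ D).
      by apply/(measurable_restrictT _ mD)/measurable_funTS; exact: measurable_dir.
    by apply/funext => x; rewrite patchE.
  rewrite /F; case: ifPn => [|_]; last by rewrite normr0.
  by rewrite inE => /dir_unit x1; rewrite (le_trans (fK _ x1)) // ler_norm.
Qed.

Let IM := invariant_dir_mean.

Lemma dir_mean1 : dir_mean (fun=> 1) = pr mu D.
Proof.
rewrite /dir_mean Rintegral_cst ?mul1r //; exact: measurable_off_center.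
Qed.

Lemma dir_mean1_le1 : dir_mean (fun=> 1) <= 1.
Proof. by rewrite dir_mean1 pr_le1 //; exact: measurable_off_center. Qed.

Lemma dir_mean_markov A f c : measurable A -> A `<=` D -> sphere_lip f ->
  (forall v, dot v v = 1 -> 0 <= f v) -> (forall x, A x -> c <= f (dir x)) ->
  c * pr mu A <= dir_mean f.
Proof.
move=> mA AD fl f0 fA; apply: markov_pr => //.
- exact: measurable_off_center.
- exact: integrable_dir.
- by move=> x /dir_unit; exact: f0.
Qed.

(** The support of the measure contains a point other than [o]; its direction
   carries mass near it. *)
Lemma dir_mean_bump : 0 < pr mu D ->
  exists2 z : 'rV[R]_n, dot z z = 1 & forall r, 0 < r -> 0 < dir_mean (bump r z).
Proof.
move=> D0; have mD := measurable_off_center o.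
have [x [Sx xo]] : exists x, Defs.support mu x /\ D x.
  apply: contrapT => H; move: D0; rewrite (_ : pr mu D = 0) ?ltxx //.
  apply/eqP; rewrite eq_le pr_ge0 andbT.
  have -> : 0 = pr mu (~` Defs.support mu) by rewrite /pr measure_supportC.
  apply: le_pr => //; first by apply: measurableC; exact: measurable_support.
  by move=> x xo Sx; apply: H; exists x.
exists (dir x); first exact: dir_unit.
move=> r r0; have r20 : 0 < r / 2 by rewrite divr_gt0.
pose U := (interior [set y | D y /\ enorm (dir x - dir y) < r / 2]).
have mU : measurable (U : set (borel (hyp R n))).
  by apply: measurable_open; exact: open_interior.
have U0 : 0 < pr mu U.
  rewrite -lte_fin prE //; apply: Sx; first exact: open_interior.
  exact: near_dir.
apply: lt_le_trans (@dir_mean_markov U (bump r (dir x)) (r / 2) mU _ _ _ _).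
- by rewrite mulr_gt0.
- by move=> y /interior_subset[].
- exact: lip1_sphere_lip (lip1_bump _ _).
- by move=> v _; rewrite /bump le_max lexx.
- move=> y /interior_subset[_]; rewrite enormC => xy.
  by rewrite /bump le_max; apply/orP; right; lra.
Qed.

(** Otherwise the distance to the directions of [A] would be a [1]-Lipschitz
   function equal to [0] on [A] and at least [r] on [B], with a larger variance
   than concentration allows. *)
Lemma close_directions A B (delta r : R) : (1 < n)%N -> measurable A ->
  measurable B -> A `<=` D -> B `<=` D -> 0 < delta -> delta <= pr mu A ->
  delta <= pr mu B -> 0 < r -> 104 / (delta * n%:R) < r ^+ 2 ->
  exists x y, [/\ A x, B y & enorm (dir x - dir y) < r].
Proof.
move=> n1 mA mB AD BD d0 dA dB r0 rn.
have nz F : measurable F -> delta <= pr mu F -> F !=set0.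
  move=> mF dF; apply/set0P; apply/negP => /eqP F0; move: dF.
  by rewrite F0 pr0 leNgt d0.
have [a0 Aa0] := nz _ mA dA.
apply: contrapT => H.
have far x y : A x -> B y -> r <= enorm (dir x - dir y).
  by move=> Ax By; rewrite leNgt; apply/negP => xy; apply: H; exists x, y.
pose S v := [set enorm (v - dir x) | x in A].
have Slb v : has_inf (S v).
  split; first by exists (enorm (v - dir a0)), a0.
  by exists 0 => _ [x _ <-]; exact: enorm_ge0.
pose f v := inf (S v).
have f_le v x : A x -> f v <= enorm (v - dir x).
  by move=> Ax; apply: ge_inf; [exact: (Slb v).2|exists x].
have fl : lip1 f.
  have half v w : f v <= f w + enorm (v - w).
    rewrite -lerBlDr; apply: lb_le_inf; first exact: (Slb w).1.
    move=> _ [x Ax <-]; rewrite lerBlDr; apply: le_trans (f_le v x Ax) _.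
    by rewrite [leRHS]addrC; exact: ler_enormB.
  move=> v w; rewrite ler_norml; have := half v w; have := half w v.
  rewrite (enormC w v); lra.
have fA x : A x -> f (dir x) = 0.
  move=> Ax; apply/eqP; rewrite eq_le; apply/andP; split.
    by have := f_le (dir x) x Ax; rewrite subrr enorm0.
  by apply: lb_le_inf; [exact: (Slb _).1|move=> _ [y _ <-]; exact: enorm_ge0].
have fB y : B y -> r <= f (dir y).
  move=> By; apply: lb_le_inf; first exact: (Slb _).1.
  by move=> _ [x Ax <-]; rewrite enormC; exact: far.
have D0 : 0 < pr mu D.
  apply: lt_le_trans d0 _; apply: le_trans dA _.
  by apply: le_pr => //; exact: measurable_off_center.
(* one of the sets lies at distance [r / 2] from the center [c] of [f]; hence
   [104 = 4 * 26] *)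
have [c cE] := mean_concentration IM n1 fl (dir_mean_bump D0).
have lb : (r / 2) ^+ 2 * delta <= dir_mean (fun v => (f v - c) ^+ 2).
  have fcl : sphere_lip (fun v => (f v - c) ^+ 2).
    apply: sphere_lipX; apply: sphere_lipB (sphere_lip_cst c).
    exact: lip1_sphere_lip.
  have key (F : set (borel (hyp R n))) : measurable F -> F `<=` D -> delta <= pr mu F ->
      (forall x, F x -> (r / 2) ^+ 2 <= (f (dir x) - c) ^+ 2) ->
      (r / 2) ^+ 2 * delta <= dir_mean (fun v => (f v - c) ^+ 2).
    move=> mF FD dF Fc; apply: le_trans (dir_mean_markov mF FD fcl _ Fc).
      by rewrite ler_wpM2l // sqr_ge0.
    by move=> v _; exact: sqr_ge0.
  have [rc|rc] := leP (r / 2) c.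
    by apply: (key A) => // x Ax; rewrite fA // sub0r sqrrN lerXn2r ?nnegrE //; lra.
  apply: (key B) => // x /fB fx; rewrite lerXn2r ?nnegrE //; lra.
have n0 : 0 < n%:R :> R by rewrite ltr0n ltnW.
have : (r / 2) ^+ 2 * delta <= 26 / n%:R.
  apply: le_trans lb (le_trans cE _); rewrite -[leRHS]mulr1.
  by rewrite ler_wpM2l ?dir_mean1_le1 // divr_ge0 // ltW.
rewrite expr_div_n; move: rn; rewrite ltr_pdivrMr ?mulr_gt0 // ler_pdivlMr //.
nra.
Qed.

Lemma measurable_dir_dot v :
  measurable_fun (setT : set (borel (hyp R n))) (fun x => dot (dir x) v).
Proof. exact: (measurable_dir o (sphere_lip_dot v)). Qed.

Lemma measurable_dot_ge v t :
  measurable ([set x | t <= dot (dir x) v] : set (borel (hyp R n))).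
Proof.
have := measurable_dir_dot v measurableT (measurable_itv `[t, +oo[).
by rewrite setTI /preimage /=; under eq_set do rewrite in_itv /= andbT.
Qed.

Lemma measurable_dot_le v t :
  measurable ([set x | `|dot (dir x) v| <= t] : set (borel (hyp R n))).
Proof.
have := measurable_dir_dot v measurableT (measurable_itv `[- t, t]).
by rewrite setTI /preimage /=; under eq_set do rewrite in_itv /= -ler_norml.
Qed.

(** A coordinate of the direction has second moment at most [1 / n]. *)
Lemma large_coordinate v t : (0 < n)%N -> dot v v = 1 -> 0 < t ->
  pr mu [set x | t < `|dot (dir x) v|] <= (t ^+ 2 * n%:R)^-1.
Proof.
move=> n0 v1 t0; have n0' : 0 < n%:R :> R by rewrite ltr0n.
have lipv : sphere_lip (fun w => dot w v ^+ 2).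
  by apply: sphere_lipX; exact: sphere_lip_dot.
have mA : measurable ([set x | t < `|dot (dir x) v|] : set (borel (hyp R n))).
  rewrite -[X in measurable X]setCK; apply: measurableC.
  by under eq_set do rewrite ltNge; have := measurable_dot_le v t;
     rewrite (_ : ~` _ = [set x | `|dot (dir x) v| <= t]) //; apply/seteqP;
     split => x /=; [move=> /negP; rewrite negbK|move=> h; apply/negP; rewrite negbK].
have : t ^+ 2 * pr mu [set x | t < `|dot (dir x) v|] <=
    dir_mean (fun w => dot w v ^+ 2).
  apply: dir_mean_markov => //.
  - by move=> x /= h xo; move: h; rewrite xo dir_o dot0l normr0 ltNge ltW.
  - by move=> w _; exact: sqr_ge0.
  - move=> x /= h; rewrite -(real_normK (num_real (dot _ _))).
    by rewrite lerXn2r ?nnegrE // ltW // (lt_trans t0).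
have E := mean_sqr IM v1; have M := dir_mean1_le1.
move=> h; rewrite -[leRHS]mul1r ler_pdivlMr ?mulr_gt0 ?exprn_gt0 //.
apply: le_trans M; rewrite -E; nra.
Qed.

End radial_measure.

(** * A coordinate is rarely small *)

Section small_coordinates.
Context {R : realType} {n : nat} (o : hyp R n)
  (mu : probability (borel (hyp R n)) R) (mu_rad : radial o mu).
Local Notation dir := (dir o).
Local Notation D := (off_center o).
Local Notation pr := (pr mu).

Lemma measurable_small v t :
  measurable ([set x | D x /\ `|dot (dir x) v| <= t] : set (borel (hyp R n))).
Proof.
by apply: measurableI; [exact: measurable_off_center|exact: measurable_dot_le].
Qed.

Lemma pr_reflect u (A B : set (borel (hyp R n))) : dot u u = 1 -> measurable A ->
  (forall x, B x <-> A (hyp_refl o u x)) -> pr A = pr B.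
Proof.
move=> u1 mA AB; rewrite -(pr_hyp_refl mu_rad u1 mA); congr (pr _).
by apply/seteqP; split => x /AB.
Qed.

Lemma pr_move (A B : set (borel (hyp R n))) x y : measurable A ->
  dot x x = 1 -> dot y y = 1 -> (x = y -> B = A) ->
  (forall z, B z <-> A (hyp_refl o (normalize (y - x)) z)) -> pr A = pr B.
Proof.
move=> mA x1 y1 BA AB; have [xy|xy] := eqVneq x y; first by rewrite BA.
by apply: (pr_reflect _ mA AB); exact: normalizeB_unit.
Qed.

Definition small_box m t : set (hyp R n) :=
  [set x | D x /\ forall i, (i < m)%N -> `|dot (dir x) (axis i)| <= t].

Lemma measurable_small_box m t :
  measurable (small_box m t : set (borel (hyp R n))).
Proof.
elim: m => [|m IH].
  rewrite (_ : small_box 0 t = D); first exact: measurable_off_center.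
  by apply/seteqP; split => [x []|x xo]; [|split].
rewrite (_ : small_box m.+1 t =
    small_box m t `&` [set x | D x /\ `|dot (dir x) (axis m)| <= t]).
  by apply: measurableI => //; exact: measurable_small.
apply/seteqP; split => x.
  move=> [xo xs]; split; first by split => // i im; apply: xs; exact: ltnW.
  by split => //; exact: xs.
move=> [[xo xs] [_ xm]]; split => // i; rewrite ltnS leq_eqVlt => /predU1P[->//|].
exact: xs.
Qed.

(** In the plane of two axes the direction of the projection of a random point
   is uniform. Being close to one of [L] pairwise transverse lines of that plane
   without being close to the origin happens for at most one line at a time, and
   all lines are equally likely. *)
Lemma small_box_step m (t : R) L : (m.+1 < n)%N -> (0 < L)%N -> 0 <= t ->
  pr (small_box m.+1 t) <= L%:R^-1 + pr (small_box m.+2 (3 * L%:R ^+ 2 * t)).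
Proof.
move=> mn L0 t0; have mn' : (m < n)%N by exact: ltnW.
pose v (k : 'I_L) : 'rV[R]_n := normalize (axis m + k%:R *: axis m.+1).
have ax1 := @axis_unit R n m mn'; have ax2 := @axis_unit R n m.+1 mn.
have ax12 : dot (axis m : 'rV[R]_n) (axis m.+1) = 0.
  by rewrite dot_axis // (ltn_eqF (ltnSn m)).
have pE k : dot (axis m + k%:R *: axis m.+1 : 'rV[R]_n)
    (axis m + k%:R *: axis m.+1) = 1 + k%:R ^+ 2.
  by rewrite !dotE ax1 ax2 (dotC (axis m.+1)) ax12; ring.
have p0 k : axis m + k%:R *: axis m.+1 != 0 :> 'rV[R]_n.
  apply/eqP => E; have := pE k; rewrite E dot0l; have := sqr_ge0 (k%:R : R); lra.
have v1 k : dot (v k) (v k) = 1 by exact: normalize_unit.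
have vax k i : (i < m)%N -> dot (v k) (axis i) = 0.
  move=> im; rewrite /v /normalize dotZl dotDl dotZl !dot_axis //.
  by rewrite !gtn_eqF ?mulr0 ?addr0 ?mulr0 // ltnW.
pose F k : set (hyp R n) := [set x | small_box m t x /\ `|dot (dir x) (v k)| <= t].
have mF k : measurable (F k : set (borel (hyp R n))).
  rewrite (_ : F k = small_box m t `&` [set x | D x /\ `|dot (dir x) (v k)| <= t]).
    by apply: measurableI; [exact: measurable_small_box|exact: measurable_small].
  by apply/seteqP; split => x [] xs; [split => //; split => //; case: xs|case].
have FE k : pr (F k) = pr (small_box m.+1 t).
  have S x : small_box m.+1 t x <->
      small_box m t x /\ `|dot (dir x) (axis m)| <= t.
    split=> [[xo xs]|[[xo xs] xm]].
      by split; [split => // i im; apply: xs; exact: ltnW|exact: xs].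
    by split => // i; rewrite ltnS leq_eqVlt => /predU1P[->//|]; exact: xs.
  apply: (@pr_move _ _ (v k) (axis m)) => //.
    by move=> vE; apply/seteqP; split => x; rewrite /F /= vE S.
  move=> z; rewrite S /F /small_box /=.
  have [vE|vn] := eqVneq (v k) (axis m).
    rewrite vE subrr /hyp_refl (_ : normalize 0 = 0); last first.
      by rewrite /normalize scaler0.
    by rewrite /refl scaler0 subr0 chartK.
  have u1 : dot (normalize (axis m - v k)) (normalize (axis m - v k)) = 1.
    exact: normalizeB_unit.
  rewrite dir_hyp_refl // dot_refll refl_swap ?v1 ?ax1 //.
  have E i : (i < m)%N -> dot (refl (normalize (axis m - v k)) (dir z)) (axis i) =
      dot (dir z) (axis i).
    move=> im; rewrite dot_refll refl_orth // /normalize dotZr dotDr dotNr.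
    rewrite (dotC _ (v k)) vax // dot_axis ?(ltn_trans im) //.
    by rewrite (ltn_eqF im) subrr mulr0.
  have O := off_center_hyp_refl o z u1.
  split=> -[[zo zs] zm]; split => //; split; rewrite ?O //; do ?exact/O.
  - by move=> i im; rewrite E //; exact: zs.
  - by move=> i im; rewrite -E //; exact: zs.
set E := small_box m.+2 _.
have mE : measurable (E : set (borel (hyp R n))) by exact: measurable_small_box.
have overlap k l x : k != l -> F k x -> F l x -> E x.
  move=> kl [[xo xs] xk] [_ xl].
  have L1 : 1 <= L%:R :> R by rewrite ler1n.
  set a := dot (dir x) (axis m); set b := dot (dir x) (axis m.+1).
  have line (q : 'I_L) : `|dot (dir x) (v q)| <= t -> `|a + q%:R * b| <= t * L%:R.
    have q0 : 0 <= q%:R :> R by [].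
    have qL : q%:R + 1 <= L%:R :> R by rewrite natr1 ler_nat.
    have -> : a + q%:R * b =
        enorm (axis m + q%:R *: axis m.+1 : 'rV[R]_n) * dot (dir x) (v q).
      by rewrite -dotZr normalizeK dotDr dotZr.
    rewrite normrM (ger0_norm (enorm_ge0 _)) => h; rewrite mulrC.
    apply: ler_pM => //; first exact: enorm_ge0.
    apply: le_trans qL; rewrite -(@ler_pXn2r _ 2) ?nnegrE ?enorm_ge0 ?addr_ge0 //.
    by rewrite sqr_enorm pE; nra.
  have {xk} hk := line _ xk; have {xl} hl := line _ xl.
  have b2 : `|b| <= 2 * t * L%:R.
    have kl1 : 1 <= `|k%:R - l%:R| :> R.
      have := kl; rewrite -(inj_eq val_inj) neq_ltn => /orP[] lt.
        have : k%:R + 1 <= l%:R :> R by rewrite natr1 ler_nat.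
        by move=> ?; rewrite ler_normr; apply/orP; right; lra.
      have : l%:R + 1 <= k%:R :> R by rewrite natr1 ler_nat.
      by move=> ?; rewrite ler_normr; apply/orP; left; lra.
    have : `|(k%:R - l%:R) * b| <= 2 * t * L%:R.
      have -> : (k%:R - l%:R) * b = (a + k%:R * b) - (a + l%:R * b) by ring.
      apply: le_trans (ler_normB _ _) _; lra.
    rewrite normrM; have := normr_ge0 b; nra.
  have a2 : `|a| <= t * L%:R + L%:R * (2 * t * L%:R).
    have -> : a = (a + k%:R * b) - k%:R * b by ring.
    apply: le_trans (ler_normB _ _) _; apply: lerD => //.
    rewrite normrM normr_nat; apply: ler_pM => //.
    by rewrite ler_nat ltnW.
  have L0' : 0 <= L%:R - 1 :> R by rewrite subr_ge0.
  have m1 := mulr_ge0 t0 L0'; have m2 := mulr_ge0 m1 (ler0n R L).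
  split => // i; rewrite ltnS leq_eqVlt => /predU1P[->|].
    by apply: le_trans b2 _; lra.
  rewrite ltnS leq_eqVlt => /predU1P[->|im].
    by apply: le_trans a2 _; lra.
  by apply: le_trans (xs i im) _; lra.
have mFE k : measurable (F k `\` E : set (borel (hyp R n))) by exact: measurableD.
have sum1 : \sum_(k < L) pr (F k `\` E) <= 1.
  rewrite -(@pr_bigcup _ _ _ mu _ (fun k => F k `\` E)) //; last first.
    move=> k l x _ _ [Fk nE] [Fl _]; apply/eqP; apply: contraPT nE => kl.
    by apply; exact: overlap Fk Fl.
  by apply: pr_le1; exact: bigsetU_measurable.
have : \sum_(k < L) (pr (small_box m.+1 t) - pr E) <= 1.
  apply: le_trans sum1; apply: ler_sum => k _.
  rewrite lerBlDr -(FE k); apply: le_trans (prU_le _ (mFE k) mE).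
  apply: le_pr => //; first exact: measurableU.
  by move=> x Fx; have [Ex|nE] := pselect (E x); [right|left].
rewrite sumr_const card_ord -[leLHS]mulr_natl -ler_pdivlMl ?ltr0n // mulr1.
by rewrite lerBlDr.
Qed.

Lemma small_box_iter m (t : R) L : (m < n)%N -> (0 < L)%N -> 0 <= t ->
  pr (small_box 1 t) <=
  m%:R / L%:R + pr (small_box m.+1 ((3 * L%:R ^+ 2) ^+ m * t)).
Proof.
move=> mn L0 t0; elim: m mn => [|m IH] mn.
  by rewrite mul0r add0r expr0 mul1r.
apply: le_trans (IH (ltnW mn)) _.
have K0 : 0 <= 3 * L%:R ^+ 2 :> R by rewrite mulr_ge0 // sqr_ge0.
have := small_box_step mn L0 (mulr_ge0 (exprn_ge0 m K0) t0).
have -> : 3 * L%:R ^+ 2 * ((3 * L%:R ^+ 2) ^+ m * t) =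
    (3 * L%:R ^+ 2) ^+ m.+1 * t by rewrite (exprS (3 * _)) mulrA.
by rewrite -[m.+1%:R]natr1 mulrDl mul1r; lra.
Qed.

(** All coordinates of a block being small contradicts the concentration of the
   sum of their squares around [m / n]. *)
Lemma small_box_block m (t : R) : (0 < m <= n)%N -> (1 < n)%N ->
  0 <= t -> t ^+ 2 <= (2 * n%:R)^-1 -> pr (small_box m t) <= 8 / m%:R.
Proof.
move=> /andP[m0 mn] n1 t0 tn.
have m0' : 0 < m%:R :> R by rewrite ltr0n.
have n0' : 0 < n%:R :> R by rewrite ltr0n ltnW.
have lipS : sphere_lip (fun v : 'rV[R]_n =>
    (\sum_(i < m) dot v (axis i) ^+ 2 - m%:R / n%:R) ^+ 2).
  apply: sphere_lipX; apply: sphere_lipB (sphere_lip_cst _).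
  by apply: sphere_lip_sum => i; apply: sphere_lipX; exact: sphere_lip_dot.
have h2 := mean_block_var (invariant_dir_mean mu_rad) mn n1.
have h1 : m%:R / (2 * n%:R) ^+ 2 * m%:R * pr (small_box m t) <= dir_mean o mu
    (fun v => (\sum_(i < m) dot v (axis i) ^+ 2 - m%:R / n%:R) ^+ 2).
  apply: dir_mean_markov => //; first exact: measurable_small_box.
  - by move=> x [].
  - by move=> v _; exact: sqr_ge0.
  move=> x [xo xs]; rewrite -[(_ - _) ^+ 2]sqrrN opprB.
  have S : \sum_(i < m) dot (dir x) (axis i) ^+ 2 <= m%:R * (2 * n%:R)^-1.
    rewrite mulr_natl -[X in _ *+ X](card_ord m) -sumr_const; apply: ler_sum => i _.
    apply: le_trans tn; rewrite -(real_normK (num_real (dot _ _))).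
    by rewrite lerXn2r ?nnegrE //; exact: xs.
  have -> : m%:R / (2 * n%:R) ^+ 2 * m%:R = (m%:R * (2 * n%:R)^-1) ^+ 2 :> R.
    by field; rewrite gt_eqF.
  have E : m%:R / n%:R = m%:R * (2 * n%:R)^-1 + m%:R * (2 * n%:R)^-1 :> R.
    by field; rewrite gt_eqF.
  have q0 : 0 <= m%:R * (2 * n%:R)^-1 :> R by rewrite mulr_ge0 // invr_ge0 mulr_ge0.
  by rewrite lerXn2r ?nnegrE //; lra.
have h3 := dir_mean1_le1 o mu.
have h4 : 2 * m%:R / n%:R ^+ 2 * dir_mean o mu (fun=> 1) <= 2 * m%:R / n%:R ^+ 2.
  by rewrite -[leRHS]mulr1 ler_wpM2l // divr_ge0 ?sqr_ge0 // mulr_ge0.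
have {h1 h2 h3 h4} := le_trans h1 (le_trans h2 h4).
have -> : m%:R / (2 * n%:R) ^+ 2 * m%:R * pr (small_box m t) =
   (m%:R / n%:R ^+ 2 / 4) * (m%:R * pr (small_box m t)).
  by field; rewrite gt_eqF.
have -> : 2 * m%:R / n%:R ^+ 2 = (m%:R / n%:R ^+ 2 / 4) * 8 :> R.
  by field; rewrite gt_eqF.
rewrite ler_pM2l; last by rewrite !divr_gt0 // exprn_gt0.
by rewrite ler_pdivlMr // mulrC.
Qed.

End small_coordinates.

(** Small-ball estimate, uniform in the dimension: if one coordinate is small, then
   up to small probability so is a whole block of [m.+1] coordinates, which
   concentration of the block forbids. *)
Lemma small_coordinate (R : realType) (eps : R) : 0 < eps ->
  exists2 c : R, 0 < c & exists n0 : nat, forall n (o : hyp R n)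
    (mu : probability (borel (hyp R n)) R), radial o mu -> (n0 <= n)%N ->
    forall v, dot v v = 1 ->
    pr mu [set x | off_center o x /\ `|dot (dir o x) v| <= c / Num.sqrt n%:R] <= eps.
Proof.
move=> e0.
have [m m_gt] : exists m : nat, 16 / eps <= m.+1%:R.
  exists (Num.truncn (16 / eps)); apply: ltW; exact: truncnS_gt.
have [l l_gt] : exists l : nat, 2 * m%:R / eps <= l.+1%:R.
  exists (Num.truncn (2 * m%:R / eps)); apply: ltW; exact: truncnS_gt.
set K : R := (3 * l.+1%:R ^+ 2) ^+ m.
have K0 : 0 < K by rewrite exprn_gt0 // mulr_gt0 // exprn_gt0.
exists (2 * K)^-1; first by rewrite invr_gt0 mulr_gt0.
exists m.+2 => n o mu mu_rad n_ge v v1.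
have n1 : (1 < n)%N by exact: leq_trans n_ge.
have n0 : 0 < n%:R :> R by rewrite ltr0n ltnW.
set t := _ / Num.sqrt _.
have t0 : 0 <= t by rewrite divr_ge0 ?sqrtr_ge0 // invr_ge0 mulr_ge0 // ltW.
have a1 : dot (axis 0 : 'rV[R]_n) (axis 0) = 1 by rewrite axis_unit // ltnW.
have -> : pr mu [set x | off_center o x /\ `|dot (dir o x) v| <= t] =
    pr mu (small_box o 1 t).
  have S (x : hyp R n) : small_box o 1 t x <->
      off_center o x /\ `|dot (dir o x) (axis 0)| <= t.
    by split=> [[xo xs]|[xo xs]]; split => //; [exact: xs|case].
  apply: (@pr_move _ _ o mu mu_rad _ _ v (axis 0)) => //.
  - exact: measurable_small.
  - by move=> ->; apply/seteqP; split => x; rewrite S.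
  - move=> z; rewrite S; have [vE|vn] := eqVneq v (axis 0).
      rewrite vE subrr /hyp_refl (_ : normalize 0 = 0); last first.
        by rewrite /normalize scaler0.
      by rewrite /refl scaler0 subr0 chartK.
    have u1 : dot (normalize (axis 0 - v)) (normalize (axis 0 - v)) = 1.
      exact: normalizeB_unit.
    rewrite /= dir_hyp_refl // dot_refll refl_swap ?v1 ?a1 //.
    by have O := off_center_hyp_refl o z u1; rewrite O.
apply: le_trans (small_box_iter mu_rad (m := m) (L := l.+1) _ _ t0) _ => //.
  by apply: leq_trans n_ge.
rewrite -/K [leRHS]splitr; apply: lerD.
  rewrite ler_pdivrMr // -ler_pdivrMl ?divr_gt0 // invf_div.
  by apply: le_trans l_gt; rewrite mulrAC.
apply: le_trans (small_box_block mu_rad _ n1 _ _) _.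
- exact: leq_trans n_ge.
- by rewrite mulr_ge0 // ltW.
- have -> : K * t = (2 * Num.sqrt n%:R)^-1.
    by rewrite /t; field; rewrite !gt_eqF // sqrtr_gt0.
  rewrite exprVn exprMn sqr_sqrtr ?(ltW n0) // lef_pV2 ?posrE ?mulr_gt0 ?exprn_gt0 //.
  by rewrite ler_pM2r //; lra.
- rewrite ler_pdivrMr // -ler_pdivrMl ?divr_gt0 // invf_div.
  by apply: le_trans m_gt; rewrite mulrAC -natrM.
Qed.

(** * Cells of the largest coordinate *)

Section argmax_cells.
Context {R : realType} {n : nat} (o : hyp R n)
  (mu : probability (borel (hyp R n)) R) (mu_rad : radial o mu).
Local Notation dir := (dir o).
Local Notation D := (off_center o).
Local Notation pr := (pr mu).

(** Requiring the margin [t] over every other coordinate makes the cells disjoint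
   and separated; exchanging two axes exchanges two cells, so that their masses
   agree exactly. *)
Definition argmax_cell (W : set (hyp R n)) N (t : R) i : set (hyp R n) :=
  [set x | W x /\ forall j, (j < N)%N -> j != i ->
    t <= dot (dir x) (axis i - axis j)].

Context (W : set (hyp R n)) (mW : measurable (W : set (borel (hyp R n))))
  (WE : forall x y, mdist o x = mdist o y -> W x -> W y).

Lemma measurable_argmax_cell N t i :
  measurable (argmax_cell W N t i : set (borel (hyp R n))).
Proof.
rewrite (_ : argmax_cell W N t i = W `&` \bigcap_(j in [set j | (j < N)%N && (j != i)])
    [set x | t <= dot (dir x) (axis i - axis j)]).
  apply: measurableI => //; apply: bigcap_measurableType => j _.
  exact: measurable_dot_ge.
apply/seteqP; split => x [Wx h]; split => // j.
  by move=> /andP[]; exact: h.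
by move=> jN ji; apply: h => /=; rewrite jN.
Qed.

Lemma argmax_cell_disjoint N t i j x : 0 < t -> (i < N)%N -> (j < N)%N ->
  argmax_cell W N t i x -> argmax_cell W N t j x -> i = j.
Proof.
move=> t0 iN jN [_ hi] [_ hj]; apply/eqP; apply: contraT => ij.
have := hi j jN; rewrite eq_sym ij => /(_ isT).
have := hj i iN ij; rewrite !dotDr !dotNr; lra.
Qed.

Lemma pr_argmax_cell N t i j : (N <= n)%N -> (i < N)%N -> (j < N)%N ->
  pr (argmax_cell W N t i) = pr (argmax_cell W N t j).
Proof.
move=> Nn iN jN.
have axu k : (k < N)%N -> dot (axis k : 'rV[R]_n) (axis k) = 1.
  by move=> kN; rewrite axis_unit // (leq_trans kN).
have [->//|ij] := eqVneq i j.
have axij : axis i != axis j :> 'rV[R]_n.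
  apply: contra_neq ij => E; have := axu i iN; rewrite {2}E dot_axis.
    by case: eqVneq => // _ /esym/eqP; rewrite oner_eq0.
  exact: leq_trans iN Nn.
set u : 'rV[R]_n := normalize (axis j - axis i).
have u1 : dot u u = 1 by exact: normalizeB_unit.
have ui : refl u (axis i) = axis j by rewrite refl_swap // !axu.
have uj : refl u (axis j) = axis i by rewrite -ui reflK.
have uk k : (k < N)%N -> k != i -> k != j -> refl u (axis k) = axis k.
  move=> kN ki kj; rewrite refl_orth // /u /normalize dotZr dotDr dotNr.
  rewrite !dot_axis ?(leq_trans kN) //.
  by rewrite (negbTE ki) (negbTE kj) subrr mulr0.
have half a b x : (a < N)%N -> (b < N)%N -> a != b -> refl u (axis a) = axis b ->
    refl u (axis b) = axis a ->
    (forall k, (k < N)%N -> k != a -> k != b -> refl u (axis k) = axis k) ->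
    argmax_cell W N t b x -> argmax_cell W N t a (hyp_refl o u x).
  move=> aN bN ab ua ub uab [Wx h]; split.
    by apply: WE Wx; rewrite -{2}(hyp_refl_o o u) mdist_hyp_refl.
  move=> k kN ka; rewrite dir_hyp_refl // dot_refll reflB ua.
  have [->|kb] := eqVneq k b; first by rewrite ub; exact: h.
  by rewrite uab //; exact: h.
apply: (pr_reflect mu_rad u1); first exact: measurable_argmax_cell.
move=> x; split; first by apply: half.
move=> /(half j i _ jN iN); rewrite eq_sym ij uj ui hyp_reflK //.
by apply => // k kN kj ki; exact: uk.
Qed.

(** A point outside all cells, lying in [W] and different from [o], has two
   coordinates closer than [t]. *)
Lemma argmax_cells_mass N t eps : (0 < N <= n)%N ->
  (forall v, dot v v = 1 ->
    pr [set x | D x /\ `|dot (dir x) v| <= t] <= eps) ->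
  pr W - pr [set o] - N%:R ^+ 2 * eps <=
    N%:R * pr (argmax_cell W N t 0).
Proof.
move=> /andP[N0 Nn] small.
have mD := measurable_off_center o.
pose B (p : 'I_N * 'I_N) : set (hyp R n) :=
  if p.1 == p.2 then set0 else
  [set x | D x /\ `|dot (dir x) (normalize (axis p.1 - axis p.2))| <= t].
have axn (k : 'I_N) : (k < n)%N by exact: leq_trans (ltn_ord k) Nn.
have nz (i j : 'I_N) : i != j -> axis i - axis j != 0 :> 'rV[R]_n.
  move=> ij; rewrite subr_eq0; apply: contra_neq ij => E; apply: val_inj => /=.
  have := @axis_unit R n i (axn i); rewrite {2}E dot_axis //.
  by case: eqVneq => // _ /esym/eqP; rewrite oner_eq0.
have eps0 : 0 <= eps.
  have := small (axis 0) (axis_unit (leq_trans N0 Nn)).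
  exact: le_trans (pr_ge0 _ _).
have mB p : measurable (B p : set (borel (hyp R n))).
  by rewrite /B; case: ifP => // _; exact: measurable_small.
have prB p : pr (B p) <= eps.
  rewrite /B; case: ifPn => [_|p12]; first by rewrite pr0.
  by apply: small; rewrite normalize_unit // nz.
have mC (i : 'I_N) := measurable_argmax_cell N t i.
pose C := \big[setU/set0]_(i < N) argmax_cell W N t i.
have cover : W `<=` C `|` ([set o] `|` \big[setU/set0]_p B p).
  move=> x Wx; have [->|xo] := pselect (x = o); first by right; left.
  pose i := [arg max_(k > Ordinal N0) dot (dir x) (axis (k : 'I_N))]%O.
  have imax (k : 'I_N) : dot (dir x) (axis k) <= dot (dir x) (axis i).
    by rewrite /i; case: arg_maxP => // m _ /(_ k isT).
  have [/existsP[p Bp]|/existsPn nB] := boolP [exists p, `[< B p x >]].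
    right; right; rewrite -bigcup_seq; exists p => /=; first by rewrite mem_index_enum.
    exact/asboolP.
  left; rewrite /C -bigcup_seq; exists i => /=; first by rewrite mem_index_enum.
  split => // j jN ji; pose j' := Ordinal jN.
  have ij' : i != j' by rewrite -(inj_eq val_inj) eq_sym.
  have := nB (i, j') => /asboolPn; rewrite /B /= (negbTE ij') => nBij.
  have lt_t : t < `|dot (dir x) (normalize (axis i - axis j'))|.
    by rewrite ltNge; apply/negP => le_t; exact: nBij.
  apply: ltW; apply: lt_le_trans lt_t _.
  have d0 : 0 <= dot (dir x) (axis i - axis j) by rewrite dotDr dotNr subr_ge0 (imax j').
  have e1 : 1 <= enorm (axis i - axis j : 'rV[R]_n).
    have dij : dot (axis i : 'rV[R]_n) (axis j) = 0.
      by rewrite dot_axis // eq_sym (negbTE ji).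
    rewrite -(@ler_pXn2r _ 2) ?nnegrE ?enorm_ge0 // expr1n sqr_enorm !dotE.
    by rewrite dij dotC dij (axis_unit (axn i)) (axis_unit (axn j')); lra.
  rewrite /normalize dotZr normrM (ger0_norm d0) ger0_norm ?invr_ge0 ?enorm_ge0 //.
  by rewrite mulrC ler_pdivrMr ?(lt_le_trans ltr01) // ler_peMr.
have mC' : measurable (C : set (borel (hyp R n))) by exact: bigsetU_measurable.
have mB' : measurable (\big[setU/set0]_p B p : set (borel (hyp R n))).
  exact: bigsetU_measurable.
have mo := measurable_point o.
have : pr W <= pr C + (pr [set o] + \sum_p pr (B p)).
  apply: (@le_trans _ _ (pr (C `|` ([set o] `|` \big[setU/set0]_p B p)))).
    by apply: le_pr => //; apply: measurableU => //; exact: measurableU.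
  apply: le_trans (prU_le _ mC' (measurableU _ _ mo mB')) _; rewrite lerD2l.
  apply: le_trans (prU_le _ mo mB') _; rewrite lerD2l.
  exact: pr_bigcup_le.
have : \sum_p pr (B p) <= N%:R ^+ 2 * eps.
  apply: le_trans (ler_sum _ (fun p _ => prB p)) _.
  by rewrite sumr_const card_prod card_ord -[leLHS]mulr_natl natrM expr2.
have : pr C <= N%:R * pr (argmax_cell W N t 0).
  apply: le_trans (pr_bigcup_le _ _ mC) _.
  rewrite (eq_bigr (fun=> pr (argmax_cell W N t 0))).
    by rewrite sumr_const card_ord -[leLHS]mulr_natl.
  by move=> i _; exact: pr_argmax_cell.
lra.
Qed.

End argmax_cells.

(** * Hyperbolic distances *)

Section arcosh_bounds.
Context {R : realType}.

Lemma expR_arcosh_bounds (t : R) : 1 <= t ->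
  t <= expR (arcosh t) /\ expR (arcosh t) <= 2 * t.
Proof.
move=> t1; rewrite expR_arcosh //; split; first by rewrite lerDl sqrtr_ge0.
suff : Num.sqrt (t ^+ 2 - 1) <= t by lra.
have t2 : 0 <= t ^+ 2 - 1 by nra.
by rewrite -(@ler_pXn2r _ 2) ?nnegrE ?sqrtr_ge0 // ?sqr_sqrtr //; lra.
Qed.

Lemma expR_mdist_bounds n (x y : hyp R n) :
  - lform x y <= expR (mdist x y) /\ expR (mdist x y) <= 2 * - lform x y.
Proof.
by apply: expR_arcosh_bounds; apply: lform_hyp_ge1; exact: hyp_valP.
Qed.

(** Shifting the radius by [h] multiplies its hyperbolic sine by at most
   [expR h], up to an additive constant that only matters for small radii. *)
Lemma sinh_shift (r rho h : R) : 0 <= r -> 0 <= rho -> `|r - rho| <= h ->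
  expR (- h) * sinh rho - 1 <= sinh r /\ sinh r <= expR h * (sinh rho + 1).
Proof.
move=> r0 rho0; rewrite ler_norml => /andP[h1 h2].
have h0 : 0 <= h by lra.
have e1 : expR (- r) <= 1 by rewrite -expR0 ler_expR; lra.
have e2 : expR (- rho) <= 1 by rewrite -expR0 ler_expR; lra.
have e3 : expR (- h) * expR rho <= expR r by rewrite -expRD ler_expR; lra.
have e4 : expR r <= expR h * expR rho by rewrite -expRD ler_expR; lra.
have p1 := expR_gt0 (- rho); have p2 := expR_gt0 (- h); have p3 := expR_gt0 (- r).
have p4 : 1 <= expR h by rewrite -expR0 ler_expR.
rewrite /sinh; split; nra.
Qed.

Lemma sinh_ge0 (r : R) : 0 <= r -> 0 <= sinh r.
Proof. by move=> r0; rewrite /sinh divr_ge0 // subr_ge0 ler_expR; lra. Qed.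

Lemma sinh_gt0 (r : R) : 0 < r -> 0 < sinh r.
Proof. by move=> r0; rewrite /sinh divr_gt0 // subr_gt0 ltr_expR; lra. Qed.

End arcosh_bounds.

Section hyperbolic_distance.
Context {R : realType} {n : nat} (o : hyp R n).
Local Notation chart := (chart o).
Local Notation dir := (dir o).

Lemma expR_opp_mdist_o x :
  expR (- mdist o x) = cosh_of (chart x) - enorm (chart x).
Proof.
rewrite expRN expR_mdist_o.
have c1 := cosh_of_ge1 (chart x); have e0 := enorm_ge0 (chart x).
have E : cosh_of (chart x) ^+ 2 = 1 + enorm (chart x) ^+ 2.
  by rewrite sqr_cosh_of sqr_enorm.
have s0 : cosh_of (chart x) + enorm (chart x) != 0 by rewrite gt_eqF //; lra.
apply: (mulfI s0); rewrite mulfV //.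
by rewrite mulrC -subr_sqr E; ring.
Qed.

(** The hyperbolic law of cosines, with the angle expressed by the chord. *)
Lemma expR_mdist_le x y (h S : R) : off_center o x -> off_center o y ->
  `|mdist o x - mdist o y| <= h -> sinh (mdist o x) <= S ->
  sinh (mdist o y) <= S ->
  expR (mdist x y) <= 2 * expR h + (S * enorm (dir x - dir y)) ^+ 2.
Proof.
move=> xo yo; rewrite ler_norml => /andP[h1 h2] Sx Sy.
apply: le_trans (expR_mdist_bounds x y).2 _.
rewrite (chartE o) exprMn dist_unit ?dir_unit //.
set c := cosh_of (chart x); set c' := cosh_of (chart y).
have E : c * c' - enorm (chart x) * enorm (chart y) =
    (expR (mdist o x - mdist o y) + expR (mdist o y - mdist o x)) / 2.
  by rewrite !expRD !expR_opp_mdist_o !expR_mdist_o -/c -/c'; field.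
have e1 : expR (mdist o x - mdist o y) <= expR h by rewrite ler_expR.
have e2 : expR (mdist o y - mdist o x) <= expR h.
  by rewrite ler_expR; move: h1; clear; lra.
have -> : dot (chart x) (chart y) =
    enorm (chart x) * enorm (chart y) * dot (dir x) (dir y).
  by rewrite {1}chart_dir [in LHS](chart_dir o y) !sinh_mdist_o dotZl dotZr mulrA.
move: Sx Sy; rewrite !sinh_mdist_o => Sx Sy.
have w1 : dot (dir x) (dir y) <= 1.
  apply: le_trans (ler_norm _) _; apply: le_trans (cauchy_schwarz _ _) _.
  by rewrite !enorm_unit ?dir_unit // mulr1.
have px := enorm_ge0 (chart x); have py := enorm_ge0 (chart y).
have pS : enorm (chart x) * enorm (chart y) <= S ^+ 2 by rewrite expr2 ler_pM.
nra.
Qed.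

(** Two points at chart height at least [k] on opposite sides of a hyperplane
   through [o]: in the law of cosines the components along [v] contribute
   [k ^+ 2], and the others are absorbed by the Cauchy-Schwarz inequality. *)
Lemma expR_mdist_ge x y v (k : R) : dot v v = 1 -> 0 <= k ->
  k <= dot (chart x) v -> dot (chart y) v <= - k ->
  k ^+ 2 <= expR (mdist x y).
Proof.
move=> v1 k0; set a := dot (chart x) v; set b := dot (chart y) v => ka kb.
apply: le_trans (expR_mdist_bounds x y).1; rewrite (chartE o).
set p := chart x - a *: v; set q := chart y - b *: v.
have pq : dot (chart x) (chart y) = a * b + dot p q.
  by rewrite /p /q !dotE v1 (dotC v) -/a -/b; ring.
have pp : dot p p = dot (chart x) (chart x) - a ^+ 2.
  by rewrite /p !dotE v1 (dotC v) -/a; ring.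
have qq : dot q q = dot (chart y) (chart y) - b ^+ 2.
  by rewrite /q !dotE v1 (dotC v) -/b; ring.
have le_cosh r (z : 'rV[R]_n) c : dot r r = dot z z - c ^+ 2 -> enorm r <= cosh_of z.
  move=> rr; rewrite ler_sqrt ?addr_ge0 ?dot_ge0 // rr.
  by move: (dot z z) (sqr_ge0 c) => t; clear; lra.
have cs := le_trans (ler_norm _) (le_trans (cauchy_schwarz p q)
  (ler_pM (enorm_ge0 p) (enorm_ge0 q) (le_cosh _ _ _ _ pp) (le_cosh _ _ _ _ qq))).
have ab : a * b <= - k ^+ 2 by move: a b ka kb k0 {p q pq pp qq cs} => a b; nra.
by rewrite pq; move: cs ab; clear; lra.
Qed.

End hyperbolic_distance.

Section signed_distance.
Context {R : realType} {n : nat} (o : hyp R n) (v : 'rV[R]_n.+1)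
  (v0 : 0 < lform v v) (vo : hyperplane v o).
Local Notation chart := (chart o).

Definition hyperplane_dist (x : hyp R n) : R :=
  inf [set mdist x y | y in hyperplane v].

Let has_inf_dist x : has_inf [set mdist x y | y in hyperplane v].
Proof.
split; first by exists (mdist x o), o.
by exists 0 => _ [y _ <-]; exact: mdist_ge0.
Qed.

Lemma hyperplane_dist_le x y : hyperplane v y -> hyperplane_dist x <= mdist x y.
Proof. by move=> vy; apply: ge_inf; [exact: (has_inf_dist x).2|exists y]. Qed.

Lemma hyperplane_dist_ge x a : (forall y, hyperplane v y -> a <= mdist x y) ->
  a <= hyperplane_dist x.
Proof.
by move=> h; apply: lb_le_inf; [exact: (has_inf_dist x).1|move=> _ [y /h ay <-]].
Qed.

Lemma hyperplane_dist_ge0 x : 0 <= hyperplane_dist x.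
Proof. by apply: hyperplane_dist_ge => y _; exact: mdist_ge0. Qed.

Lemma norm_signed_dist x : `|signed_dist v x| = hyperplane_dist x.
Proof.
have := hyperplane_dist_ge0 x; rewrite /signed_dist -/(hyperplane_dist x) => d0 /=.
by case: ifP => _; [|rewrite normrN]; exact: ger0_norm.
Qed.

Lemma measurable_signed_dist :
  measurable_fun (setT : set (borel (hyp R n))) (signed_dist v).
Proof.
have md : measurable_fun (setT : set (borel (hyp R n))) hyperplane_dist.
  apply: measurable_fun_lip => x y.
  have half a b : hyperplane_dist a <= hyperplane_dist b + mdist a b.
    rewrite -lerBlDr; apply: hyperplane_dist_ge => z vz; rewrite lerBlDr addrC.
    apply: le_trans (hyperplane_dist_le a vz) _; exact: mdist_tri.
  rewrite ler_norml; have := half x y; have := half y x.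
  rewrite (mdist_sym y x); lra.
apply: measurable_fun_if => //.
- have ml : measurable_fun (setT : set (borel (hyp R n)))
      (fun x : hyp R n => lform x v).
    apply: measurable_fun_continuous_on; first exact: openT.
    by move=> x _ e e0; exact: near_lform.
  apply: measurable_fun_ler => //.
- exact: measurable_funTS.
- by apply: measurable_funTS; exact: measurableT_comp.
Qed.

(** In the chart the hyperplane is orthogonal to a unit vector [w]; its distance
   to [x] is the inverse hyperbolic sine of [`|dot (chart x) w|], here up to
   constants. *)
Lemma expR_hyperplane_dist : exists w, [/\ dot w w = 1,
  forall x, `|dot (chart x) w| <= expR (hyperplane_dist x) /\
    expR (hyperplane_dist x) <= 2 * (1 + `|dot (chart x) w|) &
  forall x, signed_dist v (hyp_refl o w x) = - signed_dist v x].
Proof.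
have ov : lform v o = 0 by rewrite lformC.
have [w [w1 wE]] := chart_normal v0 ov.
have sv0 : 0 < Num.sqrt (lform v v) by rewrite sqrtr_gt0.
have memH y : hyperplane v y <-> dot (chart y) w = 0.
  rewrite /hyperplane /= wE; split=> [/eqP|->]; last by rewrite mulr0.
  by rewrite mulf_eq0 gt_eqF //= => /eqP.
exists w; split => // x.
- set a := dot (chart x) w.
  have [p [xE pw]] : exists p, chart x = p + a *: w /\ dot p w = 0.
    exists (chart x - a *: w); rewrite subrK; split => //.
    by rewrite dotDl dotNl dotZl w1 -/a; ring.
  have cE : cosh_of (chart x) ^+ 2 = 1 + a ^+ 2 + dot p p.
    by rewrite sqr_cosh_of xE !dotE w1 (dotC w) pw; ring.
  have c1 := cosh_of_ge1 (chart x).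
  split.
    have [->|an0] := eqVneq a 0; first by rewrite normr0 expR_ge0.
    have a0 : 0 < `|a| by rewrite normr_gt0.
    rewrite -[leLHS]lnK ?posrE // ler_expR; apply: hyperplane_dist_ge => y /memH yw.
    rewrite -ler_expR lnK ?posrE //; apply: le_trans (expR_mdist_bounds x y).1.
    rewrite (chartE o) {2}xE dotDl dotZl [dot w _]dotC yw mulr0 addr0.
    have c'1 := cosh_of_ge1 (chart y).
    have := cauchy_schwarz p (chart y); have := ler_norm (dot p (chart y)).
    have pn := enorm_ge0 p; have yn := enorm_ge0 (chart y).
    suff : `|a| + enorm p * enorm (chart y) <= cosh_of (chart x) * cosh_of (chart y).
      lra.
    rewrite -(@ler_pXn2r _ 2) ?nnegrE ?addr_ge0 ?mulr_ge0 //; [|lra|lra].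
    rewrite exprMn cE sqr_cosh_of -!sqr_enorm -(real_normK (num_real a)).
    have := sqr_ge0 (`|a| * enorm (chart y) - enorm p).
    have := sqr_ge0 (enorm (chart y)); nra.
  set k := Num.sqrt (1 + a ^+ 2).
  have kE : k ^+ 2 = 1 + a ^+ 2 by rewrite sqr_sqrtr // addr_ge0 // sqr_ge0.
  have k1 : 1 <= k.
    rewrite -(@ler_pXn2r _ 2) ?nnegrE ?sqrtr_ge0 // kE expr1n.
    by have := sqr_ge0 a; lra.
  have ka : k <= 1 + `|a|.
    rewrite -(@ler_pXn2r _ 2) ?nnegrE ?sqrtr_ge0 ?addr_ge0 // kE.
    rewrite -(real_normK (num_real a)); have := normr_ge0 a; nra.
  (* the orthogonal projection of [x] to the hyperplane *)
  pose y := unchart o (k^-1 *: p).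
  have yE : chart y = k^-1 *: p by exact: unchartK.
  have Hy : hyperplane v y by apply/memH; rewrite yE dotZl pw mulr0.
  apply: le_trans (_ : expR (mdist x y) <= _).
    by rewrite ler_expR; exact: hyperplane_dist_le.
  apply: le_trans (expR_mdist_bounds x y).2 _; rewrite ler_pM2l // (chartE o).
  apply: le_trans ka; rewrite {2}xE yE dotZr dotDl dotZl [dot w p]dotC pw mulr0 addr0.
  have cy : cosh_of (k^-1 *: p) = cosh_of (chart x) / k.
    apply/eqP; rewrite -(@eqrXn2 _ 2) ?sqrtr_ge0 ?divr_ge0 //; [|lra|lra].
    rewrite expr_div_n cE kE sqr_cosh_of dotZl dotZr mulrA -expr2 exprVn kE.
    have h : 1 + a ^+ 2 != 0 by rewrite gt_eqF //; have := sqr_ge0 a; lra.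
    by apply/eqP; field.
  rewrite cy mulrA -expr2 cE mulrC -mulrBr addrK -kE expr2 mulrA mulVf ?mul1r //.
  by rewrite gt_eqF //; lra.
- have lE : lform (hyp_refl o w x) v = - lform x v.
    by rewrite !wE chart_hyp_refl dot_refll /refl w1 dotDr dotNr dotZr; ring.
  have dE : hyperplane_dist (hyp_refl o w x) = hyperplane_dist x.
    have fixH y : hyperplane v y -> hyp_refl o w y = y.
      by move=> /memH yw; rewrite /hyp_refl refl_orth // chartK.
    apply/eqP; rewrite eq_le; apply/andP; split; apply: hyperplane_dist_ge => y vy.
      by rewrite -(mdist_hyp_refl o x y w1) (fixH y vy); exact: hyperplane_dist_le.
    by rewrite -{1}(fixH y vy) mdist_hyp_refl //; exact: hyperplane_dist_le.
  rewrite /signed_dist -!/(hyperplane_dist _) lE dE oppr_ge0.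
  have [l0|l0|l0] := ltrgt0P (lform x v); [by []|by rewrite opprK|].
  have : hyperplane_dist x <= mdist x x by exact: hyperplane_dist_le.
  have := hyperplane_dist_ge0 x; rewrite mdistxx => d0 d1.
  have -> : hyperplane_dist x = 0 by apply/eqP; rewrite eq_le d1.
  by rewrite oppr0.
Qed.

End signed_distance.

(** * Radii and signed distances under the scaling *)

Section radius_asymptotics.
Context {R : realType} (s : nat -> {posnum R}) (rho : nat -> R) (a : \bar R).
Hypothesis s_cvg : (s n)%:num @[n --> \oo] --> (0 : R).
Hypothesis rho_gt0 : forall n, (2 <= n)%N -> 0 < rho n.
Hypothesis a_lty : (a < +oo)%E.
Hypothesis a_cvg : ((s n)%:num * ln (sinh (rho n) / Num.sqrt n%:R))%:E
      @[n --> \oo] --> a.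

Lemma near_small_scale (c e : R) : 0 < e -> \forall n \near \oo, (s n)%:num * c <= e.
Proof.
move=> e0; have c1 : 0 < `|c| + 1 by rewrite ltr_wpDl.
have : 0 < e / (`|c| + 1) by rewrite divr_gt0.
move/cvgrPdist_lt : s_cvg => h /h; apply: filterS => n.
rewrite sub0r normrN gtr0_norm // ltr_pdivlMr // => sc.
apply: ltW; apply: le_lt_trans sc; rewrite ler_pM2l //.
by have := ler_norm c; lra.
Qed.

Lemma pos_part_ge0 : 0 <= pos_part a.
Proof. by rewrite /pos_part fine_ge0 // le_max lexx orbT. Qed.

(** Adding [1] inside the logarithm is what turns [a] into its positive part. *)
Lemma near_log1p (e : R) : 0 < e -> \forall n \near \oo,
  `|(s n)%:num * ln (1 + sinh (rho n) / Num.sqrt n%:R) - pos_part a| <= e.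
Proof.
move=> e0; have e20 : 0 < e / 2 by rewrite divr_gt0.
have max_near : \forall n \near \oo, `|Num.max 0
    ((s n)%:num * ln (sinh (rho n) / Num.sqrt n%:R)) - pos_part a| <= e / 2.
  rewrite /pos_part; case: a a_lty a_cvg => [b| |] // _.
    move=> /fine_cvgP[_ /cvgrPdist_le/(_ _ e20)]; apply: filterS => n /=.
    rewrite -EFin_max /= ![Num.max _ 0]maxC /Num.max !ler_norml.
    by case: ltP => h; case: ltP => h'; lra.
  move=> /cvgeNyPle/(_ 0); apply: filterS => n; rewrite lee_fin => h.
  by rewrite maxNye /= max_l // subr0 normr0 ltW.
near=> n.
have n2 : (2 <= n)%N by near: n; exact: nbhs_infty_ge.
have t0 : 0 < sinh (rho n) / Num.sqrt n%:R.
  by rewrite divr_gt0 ?sinh_gt0 ?rho_gt0 // sqrtr_gt0 ltr0n ltnW.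
have : (s n)%:num * ln 2 <= e / 2 by near: n; exact: near_small_scale.
have : `|Num.max 0 ((s n)%:num * ln (sinh (rho n) / Num.sqrt n%:R)) -
    pos_part a| <= e / 2 by near: n.
move: (sinh (rho n) / _) t0 => t t0.
have sn : 0 < (s n)%:num by [].
have lb1 : 0 <= ln (1 + t) by rewrite ln_ge0 // lerDl ltW.
have lb2 : ln t <= ln (1 + t) by rewrite ler_ln ?posrE ?addr_gt0 // lerDr.
have ub : ln (1 + t) <= ln 2 + Num.max 0 (ln t).
  have [t1|t1] := leP t 1.
    apply: (@le_trans _ _ (ln 2)); first by rewrite ler_ln ?posrE ?addr_gt0 //; lra.
    by rewrite lerDl le_max lexx.
  apply: (@le_trans _ _ (ln 2 + ln t)); last by rewrite lerD2l le_max lexx orbT.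
  by rewrite -lnM ?posrE // ler_ln ?posrE ?mulr_gt0 ?addr_gt0 //; lra.
move: lb1 lb2 ub; rewrite /Num.max; case: ltP => h1 lb1 lb2 ub.
  have -> : 0 < (s n)%:num * ln t by rewrite mulr_gt0.
  rewrite !ler_norml; nra.
rewrite ltNge (_ : (s n)%:num * ln t <= 0) /=; last by rewrite pmulr_rle0.
rewrite !ler_norml; nra.
Unshelve. all: by end_near.
Qed.

Local Notation alpha := (pos_part a).

(** The radii of the annulus [`|s (r - rho)| <= eta] have hyperbolic sine
   [sqrt n * expR (alpha / s)], up to factors [expR (O(eta) / s)]; from below only
   for positive [alpha], since otherwise the radii may be much smaller. *)
Lemma near_annulus (eta : R) : 0 < eta -> \forall n \near \oo, forall r, 0 <= r ->
  `|(s n)%:num * (r - rho n)| <= eta ->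
  sinh r <= Num.sqrt n%:R * expR ((alpha + 2 * eta) / (s n)%:num) /\
  (3 * eta <= alpha ->
   Num.sqrt n%:R * expR ((alpha - 3 * eta) / (s n)%:num) <= sinh r).
Proof.
move=> eta0; near=> n => r r0 rr.
have n2 : (2 <= n)%N by near: n; exact: nbhs_infty_ge.
have sn : 0 < (s n)%:num by [].
have q1 : 1 <= Num.sqrt n%:R :> R.
  by rewrite -[leLHS]sqrtr1 ler_sqrt ?ltr0n ?ler1n ?(ltnW n2).
have q0 : 0 < Num.sqrt n%:R :> R by exact: lt_le_trans q1.
have t0 : 0 < sinh (rho n) / Num.sqrt n%:R.
  by rewrite divr_gt0 ?sinh_gt0 ?rho_gt0.
have lam : `|(s n)%:num * ln (1 + sinh (rho n) / Num.sqrt n%:R) - alpha| <= eta.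
  by near: n; exact: near_log1p.
have big : (s n)%:num * ln 3 <= eta by near: n; exact: near_small_scale.
have rr' : `|r - rho n| <= eta / (s n)%:num.
  by rewrite ler_pdivlMr // mulrC -{1}(gtr0_norm sn) -normrM.
have [lo hi] := sinh_shift r0 (ltW (rho_gt0 n2)) rr'.
have tE : sinh (rho n) = Num.sqrt n%:R * (sinh (rho n) / Num.sqrt n%:R).
  by rewrite mulrC divfK // gt_eqF.
move: (sinh (rho n) / _) t0 tE lam => t t0 tE; rewrite ler_norml => /andP[lam1 lam2].
have t1 : 0 < 1 + t by rewrite addr_gt0.
have E1 : 1 + t <= expR ((alpha + eta) / (s n)%:num).
  rewrite -[leLHS]lnK ?posrE // ler_expR ler_pdivlMr // mulrC; lra.
have E2 : expR ((alpha - eta) / (s n)%:num) <= 1 + t.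
  rewrite -[leRHS]lnK ?posrE // ler_expR ler_pdivrMr // mulrC; lra.
split.
  apply: le_trans hi _; rewrite tE.
  have -> : (alpha + 2 * eta) / (s n)%:num =
    eta / (s n)%:num + (alpha + eta) / (s n)%:num by rewrite -mulrDl; congr (_ / _); lra.
  rewrite expRD mulrCA ler_pM2l ?expR_gt0 //.
  apply: (@le_trans _ _ (Num.sqrt n%:R * (1 + t))); first by nra.
  by rewrite ler_pM2l.
move=> ea; apply: le_trans lo; rewrite tE.
set E := expR ((alpha - 3 * eta) / (s n)%:num).
have E3 : 1 <= E by rewrite -expR0 ler_expR divr_ge0 // subr_ge0.
have E4 : 3 * E <= expR ((alpha - 2 * eta) / (s n)%:num).
  have ln3 : ln 3 <= eta / (s n)%:num by rewrite ler_pdivlMr // mulrC.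
  have -> : (alpha - 2 * eta) / (s n)%:num =
    eta / (s n)%:num + (alpha - 3 * eta) / (s n)%:num.
    by rewrite -mulrDl; congr (_ / _); lra.
  by rewrite -[leLHS](@lnK _ (3 * E)) ?posrE ?mulr_gt0 ?expR_gt0 // ler_expR
    lnM ?posrE ?expR_gt0 // expRK lerD2r.
have E5 : expR ((alpha - 2 * eta) / (s n)%:num) <= expR (- (eta / (s n)%:num)) * (1 + t).
  have -> : (alpha - 2 * eta) / (s n)%:num =
    - (eta / (s n)%:num) + (alpha - eta) / (s n)%:num by field.
  by rewrite expRD ler_pM2l ?expR_gt0.
have E6 : expR (- (eta / (s n)%:num)) <= 1.
  by rewrite -expR0 ler_expR oppr_le0 divr_ge0 // ltW.
have E7 := expR_gt0 (- (eta / (s n)%:num)).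
have E8 : E + 1 <= expR (- (eta / (s n)%:num)) * t by nra.
move: E8; set X := _ * t => E8.
have -> : expR (- (eta / (s n)%:num)) * (Num.sqrt n%:R * t) = Num.sqrt n%:R * X.
  by rewrite /X; ring.
nra.
Unshelve. all: by end_near.
Qed.

Context (o : forall n, hyp R n) (mu : forall n, probability (borel (hyp R n)) R).
Hypothesis mu_radial : forall n, (2 <= n)%N -> radial (o n) (mu n).
Hypothesis radius_cvg : forall e : R, 0 < e ->
      mu n [set x | e < `|(s n)%:num * (mdist (o n) x - rho n)|]
        @[n --> \oo] --> 0%E.

Definition annulus (eta : R) n : set (hyp R n) :=
  [set x | `|(s n)%:num * (mdist (o n) x - rho n)| <= eta].

Arguments annulus eta n x : clear implicits.

Lemma measurable_annulus eta n :
  measurable (annulus eta n : set (borel (hyp R n))).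
Proof.
have mf : measurable_fun (setT : set (borel (hyp R n)))
    (fun x => (s n)%:num * (mdist (o n) x - rho n)).
  apply: measurable_funM => //; apply: measurable_funB => //.
  exact: measurable_mdist_o.
have := mf measurableT _ (measurable_itv `[- eta, eta]).
by rewrite setTI /preimage /annulus /=; under eq_set do rewrite in_itv /= -ler_norml.
Qed.

Lemma near_pr_annulus (eta e : R) : 0 < eta -> 0 < e ->
  \forall n \near \oo, 1 - e <= pr (mu n) (annulus eta n).
Proof.
move=> eta0 e0; have /fine_cvgP[_ /cvgrPdist_le/(_ _ e0)] := radius_cvg eta0.
apply: filterS => n /=; rewrite sub0r normrN -/(pr _ _).
have -> : [set x | eta < `|(s n)%:num * (mdist (o n) x - rho n)|] =
    ~` annulus eta n.
  apply/seteqP; split => x; rewrite /annulus /= ltNge.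
    by move=> /negP.
  by move=> ?; apply/negP.
rewrite prC; last exact: measurable_annulus.
by rewrite ler_norml; lra.
Qed.

(** The distance to a hyperplane through the origin is, up to constants, the
   positive part of the logarithm of [sinh r] times a coordinate of the
   direction. With large probability that coordinate has order [1 / sqrt n], so
   that only [alpha / s] survives. *)
Lemma near_signed_dist (e delta : R) : 0 < e -> 0 < delta ->
  \forall n \near \oo, forall v : 'rV[R]_n.+1, 0 < lform v v ->
  hyperplane v (o n) ->
  pr (mu n) [set x | e < `| `|(s n)%:num * signed_dist v x| - alpha|] <= delta.
Proof.
move=> e0 d0; have d30 : 0 < delta / 3 by rewrite divr_gt0.
have al0 := pos_part_ge0.
pose eta := if alpha == 0 then e / 5 else Num.min (e / 5) (alpha / 4).
have eta0 : 0 < eta.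
  rewrite /eta; case: ifPn => [_|an]; first by rewrite divr_gt0.
  by rewrite lt_min !divr_gt0 // lt_def an.
have eta_e : eta <= e / 5 by rewrite /eta; case: ifP => // _; rewrite ge_min lexx.
have eta_a : alpha != 0 -> 3 * eta <= alpha.
  move=> an; rewrite /eta (negbTE an).
  have : Num.min (e / 5) (alpha / 4) <= alpha / 4 by rewrite ge_min lexx orbT.
  by lra.
have [c c0 [n0 small]] := small_coordinate d30.
(* a coordinate exceeds [C / sqrt n] with probability at most [delta / 3] *)
pose C := Num.sqrt (3 / delta).
have C0 : 0 < C by rewrite sqrtr_gt0 divr_gt0.
near=> n => v v0 vo.
have n2 : (2 <= n)%N by near: n; exact: nbhs_infty_ge.
have nn0 : (n0 <= n)%N by near: n; exact: nbhs_infty_ge.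
have sn : 0 < (s n)%:num by [].
have q0 : 0 < Num.sqrt n%:R :> R by rewrite sqrtr_gt0 ltr0n ltnW.
have ann : 1 - delta / 3 <= pr (mu n) (annulus eta n).
  by near: n; exact: near_pr_annulus.
have win : forall r, 0 <= r -> `|(s n)%:num * (r - rho n)| <= eta ->
  sinh r <= Num.sqrt n%:R * expR ((alpha + 2 * eta) / (s n)%:num) /\
  (3 * eta <= alpha ->
   Num.sqrt n%:R * expR ((alpha - 3 * eta) / (s n)%:num) <= sinh r).
  by near: n; exact: near_annulus.
have cst1 : (s n)%:num * ln (2 * (1 + C)) <= eta by near: n; exact: near_small_scale.
have cst2 : (s n)%:num * - ln c <= eta by near: n; exact: near_small_scale.
have mu_rad := mu_radial n2.
have [w [w1 wb _]] := expR_hyperplane_dist v0 vo.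
have mA : measurable (annulus eta n : set (borel (hyp R n))).
  exact: measurable_annulus.
pose B1 : set (hyp R n) :=
  [set x | off_center (o n) x /\ `|dot (dir (o n) x) w| <= c / Num.sqrt n%:R].
have mB1 : measurable (B1 : set (borel (hyp R n))) by exact: measurable_small.
pose B2 : set (hyp R n) := ~` [set x | `|dot (dir (o n) x) w| <= C / Num.sqrt n%:R].
have mB2 : measurable (B2 : set (borel (hyp R n))).
  by apply: measurableC; exact: measurable_dot_le.
have pB1 : pr (mu n) B1 <= delta / 3 by exact: small.
have pB2 : pr (mu n) B2 <= delta / 3.
  have -> : B2 = [set x | C / Num.sqrt n%:R < `|dot (dir (o n) x) w|].
    apply/seteqP; split => x /=; first by move=> /negP; rewrite -ltNge.
    by move=> h; apply/negP; rewrite -ltNge.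
  apply: le_trans (large_coordinate mu_rad _ w1 _) _; [exact: ltnW|exact: divr_gt0|].
  have CE : C ^+ 2 = 3 / delta by rewrite sqr_sqrtr // divr_ge0 // ltW.
  rewrite expr_div_n CE sqr_sqrtr // divfK ?invf_div //.
  by rewrite gt_eqF // ltr0n ltnW.
apply: (@le_trans _ _ (pr (mu n) (~` annulus eta n `|` (B1 `|` B2)))); last first.
  apply: le_trans (prU_le _ (measurableC mA) (measurableU _ _ mB1 mB2)) _.
  by move: (ann) pB1 pB2 (prU_le (mu n) mB1 mB2); rewrite (prC _ mA); drop_comparisons; lra.
apply: le_pr.
- apply: measurable_deviation; apply: measurable_funM => //.
  exact: measurable_signed_dist vo.
- by do 2?apply: measurableU => //; exact: measurableC.
move=> x /= bad; apply: contrapT => /not_orP[/contrapT xA /not_orP[nB1 /contrapT xC]].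
move: bad; rewrite ltNge => /negP; apply.
have [xhi xlo] := win _ (mdist_ge0 _ _) xA.
have [dlo dhi] := wb x.
have chartw : dot (chart (o n) x) w = sinh (mdist (o n) x) * dot (dir (o n) x) w.
  by rewrite chart_dir dotZl.
have sh0 := sinh_ge0 (mdist_ge0 (o n) x).
rewrite normrM gtr0_norm // (norm_signed_dist vo).
set d := hyperplane_dist v x in dlo dhi *.
have hi : (s n)%:num * d <= alpha + 3 * eta.
  have E0 : 1 <= expR ((alpha + 2 * eta) / (s n)%:num).
    by rewrite -expR0 ler_expR divr_ge0 // addr_ge0 // mulr_ge0 // ltW.
  have pC : `|dot (chart (o n) x) w| <= C * expR ((alpha + 2 * eta) / (s n)%:num).
    rewrite chartw normrM ger0_norm //.
    have -> : C * expR ((alpha + 2 * eta) / (s n)%:num) =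
      Num.sqrt n%:R * expR ((alpha + 2 * eta) / (s n)%:num) * (C / Num.sqrt n%:R).
      by field; rewrite gt_eqF.
    by apply: ler_pM.
  have : expR d <= 2 * (1 + C) * expR ((alpha + 2 * eta) / (s n)%:num).
    apply: le_trans dhi _; rewrite -mulrA ler_pM2l // mulrDl mul1r; exact: lerD.
  have C1 : 0 < 2 * (1 + C) by rewrite mulr_gt0 // addr_gt0.
  rewrite -[2 * (1 + C)]lnK ?posrE // -expRD ler_expR => dle.
  have := ler_wpM2l (ltW sn) dle.
  by rewrite mulrDr [_ * (_ / _)]mulrC divfK ?gt_eqF //; move: (cst1); drop_comparisons; lra.
have lo : alpha - 4 * eta <= (s n)%:num * d.
  have [a0|an] := eqVneq alpha 0.
    have : 0 <= (s n)%:num * d by rewrite mulr_ge0 //; exact: hyperplane_dist_ge0 vo x.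
    by rewrite a0; move: (eta0); drop_comparisons; lra.
  have {}xlo := xlo (eta_a an).
  have xo : off_center (o n) x.
    move=> xo; move: xlo; rewrite xo mdistxx /sinh oppr0 subrr mul0r leNgt.
    by rewrite mulr_gt0 // expR_gt0.
  have wc : c / Num.sqrt n%:R <= `|dot (dir (o n) x) w|.
    by apply: ltW; rewrite ltNge; apply/negP => h; exact: nB1.
  have pc : c * expR ((alpha - 3 * eta) / (s n)%:num) <= expR d.
    apply: le_trans dlo; rewrite chartw normrM ger0_norm //.
    have -> : c * expR ((alpha - 3 * eta) / (s n)%:num) =
      Num.sqrt n%:R * expR ((alpha - 3 * eta) / (s n)%:num) * (c / Num.sqrt n%:R).
      by field; rewrite gt_eqF.
    apply: ler_pM => //.
    by rewrite divr_ge0 ?sqrtr_ge0 // ltW.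
  move: pc; rewrite -[c]lnK ?posrE // -expRD ler_expR => dge.
  have := ler_wpM2l (ltW sn) dge.
  by rewrite mulrDr [_ * (_ / _)]mulrC divfK ?gt_eqF //; move: (cst2); drop_comparisons; lra.
by rewrite ler_norml; move: hi lo (eta_e) (eta0); drop_comparisons; lra.
Unshelve. all: by end_near.
Qed.

End radius_asymptotics.
Arguments annulus {R} s rho o eta n x.

(** * The limit law of the signed distance *)

Section two_point_limit.
Context {R : realType}.

Lemma integral_half_dirac (a b : R) (f : R -> R) : continuous f ->
  (\int[half_dirac a b]_x (f x)%:E = ((f a + f b) / 2)%:E)%E.
Proof.
move=> cf; have mf : measurable_fun setT f by exact: continuous_measurable_fun.
have ge0 (g : R -> R) : measurable_fun setT g -> (forall x, 0 <= g x) ->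
    (\int[half_dirac a b]_x (g x)%:E = ((g a + g b) / 2)%:E)%E.
  move=> mg g0; have mg' : measurable_fun setT (EFin \o g) by exact/measurable_EFinP.
  rewrite /half_dirac ge0_integral_measure_add //; last by move=> x _; rewrite lee_fin.
  rewrite !ge0_integral_mscale //; do ?by move=> x _; rewrite lee_fin.
  rewrite !integral_dirac // !diracT !mul1e /= -!EFinM -EFinD; congr EFin.
  by field.
rewrite integralE.
have -> : (fun x => (f x)%:E)^\+%E = (fun x => (Num.max (f x) 0)%:E).
  by apply/funext => x; rewrite funeposE EFin_max.
have -> : (fun x => (f x)%:E)^\-%E = (fun x => (Num.max (- f x) 0)%:E).
  by apply/funext => x; rewrite funenegE EFin_max.
have mN : measurable_fun setT (fun x => - f x) by exact: measurableT_comp.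
rewrite (ge0 (fun x => Num.max (f x) 0)); first last.
- by move=> x; rewrite le_max lexx orbT.
- by apply: measurable_maxr.
rewrite (ge0 (fun x => Num.max (- f x) 0)); first last.
- by move=> x; rewrite le_max lexx orbT.
- by apply: measurable_maxr.
rewrite -EFinB; congr EFin; rewrite /Num.max !oppr_lt0.
by case: ltrgt0P => ha; case: ltrgt0P => hb; lra.
Qed.

Lemma Rintegral_bad_set d (T : measurableType d) (mu : probability T R)
    (f : T -> R) (B : set T) (e M : R) : measurable B ->
  measurable_fun setT f -> 0 <= e -> (forall x, `|f x| <= M) ->
  (forall x, ~ B x -> `|f x| <= e) ->
  `|\int[mu]_x f x| <= e + M * pr mu B.
Proof.
move=> mB mf e0 fM fe; have M0 : 0 <= M by exact: le_trans (fM point).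
have fi : mu.-integrable setT (EFin \o f).
  by apply: (@bounded_integrable _ _ _ _ _ _ M).
have ni : mu.-integrable setT (EFin \o fun x => `|f x|).
  apply: (@bounded_integrable _ _ _ _ _ _ M) => //.
    exact: measurableT_comp.
  by move=> x _; rewrite normr_id.
have ei : mu.-integrable setT (EFin \o fun=> e).
  by apply: (@bounded_integrable _ _ _ _ _ _ `|e|).
have Bi : mu.-integrable setT (EFin \o (\1_B : T -> R)) by exact: integrable_indic.
have MBi : mu.-integrable setT (EFin \o fun x => M * \1_B x).
  apply: (@bounded_integrable _ _ _ _ _ _ M) => //.
    exact: measurable_funM.
  move=> x _; rewrite normrM (ger0_norm M0) indicE ger0_norm //.
  by case: (x \in B); rewrite ?mulr1 ?mulr0.
apply: le_trans (le_normr_Rintegral measurableT fi) _.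
apply: (@le_trans _ _ (\int[mu]_x (e + M * \1_B x))).
  apply: le_Rintegral => //.
    have := integrableD measurableT ei MBi.
    by apply: eq_integrable => // x _; rewrite /= EFinD.
  move=> x _; rewrite indicE; have [/set_mem Bx|nB] := boolP (x \in B).
    by rewrite mulr1 ler_wpDl.
  rewrite mulr0 addr0; apply: fe => Bx; move: nB; rewrite mem_set //.
rewrite RintegralD // RintegralZl // Rintegral_cst // -/(pr mu setT) prT mulr1.
by rewrite /Rintegral integral_indic // setIT.
Qed.

End two_point_limit.

Section symmetric_limit.
Context {R : realType} (o : forall n, hyp R n)
  (mu : forall n, probability (borel (hyp R n)) R) (s : nat -> {posnum R}).
Hypothesis mu_radial : forall n, (2 <= n)%N -> radial (o n) (mu n).

(** The law of a signed distance is symmetric, by reflection in the hyperplane;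
   the convergence of absolute values therefore determines the limit law. *)
Lemma cvg_signed_dist (alpha : R) (v : forall n, 'rV[R]_n.+1) :
  (forall n, (2 <= n)%N -> 0 < lform (v n) (v n) /\ hyperplane (v n) (o n)) ->
  (forall e delta, 0 < e -> 0 < delta -> \forall n \near \oo,
    pr (mu n) [set x | e < `| `|(s n)%:num * signed_dist (v n) x| - alpha|] <= delta) ->
  cvg_in_distribution
    (fun n => pushforward (mu n) (fun x => (s n)%:num * signed_dist (v n) x))
    (half_dirac (- alpha) alpha).
Proof.
move=> hv conc f cf [M fM].
have mf : measurable_fun setT f by exact: continuous_measurable_fun.
rewrite integral_half_dirac //.
pose g n x := (s n)%:num * signed_dist (v n) x.
have mg n : (2 <= n)%N ->
    measurable_fun (setT : set (borel (hyp R n))) (g n : hyp R n -> R).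
  move=> /hv[v0 vo]; apply: measurable_funM => //; exact: measurable_signed_dist vo.
have mfg n : (2 <= n)%N ->
    measurable_fun (setT : set (borel (hyp R n))) (f \o g n).
  by move=> n2; exact: measurableT_comp mf (mg n n2).
have mfNg n : (2 <= n)%N ->
    measurable_fun (setT : set (borel (hyp R n))) (fun x => f (- g n x)).
  move=> n2; apply: (measurableT_comp mf); exact: measurableT_comp (mg n n2).
have integ n : (2 <= n)%N ->
    (mu n).-integrable (setT : set (borel (hyp R n))) (EFin \o (f \o g n)).
  by move=> n2; apply: (bounded_integrable _ measurableT (mfg n n2)) => x _; exact: fM.
have integN n : (2 <= n)%N ->
    (mu n).-integrable (setT : set (borel (hyp R n))) (EFin \o (fun x => f (- g n x))).
  by move=> n2; apply: (bounded_integrable _ measurableT (mfNg n n2)) => x _; exact: fM.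
have push n : (2 <= n)%N -> (\int[pushforward (mu n) (g n)]_x (f x)%:E =
    (\int[mu n]_x f (g n x))%:E)%E.
  move=> n2; rewrite (integral_pushforward (mg n n2)) //.
  - by rewrite preimage_setT /Rintegral fineK //; exact: integrable_fin_num (integ n n2).
  - exact/measurable_EFinP.
  - exact: integ.
have sym n : (2 <= n)%N -> \int[mu n]_x f (g n x) = \int[mu n]_x f (- g n x).
  move=> n2; have [v0 vo] := hv n n2.
  have [w [w1 _ wN]] := expR_hyperplane_dist v0 vo.
  rewrite /Rintegral; congr fine.
  apply: etrans (esym (integral_hyp_refl (mu_radial n2) w1 (mfg n n2)
    (fun x => fM (g n x)))) _.
  by apply: eq_integral => x _; rewrite /= /g wN mulrN.
apply/fine_cvgP; split.
  near=> n; rewrite push //; near: n; exact: nbhs_infty_ge.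
apply/cvgrPdist_le => e e0.
have e20 : 0 < e / 2 by rewrite divr_gt0.
have /cvgrPdist_le/(_ _ e20)/nbhs_ballP[d1 d10 f1] := cf alpha.
have /cvgrPdist_le/(_ _ e20)/nbhs_ballP[d2 d20 f2] := cf (- alpha).
pose d := Num.min d1 d2 / 2.
have d0 : 0 < d by rewrite divr_gt0 // lt_min d10.
have M0 : 0 <= M by exact: le_trans (fM 0).
have dl0 : 0 < e / (4 * M + 1) by rewrite divr_gt0 //; lra.
near=> n.
have n2 : (2 <= n)%N by near: n; exact: nbhs_infty_ge.
have bad : pr (mu n) [set x | d < `| `|g n x| - alpha|] <= e / (4 * M + 1).
  by near: n; exact: conc.
have mbad : measurable ([set x | d < `| `|g n x| - alpha|] : set (borel (hyp R n))).
  by apply: measurable_deviation; exact: mg.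
rewrite /= push //= distrC.
pose F x := f (g n x) + f (- g n x) - (f (- alpha) + f alpha).
have mF : measurable_fun (setT : set (borel (hyp R n))) (F : hyp R n -> R).
  apply: measurable_funB => //; apply: measurable_funD; [exact: mfg|exact: mfNg].
have FM x : `|F x| <= 4 * M.
  rewrite /F; apply: le_trans (ler_normB _ _) _.
  have := ler_normD (f (g n x)) (f (- g n x)); have := ler_normD (f (- alpha)) (f alpha).
  have := fM (g n x); have := fM (- g n x); have := fM alpha; have := fM (- alpha).
  by drop_comparisons; lra.
have Fe x : ~ (d < `| `|g n x| - alpha|) -> `|F x| <= e.
  move=> /negP; rewrite -leNgt => gd.
  have [dd1 dd2] : d < d1 /\ d < d2.
    have m1 : Num.min d1 d2 <= d1 by rewrite ge_min lexx.
    have m2 : Num.min d1 d2 <= d2 by rewrite ge_min lexx orbT.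
    have : 0 < Num.min d1 d2 by rewrite lt_min d10.
    by move: m1 m2; rewrite /d; drop_comparisons; split; lra.
  have near1 t : `|t - alpha| <= d -> `|f alpha - f t| <= e / 2.
    by move=> td; apply: f1; rewrite /ball /= distrC; exact: le_lt_trans td dd1.
  have near2 t : `|t + alpha| <= d -> `|f (- alpha) - f t| <= e / 2.
    move=> td; apply: f2; rewrite /ball /= distrC opprK; exact: le_lt_trans td dd2.
  rewrite /F; have [g0|g0] := leP 0 (g n x).
    rewrite (ger0_norm g0) in gd.
    have h1 := near1 _ gd.
    have h2 : `|f (- alpha) - f (- g n x)| <= e / 2.
      by apply: near2; rewrite -normrN opprD opprK.
    by move: h1 h2; rewrite !ler_norml; drop_comparisons; lra.
  rewrite (ltr0_norm g0) in gd.
  have h1 := near1 _ gd.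
  have h2 : `|f (- alpha) - f (g n x)| <= e / 2.
    by apply: near2; rewrite -normrN opprD.
  by move: h1 h2; rewrite !ler_norml; drop_comparisons; lra.
have := Rintegral_bad_set (mu n) mbad mF (ltW e0) FM Fe.
have -> : \int[mu n]_x F x = 2 * (\int[mu n]_x f (g n x)) - (f (- alpha) + f alpha).
  rewrite /F RintegralB //.
  - rewrite RintegralD //; [|exact: integ|exact: integN].
    rewrite -sym // Rintegral_cst // -/(pr (mu n) setT) prT; ring.
  - have := integrableD measurableT (integ n n2) (integN n n2).
    by apply: eq_integrable => // x _; rewrite /= EFinD.
  - by apply: (@bounded_integrable _ _ _ _ _ _ `|f (- alpha) + f alpha|).
have h : 4 * M * pr (mu n) [set x | d < `| `|g n x| - alpha|] <= e.
  apply: (@le_trans _ _ ((4 * M + 1) * (e / (4 * M + 1)))).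
    apply: ler_pM => //; [|exact: pr_ge0|by drop_comparisons; lra].
    by move: (M0); drop_comparisons; lra.
  by rewrite mulrC divfK // gt_eqF //; move: (M0); drop_comparisons; lra.
by move: (h); rewrite !ler_norml; drop_comparisons; lra.
Unshelve. all: by end_near.
Qed.

End symmetric_limit.

(** * Upper bound: the diameter of limits *)

Section box_distance_facts.
Context {R : realType}.

Lemma box_lt_witness (X Y : mmSpace R) (r : R) : (box X Y < r%:E)%E ->
  exists (pi : probability (borel (X * Y)%type) R) (S : set (X * Y)),
    [/\ is_coupling pi, closed S, 1 - r < pr pi S &
     forall p q, S p -> S q -> `|mdist p.1 q.1 - mdist p.2 q.2| < r].
Proof.
move=> /ereal_inf_lt[_ [pi [S [cpi cS ->]]]]; rewrite gt_max => /andP[h1 h2].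
exists pi, S; split => //.
  have mS := measurable_closed_prod cS.
  move: h1; rewrite -prE // -EFinB lte_fin; lra.
move=> p q Sp Sq; rewrite -lte_fin; apply: le_lt_trans h2.
by apply: ereal_sup_ubound; exists p => //; exists q.
Qed.

Lemma open_fst_preimage (X Y : csMetricType R) (A : set X) : open A ->
  open ((fst : X * Y -> X) @^-1` A).
Proof. by move=> oA; apply: open_comp => // p _; exact: cvg_fst. Qed.

Lemma open_snd_preimage (X Y : csMetricType R) (A : set Y) : open A ->
  open ((snd : X * Y -> Y) @^-1` A).
Proof. by move=> oA; apply: open_comp => // p _; exact: cvg_snd. Qed.

(** The projection of the good set of a coupling need not be measurable; its open
   neighbourhoods are. *)
Lemma box_separation (X Y : mmSpace R) (y y' : Y) (e delta : R) : 0 < e ->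
  (box X Y < (Num.min e delta)%:E)%E ->
  2 * delta <= pr (mm_measure Y) [set z | mdist y z < e] ->
  2 * delta <= pr (mm_measure Y) [set z | mdist y' z < e] ->
  exists A B : set X, [/\ open A, open B, delta <= pr (mm_measure X) A,
    delta <= pr (mm_measure X) B &
    forall x x', A x -> B x' -> mdist y y' - 5 * e <= mdist x x'].
Proof.
move=> e0 /box_lt_witness[pi [S [[p1 p2] cS piS disS]]] dy dy'.
have m1 : Num.min e delta <= e by rewrite ge_min lexx.
have m2 : Num.min e delta <= delta by rewrite ge_min lexx orbT.
pose fat (z : Y) : set X := [set x | exists x1 y1,
  [/\ S (x1, y1), mdist z y1 < e & mdist x1 x < e]].
have ofat z : open (fat z).
  apply: open_mdist => x [x1 [y1 [Sx zy xx]]]; exists (e - mdist x1 x).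
    by rewrite subr_gt0.
  move=> x2 xx2; exists x1, y1; split => //.
  by apply: le_lt_trans (mdist_tri x x1 x2) _; lra.
have mS := measurable_closed_prod cS.
have big z : 2 * delta <= pr (mm_measure Y) [set t | mdist z t < e] ->
    delta <= pr (mm_measure X) (fat z).
  move=> dz; have oU := open_mdist_ball z e.
  have mU : measurable ((snd : X * Y -> Y) @^-1` [set t | mdist z t < e]
      : set (borel (X * Y)%type)).
    by apply: sub_sigma_algebra; exact: open_snd_preimage.
  have mF : measurable ((fst : X * Y -> X) @^-1` fat z : set (borel (X * Y)%type)).
    by apply: sub_sigma_algebra; exact: open_fst_preimage.
  have -> : pr (mm_measure X) (fat z) = pr pi (fst @^-1` fat z).
    by rewrite /pr p1 //; exact: measurable_open.
  apply: (@le_trans _ _ (pr pi (S `&` (snd @^-1` [set t | mdist z t < e])))).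
    have := prI_ge pi mS mU.
    have -> : pr pi (snd @^-1` [set t | mdist z t < e]) =
        pr (mm_measure Y) [set t | mdist z t < e].
      by rewrite /pr p2 //; exact: measurable_open.
    by lra.
  apply: le_pr => //; first exact: measurableI.
  by move=> [x1 y1] [Sx /= zy]; exists x1, y1; rewrite mdistxx.
exists (fat y), (fat y'); split; [exact: ofat|exact: ofat|exact: big|exact: big|].
move=> x x' [x1 [y1 [S1 yy1 xx1]]] [x2 [y2 [S2 yy2 xx2]]].
have := disS _ _ S1 S2; rewrite ltr_norml /= => /andP[d1 d2].
have t1 := mdist_tri y1 y y'; have t2 := mdist_tri y2 y1 y'.
have t3 := mdist_tri x x1 x2; have t4 := mdist_tri x' x x2.
rewrite (mdist_sym y2 y') in t2; rewrite (mdist_sym x' x2) in t4.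
lra.
Qed.

Lemma measurable_supp_image (T : csMetricType R) (mu : probability (borel T) R)
    (U : set (supp_space mu)) : open U ->
  measurable (@supp_val R T mu @` U : set (borel T)).
Proof.
move=> [V oV <-].
rewrite (_ : _ @` _ = V `&` Defs.support mu).
  by apply: measurableI; [exact: measurable_open|exact: measurable_support].
apply/seteqP; split => [_ [x Vx <-]|x [Vx Sx]].
  by split; [exact: Vx|exact: supp_valP].
by exists (SigSub (mem_set Sx)).
Qed.

End box_distance_facts.

Section pyramid_upper_bound.
Context {R : realType} (s : nat -> {posnum R}) (rho : nat -> R) (a : \bar R).
Hypothesis s_cvg : (s n)%:num @[n --> \oo] --> (0 : R).
Hypothesis rho_gt0 : forall n, (2 <= n)%N -> 0 < rho n.
Hypothesis a_lty : (a < +oo)%E.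
Hypothesis a_cvg : ((s n)%:num * ln (sinh (rho n) / Num.sqrt n%:R))%:E
      @[n --> \oo] --> a.
Context (o : forall n, hyp R n) (mu : forall n, probability (borel (hyp R n)) R).
Hypothesis mu_radial : forall n, (2 <= n)%N -> radial (o n) (mu n).
Hypothesis radius_cvg : forall e : R, 0 < e ->
      mu n [set x | e < `|(s n)%:num * (mdist (o n) x - rho n)|]
        @[n --> \oo] --> 0%E.
Local Notation alpha := (pos_part a).

(** Two sets of substantial mass contain points with close directions and nearly
   equal radii, hence at scaled distance at most about [2 * alpha]. An atom of
   substantial mass at the center forces all radii to be small instead. *)
Lemma near_separation (e delta : R) : 0 < e -> 0 < delta ->
  \forall n \near \oo, forall A B : set (borel (hyp R n)), measurable A ->
  measurable B -> delta <= pr (mu n) A -> delta <= pr (mu n) B ->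
  exists x y, [/\ A x, B y & (s n)%:num * mdist x y <= 2 * alpha + e].
Proof.
move=> e0 d0; have al0 : 0 <= alpha := pos_part_ge0 a.
pose eta := e / 5; have eta0 : 0 < eta by rewrite divr_gt0.
have etaE : e = 5 * eta by rewrite /eta mulrC divfK.
have d40 : 0 < delta / 4 by rewrite divr_gt0.
have d80 : 0 < delta / 8 by rewrite divr_gt0.
(* sets of mass [delta / 2] have directions at distance less than [C / sqrt n],
   since [104 / (delta / 2) = 208 / delta] *)
pose K : R := 209; have K0 : 0 < K by rewrite ltr0n.
pose C := Num.sqrt (K / delta).
have C0 : 0 < C by rewrite sqrtr_gt0 divr_gt0.
have CE : C ^+ 2 = K / delta by rewrite sqr_sqrtr // divr_ge0 // ltW.
near=> n => A B mA mB dA dB.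
have n2 : (2 <= n)%N by near: n; exact: nbhs_infty_ge.
have nn : 0 < n%:R :> R by rewrite ltr0n ltnW.
have sn : 0 < (s n)%:num by [].
have q0 : 0 < Num.sqrt n%:R :> R by rewrite sqrtr_gt0.
have ann : 1 - delta / 8 <= pr (mu n) (annulus s rho o eta n).
  by near: n; exact: near_pr_annulus.
have win : forall r, 0 <= r -> `|(s n)%:num * (r - rho n)| <= eta ->
  sinh r <= Num.sqrt n%:R * expR ((alpha + 2 * eta) / (s n)%:num) /\
  (3 * eta <= alpha ->
   Num.sqrt n%:R * expR ((alpha - 3 * eta) / (s n)%:num) <= sinh r).
  by near: n; exact: near_annulus.
have cst : (s n)%:num * ln (2 + C ^+ 2) <= eta by near: n; exact: near_small_scale.
have mW : measurable (annulus s rho o eta n : set (borel (hyp R n))).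
  exact: measurable_annulus.
have nz (F : set (borel (hyp R n))) : measurable F -> 0 < pr (mu n) F -> F !=set0.
  by move=> mF F0; apply/set0P/eqP => E; move: F0; rewrite E pr0 ltxx.
have mo : measurable ([set o n] : set (borel (hyp R n))) by exact: measurable_point.
have inW (F : set (borel (hyp R n))) : measurable F -> delta <= pr (mu n) F ->
    delta - delta / 8 <= pr (mu n) (F `&` annulus s rho o eta n).
  by move=> mF dF; move: dF (ann) (prI_ge (mu n) mF mW); drop_comparisons; lra.
have [big|small] := ltP (delta / 4) (pr (mu n) [set o n]).
  have [|x [Ax Wx]] := nz _ (measurableI _ _ mA mW).
    by apply: lt_le_trans (inW A mA dA); move: (d0); drop_comparisons; lra.
  have [|y [By Wy]] := nz _ (measurableI _ _ mB mW).
    by apply: lt_le_trans (inW B mB dB); move: (d0); drop_comparisons; lra.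
  have [|z [-> Wo]] := nz _ (measurableI _ _ mo mW).
    by move: big (ann) (d0) (prI_ge (mu n) mo mW); drop_comparisons; lra.
  exists x, y; split => //.
  have rad z' : annulus s rho o eta n z' -> (s n)%:num * mdist (o n) z' <= 2 * eta.
    move: Wo; rewrite /annulus /= mdistxx !ler_norml => /andP[h1 h2] /andP[h3 h4].
    by move: h1 h2 h3 h4; drop_comparisons; lra.
  have := mdist_tri (o n) x y; rewrite (mdist_sym x (o n)).
  have := rad x Wx; have := rad y Wy; move=> h1 h2 /(ler_wpM2l (ltW sn)).
  by rewrite mulrDr; move: h1 h2 (etaE) (al0) (eta0); drop_comparisons; lra.
have mD := measurable_off_center (o n).
have inWD (F : set (borel (hyp R n))) : measurable F -> delta <= pr (mu n) F ->
    delta / 2 <= pr (mu n) (F `&` annulus s rho o eta n `&` off_center (o n)).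
  move=> mF dF; have mFW := measurableI _ _ mF mW.
  have := prI_ge (mu n) mFW mD; have := inW F mF dF.
  by rewrite /off_center prC //; move: small (d0); drop_comparisons; lra.
have r2 : 104 / (delta / 2 * n%:R) < (C / Num.sqrt n%:R) ^+ 2.
  rewrite expr_div_n CE sqr_sqrtr ?(ltW nn) //.
  have -> : 104 / (delta / 2 * n%:R) = 208 / delta / n%:R :> R.
    by field; rewrite !gt_eqF.
  by rewrite !ltr_pM2r ?invr_gt0 // ltr_nat.
have d20 : 0 < delta / 2 by rewrite divr_gt0.
have mAWD := measurableI _ _ (measurableI _ _ mA mW) mD.
have mBWD := measurableI _ _ (measurableI _ _ mB mW) mD.
have [x [y [[[Ax Wx] xo] [[By Wy] yo] xy]]] := close_directions (mu_radial n2) n2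
  mAWD mBWD (@subIsetr _ _ _) (@subIsetr _ _ _) d20 (inWD A mA dA) (inWD B mB dB)
  (divr_gt0 C0 q0) r2.
exists x, y; split => //.
have [xhi _] := win _ (mdist_ge0 (o n) x) Wx.
have [yhi _] := win _ (mdist_ge0 (o n) y) Wy.
have rr : `|mdist (o n) x - mdist (o n) y| <= 2 * eta / (s n)%:num.
  rewrite ler_pdivlMr // mulrC -{1}(gtr0_norm sn) -normrM.
  have -> : (s n)%:num * (mdist (o n) x - mdist (o n) y) =
    (s n)%:num * (mdist (o n) x - rho n) - (s n)%:num * (mdist (o n) y - rho n).
    by ring.
  apply: le_trans (ler_normB _ _) _; move: Wx Wy; rewrite /annulus /=.
  by drop_comparisons; lra.
have := expR_mdist_le xo yo rr xhi yhi.
set E := expR ((alpha + 2 * eta) / (s n)%:num).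
have E1 : 1 <= E by rewrite -expR0 ler_expR divr_ge0 // addr_ge0 // mulr_ge0 // ltW.
have hE : expR (2 * eta / (s n)%:num) <= E ^+ 2.
  by rewrite /E -expRM_natl ler_expR mulrA ler_pM2r ?invr_gt0 //; move: (al0) (eta0);
    drop_comparisons; lra.
have cE : (Num.sqrt n%:R * E * enorm (dir (o n) x - dir (o n) y)) ^+ 2 <=
    C ^+ 2 * E ^+ 2.
  have E0 : 0 < E by exact: expR_gt0.
  have a1 : 0 <= Num.sqrt n%:R * E * enorm (dir (o n) x - dir (o n) y).
    by rewrite !mulr_ge0 ?enorm_ge0 ?sqrtr_ge0 // ltW.
  have a2 : 0 <= C * E by rewrite mulr_ge0 // ltW.
  rewrite -exprMn lerXn2r ?nnegrE //.
  rewrite (mulrC _ E) (mulrC C) -mulrA ler_pM2l //.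
  rewrite mulrC -ler_pdivlMr //; exact: ltW.
move=> ed; have {ed} : expR (mdist x y) <= (2 + C ^+ 2) * E ^+ 2.
  by move: ed hE cE; drop_comparisons; lra.
have C2 : 0 < 2 + C ^+ 2 by rewrite ltr_pwDl // sqr_ge0.
rewrite -[2 + C ^+ 2]lnK ?posrE // /E -expRM_natl -expRD ler_expR.
move=> /(ler_wpM2l (ltW sn)); rewrite mulrDr.
have -> : (s n)%:num * (2 * ((alpha + 2 * eta) / (s n)%:num)) = 2 * (alpha + 2 * eta).
  by field.
by move: (cst) (etaE); drop_comparisons; lra.
Unshelve. all: by end_near.
Qed.

(** Two points of the limit farther apart than [2 * alpha] have neighbourhoods of
   positive mass. Almost optimal couplings and the [1]-Lipschitz maps pull these
   back to sets of substantial mass that are too far apart. *)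
Lemma limit_diameter (k : nat -> nat) (Z : nat -> mmSpace R) (Y : mmSpace R) :
  {homo k : i j / (i < j)%N} ->
  (forall i, pyramid_of (mm_scale (s (k i)) (mm_supp (mu (k i)))) (Z i)) ->
  box (Z i) Y @[i --> \oo] --> 0%E -> pyramid_le (2 * alpha) Y.
Proof.
move=> k_incr domZ cvgZ; apply: ge_ereal_sup => _ [y _ [y' _ <-]].
rewrite lee_fin leNgt; apply/negP => gap.
pose e := (mdist y y' - 2 * alpha) / 7.
have e0 : 0 < e by rewrite divr_gt0 // subr_gt0.
pose U z := [set t : Y | mdist z t < e].
have U0 z : 0 < pr (mm_measure Y) (U z).
  have oU : open (U z) by exact: open_mdist_ball.
  rewrite -lte_fin prE; last exact: measurable_open.
  by apply: mm_full_support => //; exists z; rewrite /U /= mdistxx.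
pose delta := Num.min (pr (mm_measure Y) (U y)) (pr (mm_measure Y) (U y')) / 2.
have d0 : 0 < delta by rewrite divr_gt0 // lt_min !U0.
have dy : 2 * delta <= pr (mm_measure Y) (U y).
  by rewrite /delta mulrC divfK // ge_min lexx.
have dy' : 2 * delta <= pr (mm_measure Y) (U y').
  by rewrite /delta mulrC divfK // ge_min lexx orbT.
have ki i : (i <= k i)%N.
  by elim: i => // i IH; apply: leq_ltn_trans IH _; exact: k_incr.
have [N _ sepN] := near_separation e0 d0.
have m0 : 0 < Num.min e delta by rewrite lt_min e0.
have /fine_cvgP[Zfin /cvgrPdist_lt/(_ _ m0) Zlt] := cvgZ.
near \oo => i.
have boxi : (box (Z i) Y < (Num.min e delta)%:E)%E.
  have fini : box (Z i) Y \is a fin_num by near: i.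
  have : `|0 - fine (box (Z i) Y)| < Num.min e delta by near: i.
  rewrite sub0r normrN => /(le_lt_trans (ler_norm _)).
  by rewrite -lte_fin fineK.
have [A [B [oA oB dA dB AB]]] := box_separation e0 boxi dy dy'.
have [f [fl fm]] := domZ i.
have oP C : open C -> open (f @^-1` C) by exact: open_preimage_lip.
have prP C : open C -> pr (mm_measure (Z i)) C =
    pr (mu (k i)) (@supp_val _ _ (mu (k i)) @` (f @^-1` C)).
  by move=> oC; rewrite /pr -fm //; exact: measurable_open.
have Nk : (N <= k i)%N by apply: leq_trans (ki i); near: i; exact: nbhs_infty_ge.
rewrite prP // in dA; rewrite prP // in dB.
have [x [x' [[z Az zx] [z' Bz' zx'] xx']]] := sepN (k i) Nk _ _
  (measurable_supp_image (oP _ oA)) (measurable_supp_image (oP _ oB)) dA dB.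
have := AB _ _ Az Bz'; have := fl z z'.
rewrite scaled_mdistE supp_mdistE zx zx'; rewrite /e in xx' *; lra.
Unshelve. all: by end_near.
Qed.

End pyramid_upper_bound.

(** * Couplings with prescribed masses of cells *)

Section finite_sums_of_measures.
Context {R : realType} d {T : measurableType d}.

Lemma sum_measure (J : Type) (r : seq J) (ms : J -> {measure set T -> \bar R}) :
  exists m : {measure set T -> \bar R}, forall E, m E = (\sum_(j <- r) ms j E)%E.
Proof.
elim: r => [|j r [m mE]].
  by exists mzero => E; rewrite big_nil.
exists (measure_add (ms j) m) => E; rewrite big_cons -mE; exact: measure_addE.
Qed.

(** A copy of [m] under a name to which the probability structure is attached. *)
Definition mass1 (m : {measure set T -> \bar R}) (m1 : m setT = 1%E) :
  set T -> \bar R := m.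

Context (m : {measure set T -> \bar R}) (m1 : m setT = 1%E).

HB.instance Definition _ := Measure.on (mass1 m1).

HB.instance Definition _ := Measure_isProbability.Build _ _ _ (mass1 m1) m1.

Definition probability_of_mass1 : probability T R := mass1 m1.

End finite_sums_of_measures.

Lemma pushforward_measure (R : realType) d d' (T : measurableType d)
    (T' : measurableType d') (m : {measure set T -> \bar R}) (f : T -> T') :
  measurable_fun setT f ->
  exists m' : {measure set T' -> \bar R}, forall E, m' E = m (f @^-1` E).
Proof.
by move=> mf; exists (measure_function_pushforward__canonical__measure_function_Measure m mf).
Qed.

Section product_borel.
Context {R : realType}.

Lemma dense_sequence (T : csMetricType R) : exists g : nat -> T,
  forall (x : T) (e : R), 0 < e -> exists i, mdist x (g i) < e.
Proof.
have [A /countable_injP[f fA] dA] := separable_subproof (s := T).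
exists (fun i => xget point [set a | A a /\ f a = i]) => x e e0.
have [|a [xa Aa]] := dA _ _ (open_mdist_ball x e); first by exists x => /=; rewrite mdistxx.
exists (f a); have [Ag fg] := @xgetI _ point [set b | A b /\ f b = f a] a (conj Aa erefl).
by rewrite [X in mdist x X](_ : _ = a) //; apply: fA; rewrite ?inE.
Qed.

(** Separability makes every open set of the product a countable union of
   rectangles. *)
Lemma measurable_product_borel (X Y : csMetricType R) :
  measurable_fun setT (id : (borel X * borel Y)%type -> borel (X * Y)%type).
Proof.
apply: (@measurability _ _ (borel X * borel Y)%type (borel (X * Y)%type) setT id
  (@open (X * Y)%type)) => //.
move=> _ [U oU <-]; rewrite setTI.
have [g gd] := dense_sequence X; have [h hd] := dense_sequence Y.
pose ballX i k : set X := [set x | mdist (g i) x < k.+1%:R^-1].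
pose ballY j k : set Y := [set y | mdist (h j) y < k.+1%:R^-1].
pose rect i j k : set (X * Y) :=
  if `[< ballX i k `*` ballY j k `<=` U >] then ballX i k `*` ballY j k else set0.
have -> : id @^-1` U = \bigcup_i \bigcup_j \bigcup_k rect i j k.
  apply/seteqP; split => [[x y] Uxy|p [i _ [j _ [k _]]]]; last first.
    by rewrite /rect; case: asboolP => // sub; exact: sub.
  have [[P Q] [/= /near_mdist[e e0 eP] /near_mdist[e' e'0 eQ]] PQ] :
    nbhs (x, y) U by exact: open_nbhs_nbhs.
  have [k ke] : exists k : nat, k.+1%:R^-1 < Num.min e e' / 2.
    by apply: exists_invS_lt; rewrite divr_gt0 // lt_min e0.
  have k0 : 0 < k.+1%:R^-1 :> R by rewrite invr_gt0.
  have m1 : Num.min e e' <= e by rewrite ge_min lexx.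
  have m2 : Num.min e e' <= e' by rewrite ge_min lexx orbT.
  have key u w : u < k.+1%:R^-1 -> w < k.+1%:R^-1 -> u + w < Num.min e e'.
    by move=> hu hw; rewrite [ltRHS]splitr ltrD // (lt_trans _ ke).
  have [i xi] := gd x _ k0; have [j yj] := hd y _ k0.
  exists i => //; exists j => //; exists k => //; rewrite /rect.
  rewrite asboolT /ballX /ballY /=; first by split => /=; rewrite mdist_sym.
  move=> [x' y'] /= [x'i y'j]; apply: PQ; split => /=.
    apply: eP; apply: le_lt_trans (mdist_tri (g i) x x') _.
    exact: lt_le_trans (key _ _ xi x'i) m1.
  apply: eQ; apply: le_lt_trans (mdist_tri (h j) y y') _.
  exact: lt_le_trans (key _ _ yj y'j) m2.
do 3 apply: bigcupT_measurable => ?.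
rewrite /rect; case: asboolP => // _; by apply: measurableX; apply: measurable_open;
  exact: open_mdist_ball.
Qed.

End product_borel.

(** Conditionally on the first cell the densities of [coupling_of_cells] have
   total mass one. *)
Lemma cell_density_sum (R : realType) (J : finType) (a b m : J -> R) (i : J) :
  (forall j, 0 <= m j) -> (forall j, m j <= a j) -> (forall j, m j <= b j) ->
  \sum_j a j = 1 -> \sum_j b j = 1 -> a i != 0 ->
  \sum_j ((i == j)%:R * (m i / (a i * b i)) + (a i - m i) * (b j - m j) /
    (a i * b j * (1 - \sum_j m j))) * b j = 1.
Proof.
move=> m0 ma mb suma sumb ai; set M := \sum_j m j.
have res : M = 1 -> a i = m i.
  move=> ME; apply/eqP; rewrite -subr_eq0; apply/eqP.
  have : \sum_j (a j - m j) = 0 by rewrite sumrB suma -/M ME subrr.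
  by move=> /psumr_eq0P; apply => // j _; rewrite subr_ge0.
have bm j : b j = 0 -> m j = 0.
  by move=> bj; apply/eqP; rewrite eq_le m0 andbT -bj mb.
have E j : ((i == j)%:R * (m i / (a i * b i)) + (a i - m i) * (b j - m j) /
    (a i * b j * (1 - M))) * b j = (i == j)%:R * (m i / a i) +
    (b j - m j) * ((a i - m i) / (a i * (1 - M))).
  have [bj|bj] := eqVneq (b j) 0.
    rewrite bj (bm j bj) subrr !(mul0r, mulr0, addr0).
    have [ij|_] := eqVneq i j; last by rewrite mul0r.
    by rewrite ij (bm j bj) !mul0r mulr0.
  have [M1'|M1'] := eqVneq (1 - M) 0.
    rewrite M1' !mulr0 invr0 !mulr0 !addr0.
    have [ij|_] := eqVneq i j; last by rewrite !mul0r.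
    by rewrite -{}ij in bj *; rewrite !mul1r; field; rewrite ?ai ?bj.
  have [ij|_] := eqVneq i j.
    by rewrite -{}ij in bj *; rewrite !mul1r; field; rewrite ?ai ?M1' ?bj.
  by rewrite !mul0r !add0r; field; rewrite ?ai ?M1' ?bj.
rewrite (eq_bigr _ (fun j _ => E j)) big_split /= -mulr_suml -mulr_suml.
rewrite (bigD1 i) //= eqxx big1 => [|j ji]; last by rewrite eq_sym (negbTE ji).
rewrite sumrB sumb -/M addr0 mul1r.
have [M1'|M1'] := eqVneq (1 - M) 0.
  rewrite M1' mul0r addr0 -res ?divff //.
  by apply/eqP; rewrite eq_sym -subr_eq0 M1'.
by field; rewrite ?ai ?M1'.
Qed.

Section couplings.
Context {R : realType} (X Y : mmSpace R) (J : finType) (cX : X -> J) (cY : Y -> J).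
Hypothesis mX : forall i, measurable ([set x | cX x = i] : set (borel X)).
Hypothesis mY : forall j, measurable ([set y | cY y = j] : set (borel Y)).
Let A i : set (borel X) := [set x | cX x = i].
Let B j : set (borel Y) := [set y | cY y = j].
Let a i := pr (mm_measure X) (A i).
Let b j := pr (mm_measure Y) (B j).

Let sum_cells (Z : mmSpace R) (c : Z -> J) (E : set (borel Z)) : measurable E ->
  (forall i, measurable ([set z | c z = i] : set (borel Z))) ->
  \sum_i pr (mm_measure Z) (E `&` [set z | c z = i]) = pr (mm_measure Z) E.
Proof.
move=> mE mc; rewrite -pr_bigcup => [|i|i j z _ _ [_ <-] [_ <-]] //; last first.
  exact: measurableI.
congr pr; apply/seteqP; split => z; rewrite -bigcup_seq.
  by move=> [i _ []].
by move=> Ez; exists (c z) => //=; rewrite mem_index_enum.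
Qed.

(** Couple the mass [m i] of corresponding cells, and the remaining masses
   independently of each other; conditionally on their cells the two points are
   independent. *)
Lemma coupling_of_cells (m : J -> R) : (forall i, 0 <= m i) ->
  (forall i, m i <= a i) -> (forall i, m i <= b i) ->
  exists pi : probability (borel (X * Y)%type) R, is_coupling pi /\
    forall k, m k <= pr pi (A k `*` B k).
Proof.
move=> m0 ma mb.
have suma : \sum_i a i = 1.
  rewrite -[RHS](prT (mm_measure X)) -(sum_cells measurableT mX).
  by apply: eq_bigr => i _; rewrite setTI.
have sumb : \sum_i b i = 1.
  rewrite -[RHS](prT (mm_measure Y)) -(sum_cells measurableT mY).
  by apply: eq_bigr => i _; rewrite setTI.
pose M := \sum_i m i.
have M1 : M <= 1 by rewrite -suma; apply: ler_sum.
(* the density on [A i `*` B j] with respect to the product measure; the inverse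
   of zero being zero, empty cells and the case [M = 1] need no separate form *)
pose q i j := (i == j)%:R * (m i / (a i * b i)) +
  (a i - m i) * (b j - m j) / (a i * b j * (1 - M)).
have a0 i : 0 <= a i by exact: pr_ge0.
have b0 i : 0 <= b i by exact: pr_ge0.
have q0 i j : 0 <= q i j.
  by rewrite addr_ge0 // ?mulr_ge0 ?invr_ge0 ?mulr_ge0 ?subr_ge0.
have diag i : q i i * (a i * b i) >= m i.
  have [ab0|abn] := eqVneq (a i * b i) 0.
    rewrite ab0 mulr0; move/eqP: ab0; rewrite mulf_eq0 => /orP[]/eqP E.
      by rewrite -E.
    by rewrite -E.
  rewrite /q eqxx mul1r mulrDl divfK // lerDl.
  by rewrite ?mulr_ge0 ?invr_ge0 ?mulr_ge0 ?subr_ge0.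
have row i : a i != 0 -> \sum_j q i j * b j = 1.
  exact: cell_density_sum.
have col j : b j != 0 -> \sum_i q i j * a i = 1.
  move=> bj; rewrite -[RHS](cell_density_sum m0 mb ma sumb suma bj).
  apply: eq_bigr => i _; rewrite /q [b j * a i]mulrC [(b j - _) * _]mulrC.
  by have [->|_] := eqVneq i j; rewrite ?mul0r // [b j * a j]mulrC.
pose rho := (mm_measure X \x mm_measure Y)%E.
have mAB (p : J * J) : measurable (A p.1 `*` B p.2).
  by apply: measurableX; [exact: mX|exact: mY].
pose ms (p : J * J) : {measure set (borel X * borel Y)%type -> \bar R} :=
  mscale (NngNum (q0 p.1 p.2)) (mrestr rho (mAB p)).
have [m' m'E] := sum_measure (index_enum _) ms.
have rectE (F : set (borel X)) (G : set (borel Y)) : measurable F -> measurable G ->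
    m' (F `*` G) = (\sum_i \sum_j q i j * pr (mm_measure X) (F `&` A i) *
      pr (mm_measure Y) (G `&` B j))%:E.
  move=> mF mG; rewrite m'E pair_big /= -sumEFin; apply: eq_bigr => -[i j] _.
  have mFA : measurable (F `&` A i) by apply: measurableI => //; exact: mX.
  have mGB : measurable (G `&` B j) by apply: measurableI => //; exact: mY.
  rewrite /ms /= /mscale /= /mrestr -setXI product_measure1E //.
  by rewrite !EFinM (prE _ mFA) (prE _ mGB) muleA.
have fstE F : measurable F -> m' (F `*` setT) = (pr (mm_measure X) F)%:E.
  move=> mF; rewrite rectE //; congr EFin.
  rewrite -(sum_cells mF mX); apply: eq_bigr => i _.
  under eq_bigr do rewrite setTI mulrAC.
  rewrite -mulr_suml; have [ai|ai] := eqVneq (a i) 0; last by rewrite row // mul1r.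
  have -> : pr (mm_measure X) (F `&` A i) = 0; last by rewrite mulr0.
  apply/eqP; rewrite eq_le pr_ge0 andbT -ai; apply: le_pr => //; last exact: mX.
  by apply: measurableI => //; exact: mX.
have sndE G : measurable G -> m' (setT `*` G) = (pr (mm_measure Y) G)%:E.
  move=> mG; rewrite rectE //; congr EFin.
  rewrite exchange_big -(sum_cells mG mY); apply: eq_bigr => j _ /=.
  under eq_bigr do rewrite setTI.
  rewrite -mulr_suml; have [bj|bj] := eqVneq (b j) 0; last by rewrite col // mul1r.
  have -> : pr (mm_measure Y) (G `&` B j) = 0; last by rewrite mulr0.
  apply/eqP; rewrite eq_le pr_ge0 andbT -bj; apply: le_pr => //; last exact: mY.
  by apply: measurableI => //; exact: mY.
have [m'' m''E] := pushforward_measure m' (measurable_product_borel (X := X) (Y := Y)).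
have m''1 : m'' setT = 1%E by rewrite m''E preimage_setT -setXTT fstE // prT.
exists (probability_of_mass1 m''1); split; first split.
- move=> E mE; rewrite -[LHS]/(m'' _) m''E.
  have -> : id @^-1` (fst @^-1` E) = E `*` [set: Y].
    by apply/seteqP; split => [p Ep|p [Ep _]]; [split|exact: Ep].
  by rewrite fstE // prE.
- move=> E mE; rewrite -[LHS]/(m'' _) m''E.
  have -> : id @^-1` (snd @^-1` E) = [set: X] `*` E.
    by apply/seteqP; split => [p Ep|p [_ Ep]]; [split|exact: Ep].
  by rewrite sndE // prE.
move=> k; rewrite /pr -[X in fine X]/(m'' _) m''E -[_ @^-1` _]/(A k `*` B k).
rewrite rectE /=; [|exact: mX|exact: mY].
apply: le_trans (diag k) _; rewrite (bigD1 k) //= (bigD1 k) //= !setIid mulrA.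
rewrite -!addrA lerDl addr_ge0 //; apply: sumr_ge0 => i _.
  by rewrite !mulr_ge0 ?pr_ge0.
by apply: sumr_ge0 => j _; rewrite !mulr_ge0 ?pr_ge0.
Qed.

End couplings.

(** * Box distance estimates and changes of metric *)

Section box_upper_bound.
Context {R : realType}.

Lemma measurable_rectangle (X Y : csMetricType R) (A : set X) (B : set Y) :
  measurable (A : set (borel X)) -> measurable (B : set (borel Y)) ->
  measurable (A `*` B : set (borel (X * Y)%type)).
Proof.
have mfst : measurable_fun setT (fst : borel (X * Y)%type -> borel X).
  apply: (@measurability _ _ (borel (X * Y)%type) (borel X) setT fst (@open X)) => //.
  move=> _ [U oU <-]; rewrite setTI; apply: sub_sigma_algebra.
  exact: open_fst_preimage.
have msnd : measurable_fun setT (snd : borel (X * Y)%type -> borel Y).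
  apply: (@measurability _ _ (borel (X * Y)%type) (borel Y) setT snd (@open Y)) => //.
  move=> _ [U oU <-]; rewrite setTI; apply: sub_sigma_algebra.
  exact: open_snd_preimage.
move=> mA mB.
have -> : A `*` B = (setT `&` fst @^-1` A) `&` (setT `&` snd @^-1` B).
  by rewrite !setTI; apply/seteqP; split => -[x y] [].
by apply: measurableI; [exact: mfst|exact: msnd].
Qed.

Lemma distortion_closure (X Y : mmSpace R) (S : set (X * Y)) (e : R) :
  (forall p q, S p -> S q -> `|mdist p.1 q.1 - mdist p.2 q.2| <= e) ->
  (distortion (closure S) <= e%:E)%E.
Proof.
move=> Se; apply: ge_ereal_sup => _ [p Sp [q Sq <-]]; rewrite lee_fin.
apply/ler_addgt0Pr => d d0; have d40 : 0 < d / 4 by rewrite divr_gt0.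
have approx r : closure S r -> exists r', [/\ S r', mdist r.1 r'.1 < d / 4 &
    mdist r.2 r'.2 < d / 4].
  move=> /(_ [set r' | mdist r.1 r'.1 < d / 4 /\ mdist r.2 r'.2 < d / 4]) [].
    exists ([set x | mdist r.1 x < d / 4], [set y | mdist r.2 y < d / 4]).
      by split; apply/near_mdist; exists (d / 4).
    by move=> r' [].
  by move=> r' [Sr' [r1 r2]]; exists r'.
have [p' [Sp' p1 p2]] := approx p Sp; have [q' [Sq' q1 q2]] := approx q Sq.
have := Se p' q' Sp' Sq'; rewrite !ler_norml => /andP[h1 h2].
have t1 := mdist_tri p'.1 p.1 q.1; have t2 := mdist_tri q'.1 p'.1 q.1.
have t3 := mdist_tri p.1 p'.1 q'.1; have t4 := mdist_tri q.1 p.1 q'.1.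
have u1 := mdist_tri p'.2 p.2 q.2; have u2 := mdist_tri q'.2 p'.2 q.2.
have u3 := mdist_tri p.2 p'.2 q'.2; have u4 := mdist_tri q.2 p.2 q'.2.
rewrite (mdist_sym q'.1 q.1) in t2; rewrite (mdist_sym p'.1 p.1) in t3.
rewrite (mdist_sym q'.2 q.2) in u2; rewrite (mdist_sym p'.2 p.2) in u3.
apply/andP; split; lra.
Qed.

(** The coupling of [coupling_of_cells] gives the products of matching cells mass
   at least [\sum_i m i], and closing their union does not increase its
   distortion. *)
Lemma box_le_cells (X Y : mmSpace R) (J : finType) (cX : X -> J) (cY : Y -> J)
    (G : pred J) (m : J -> R) (e : R) :
  (forall i, measurable ([set x | cX x = i] : set (borel X))) ->
  (forall j, measurable ([set y | cY y = j] : set (borel Y))) ->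
  (forall i, 0 <= m i) -> (forall i, ~~ G i -> m i = 0) ->
  (forall i, G i -> m i <= pr (mm_measure X) [set x | cX x = i]) ->
  (forall i, G i -> m i <= pr (mm_measure Y) [set y | cY y = i]) ->
  1 - e <= \sum_i m i ->
  (forall x x' y y', G (cX x) -> G (cX x') -> cY y = cX x -> cY y' = cX x' ->
    `|mdist x x' - mdist y y'| <= e) ->
  (box X Y <= e%:E)%E.
Proof.
move=> mX mY m0 mG ma mb M d_e.
have le_m (T : mmSpace R) (c : T -> J) i :
    (G i -> m i <= pr (mm_measure T) [set z | c z = i]) ->
    m i <= pr (mm_measure T) [set z | c z = i].
  by move=> h; have [/h//|/mG ->] := boolP (G i); exact: pr_ge0.
have [pi [cpi pim]] := coupling_of_cells mX mY m0 (fun i => le_m _ _ _ (ma i))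
  (fun i => le_m _ _ _ (mb i)).
pose rect i : set (X * Y) := [set x | cX x = i] `*` [set y | cY y = i].
have mrect i : measurable (rect i : set (borel (X * Y)%type)).
  exact: measurable_rectangle.
pose S := \big[setU/set0]_(i | G i) rect i.
have mS : measurable (S : set (borel (X * Y)%type)) by exact: bigsetU_measurable.
have SE p : S p -> G (cX p.1) /\ cY p.2 = cX p.1.
  by rewrite /S -bigcup_seq_cond => -[i /= /andP[_ Gi] [/= -> ->]].
have cS : closed (closure S) by exact: closed_closure.
have mcS := measurable_closed_prod cS.
apply: (@le_trans _ _ (maxe (1 - pi (closure S)) (@distortion R X Y (closure S)))%E).
  by apply: ereal_inf_lbound; exists pi, (closure S).
rewrite ge_max; apply/andP; split.
  rewrite -prE // -EFinB lee_fin lerBlDr -lerBlDl; apply: le_trans M _.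
  apply: (@le_trans _ _ (pr pi S)); last by apply: le_pr => //; exact: subset_closure.
  rewrite /S pr_bigcup //.
    by rewrite (bigID G) /= [X in _ + X]big1 ?addr0 // ; apply: ler_sum => i _; exact: pim.
  by move=> i j p _ _ [<- _] [<- _].
apply: distortion_closure => p q /SE[Gp Ep] /SE[Gq Eq]; exact: d_e.
Qed.

End box_upper_bound.

Section remetrization.
Context {R : realType}.

(** A metric squeezed between a truncation of the given one and the given one
   has the same uniformity, hence the same topology and Borel sets, and is
   dominated by it through the identity map. *)
Record squeezed (X : csMetricType R) := Squeezed {
  sq_dist : X -> X -> R;
  sq_refl : forall x, sq_dist x x = 0;
  sq_sym : forall x y, sq_dist x y = sq_dist y x;
  sq_tri : forall y x z, sq_dist x z <= sq_dist x y + sq_dist y z;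
  sq_cut : R;
  sq_cut_gt0 : 0 < sq_cut;
  sq_ge : forall x y, Num.min sq_cut (mdist x y) <= sq_dist x y;
  sq_le : forall x y, sq_dist x y <= mdist x y
}.

Context (X : csMetricType R) (d : squeezed X).

Definition remetrized (d : squeezed X) : Type := X.

HB.instance Definition _ := Complete.copy (remetrized d) X.

HB.instance Definition _ :=
  Topological_isSeparable.Build (remetrized d) (separable_subproof (s := X)).

Let sq_ball (x : X) (e : R) : set X := [set y | sq_dist d x y < e].

Let sq_dist_ge0 x y : 0 <= sq_dist d x y.
Proof.
apply: le_trans (sq_ge d x y); rewrite le_min mdist_ge0 andbT ltW //.
exact: sq_cut_gt0.
Qed.

Let sq_ball_center (x : X) (e : R) : 0 < e -> sq_ball x e x.
Proof. by rewrite /sq_ball /= sq_refl. Qed.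

Let sq_ball_sym (x y : X) (e : R) : sq_ball x e y -> sq_ball y e x.
Proof. by rewrite /sq_ball /= sq_sym. Qed.

Let sq_ball_triangle (x y z : X) (e1 e2 : R) :
  sq_ball x e1 y -> sq_ball y e2 z -> sq_ball x (e1 + e2) z.
Proof.
by rewrite /sq_ball /= => xy yz; apply: le_lt_trans (sq_tri d y x z) _; exact: ltrD.
Qed.

Let sq_entourageE : @entourage (remetrized d) = entourage_ sq_ball.
Proof.
rewrite -[LHS]/(@entourage X) -(@entourage_ballE R X).
apply/seteqP; split=> A [e /= e0 eA].
  exists (Num.min e (sq_cut d)) => /=; first by rewrite lt_min e0 sq_cut_gt0.
  move=> [x y] /=; rewrite /sq_ball /= lt_min => /andP[xe xc].
  apply: eA => /=; rewrite ballEmdist /=.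
  have := sq_ge d x y; rewrite ge_min => /orP[h|h]; last exact: le_lt_trans h xe.
  by have := le_lt_trans h xc; rewrite ltxx.
exists e => //= -[x y] /=; rewrite ballEmdist /= => xy; apply: eA => /=.
exact: le_lt_trans (sq_le d x y) xy.
Qed.

HB.instance Definition _ := Uniform_isPseudoMetric.Build R (remetrized d)
  sq_ball_center sq_ball_sym sq_ball_triangle sq_entourageE.

Let sq_dist_pos x y : sq_dist d x y = 0 -> x = y.
Proof.
move=> xy0; apply: mdist_positivity; apply/eqP; rewrite eq_le mdist_ge0 andbT.
have := sq_ge d x y; rewrite xy0 ge_min => /orP[|//].
by rewrite leNgt sq_cut_gt0.
Qed.

Let sq_ballE (x : remetrized d) e : ball x e = [set y | sq_dist d x y < e].
Proof. by []. Qed.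

HB.instance Definition _ := PseudoMetric_isMetric.Build R (remetrized d)
  sq_dist_ge0 sq_dist_pos sq_ballE.

Lemma remetrized_mdistE (x y : remetrized d) : mdist x y = sq_dist d x y.
Proof. by []. Qed.

End remetrization.

Definition mm_remetrize (R : realType) (X : mmSpace R) (d : squeezed X) : mmSpace R :=
  @MMSpace R (remetrized d) (mm_measure X) (@mm_full_support R X).

Lemma dominates_remetrize (R : realType) (X : mmSpace R) (d : squeezed X) :
  dominates X (mm_remetrize d).
Proof.
exists id; split => // x x'; exact: sq_le.
Qed.

(** * Finite approximation *)

Section finite_approximation.
Context {R : realType}.

Lemma box_ge0 (X Y : mmSpace R) : (0 <= box X Y)%E.
Proof.
apply: le_ereal_inf_tmp => _ [pi [S [_ cS ->]]].
have mS := measurable_closed_prod cS.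
by rewrite le_max -prE // -EFinB lee_fin subr_ge0 pr_le1.
Qed.

(** The piece of a point is the first ball around a dense sequence that contains
   it; the index [k] marks the remainder. *)
Lemma small_pieces (Y : mmSpace R) (e : R) : 0 < e ->
  exists (k : nat) (g : nat -> Y) (c : Y -> 'I_k.+1),
  [/\ forall j, measurable ([set y | c y = j] : set (borel Y)),
      forall y, (c y < k)%N -> mdist (g (c y)) y < e &
      1 - e <= pr (mm_measure Y) [set y | (c y < k)%N]].
Proof.
move=> e0; have [g gd] := dense_sequence Y.
pose b i : set Y := [set y | mdist (g i) y < e].
have mb i : measurable (b i : set (borel Y)).
  by apply: measurable_open; exact: open_mdist_ball.
pose U k : set (borel Y) := \big[setU/set0]_(i < k) b i.
have mU k : measurable (U k) by exact: bigsetU_measurable.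
have UE k y : U k y <-> exists2 i, (i < k)%N & b i y.
  rewrite /U -bigcup_seq; split=> [[i _ bi]|[i ik bi]]; first by exists i.
  by exists (Ordinal ik) => //=; rewrite mem_index_enum.
have [k Uk] : exists k, 1 - e <= pr (mm_measure Y) (U k).
  have : mm_measure Y (U k) @[k --> \oo] --> mm_measure Y (\bigcup_k U k).
    apply: nondecreasing_cvg_mu => //; first exact: bigcupT_measurable.
    move=> i j ij; apply/subsetPset => y /UE[l li bl]; apply/UE.
    by exists l => //; exact: leq_trans li ij.
  have -> : \bigcup_k U k = setT.
    apply/seteqP; split => // y _; have [i yi] := gd y e e0.
    exists i.+1 => //; apply/UE; exists i => //.
    by rewrite /b /= mdist_sym.
  rewrite probability_setT => /fine_cvgP[_ /cvgrPdist_le/(_ e e0)] [k _ /(_ k (leqnn k))].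
  by move=> /= h; exists k; move: h; rewrite -/(pr _ _) ler_norml; lra.
pose f y := find (fun i => `[< b i y >]) (iota 0 k).
have fk y : (f y < k.+1)%N by rewrite ltnS /f -{2}(size_iota 0 k) find_size.
have fP y : (f y < k)%N -> b (f y) y.
  rewrite /f -{2}(size_iota 0 k) -has_find => h.
  by have := nth_find 0 h; rewrite nth_iota ?add0n => [/asboolP|]; last by
    rewrite -{2}(size_iota 0 k) -has_find.
have fU y i : (i <= k)%N -> (f y < i)%N <-> U i y.
  move=> ik; split=> [fi|/UE[l li bl]].
    by apply/UE; exists (f y) => //; apply: fP; exact: leq_trans fi ik.
  rewrite ltnNge; apply/negP => le_f; have lf : (l < f y)%N by exact: leq_trans li le_f.
  have := before_find 0 lf; rewrite nth_iota ?add0n; last first.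
    exact: leq_trans li ik.
  by rewrite asboolT.
have mf i : measurable ([set y | (f y < i)%N] : set (borel Y)).
  have [ik|ki] := leqP i k.
    rewrite (_ : [set y | _] = U i) //; apply/seteqP.
    by split => y /(fU y i ik).
  rewrite (_ : [set y | _] = setT) //; apply/seteqP; split => // y _ /=.
  exact: leq_trans (fk y) ki.
exists k, g, (fun y => Ordinal (fk y)); split => /=.
- move=> j; rewrite (_ : [set y | _] = [set y | (f y < j.+1)%N] `\` [set y | (f y < j)%N]).
    exact: measurableD.
  apply/seteqP; split => y /=.
    by move=> <- /=; split => //; apply/negP; rewrite -leqNgt.
  move=> [lt_j /negP]; rewrite -leqNgt => ge_j; apply: val_inj => /=.
  by apply/eqP; rewrite eqn_leq ge_j andbT -ltnS.
- by move=> y /fP.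
- rewrite (_ : [set y | _] = U k) //; apply/seteqP.
  by split => y /(fU y k (leqnn k)).
Qed.

(** List [m j] copies of every [j] and pad with [ord_max]. *)
Lemma assignment (k N : nat) (m : 'I_k.+1 -> nat) : m ord_max = 0%N ->
  (\sum_j m j <= N)%N ->
  exists J : nat -> 'I_k.+1, forall j, j != ord_max ->
    #|[pred i : 'I_N | J i == j]| = m j.
Proof.
move=> m0 mN; pose L := flatten [seq nseq (m j) j | j <- index_enum 'I_k.+1].
have sL : (size L <= N)%N.
  rewrite size_flatten /shape -map_comp sumnE big_map.
  by under eq_bigr do rewrite /= size_nseq.
exists (nth ord_max L) => j jk; rewrite cardE /enum_mem size_filter.
transitivity (count (pred1 j) (L ++ nseq (N - size L) ord_max)); last first.
  rewrite count_cat count_nseq /= eq_sym (negbTE jk) mul0n addn0.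
  rewrite /L count_flatten -map_comp sumnE big_map (bigD1_seq j) /=; first last.
  - exact: index_enum_uniq.
  - exact: mem_index_enum.
  rewrite count_nseq /= eqxx mul1n big1 ?addn0 // => i ij.
  by rewrite count_nseq /= (negbTE ij).
rewrite -(_ : [seq nth ord_max L (nat_of_ord i) | i <- enum 'I_N] =
    L ++ nseq (N - size L) ord_max).
  rewrite count_map -enumT; apply: eq_count => i.
  by rewrite /= /in_mem /=.
apply: (@eq_from_nth _ ord_max).
  by rewrite size_map size_enum_ord size_cat size_nseq subnKC.
move=> i; rewrite size_map size_enum_ord => iN.
rewrite (nth_map (Ordinal iN)) ?size_enum_ord // nth_enum_ord // nth_cat nth_nseq.
by case: ltnP => // Li; rewrite nth_default // if_same.
Qed.

(** McShane's extension [inf_y (f y + mdist y x)]. *)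
Lemma lipschitz_extension (X : csMetricType R) (G : set X) (f : X -> R) :
  (forall x, G x -> 0 <= f x) ->
  (forall x y, G x -> G y -> `|f x - f y| <= mdist x y) ->
  exists F : X -> R, (forall x y, `|F x - F y| <= mdist x y) /\
    forall x, G x -> F x = f x.
Proof.
move=> f0 fl; have [G0|/set0P[z Gz]] := eqVneq G set0.
  exists (fun=> 0); split => [x y|x]; last by rewrite G0.
  by rewrite subrr normr0 mdist_ge0.
pose S x := [set f y + mdist y x | y in G].
have hS x : has_inf (S x).
  split; first by exists (f z + mdist z x), z.
  by exists 0 => _ [y Gy <-]; rewrite addr_ge0 ?f0 ?mdist_ge0.
have ub x y : G y -> inf (S x) <= f y + mdist y x.
  by move=> Gy; apply: ge_inf; [exact: (hS x).2|exists y].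
exists (fun x => inf (S x)); split => [x y|x Gx].
  have half u w : inf (S u) <= inf (S w) + mdist w u.
    rewrite -lerBlDr; apply: lb_le_inf; first exact: (hS w).1.
    move=> _ [t Gt <-]; rewrite lerBlDr -addrA; apply: le_trans (ub u t Gt) _.
    by rewrite lerD2l; exact: mdist_tri.
  rewrite ler_norml; have := half x y; have := half y x; rewrite (mdist_sym y x).
  lra.
apply/eqP; rewrite eq_le; apply/andP; split.
  by have := ub x x Gx; rewrite mdistxx addr0.
apply: lb_le_inf; first exact: (hS x).1.
move=> _ [y Gy <-]; have := fl x y Gx Gy; rewrite ler_norml (mdist_sym y x); lra.
Qed.

End finite_approximation.

Section squeezed_of_functions.
Context {R : realType} (X : csMetricType R) (k : nat) (f : 'I_k -> X -> R) (r : R).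
Hypothesis r0 : 0 < r.
Hypothesis fl : forall j x y, `|f j x - f j y| <= mdist x y.

(** The pull-back of the sup norm under 1-Lipschitz functions, made separating
   by the original metric truncated at [r]. *)
Definition sup_dist x y : R :=
  Num.max (Num.min r (mdist x y)) (\big[Num.max/0]_j `|f j x - f j y|).

Let sup_ge j x y : `|f j x - f j y| <= sup_dist x y.
Proof. by rewrite le_max; apply/orP; right; exact: le_bigmax. Qed.

Let sup_dist_refl x : sup_dist x x = 0.
Proof.
rewrite /sup_dist mdistxx (min_idPr (ltW r0)); apply/eqP.
rewrite eq_le le_max lexx andbT ge_max lexx /=; apply/bigmax_leP; split => // j _.
by rewrite subrr normr0.
Qed.

Let sup_dist_sym x y : sup_dist x y = sup_dist y x.
Proof.
rewrite /sup_dist mdist_sym; congr Num.max.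
by apply: eq_bigr => j _; rewrite distrC.
Qed.

Let sup_dist_tri y x z : sup_dist x z <= sup_dist x y + sup_dist y z.
Proof.
have cut u w : Num.min r (mdist u w) <= sup_dist u w by rewrite le_max lexx.
have cut0 (u w : X) : 0 <= Num.min r (mdist u w) by rewrite le_min mdist_ge0 ltW.
rewrite {1}/sup_dist ge_max; apply/andP; split.
  have := cut x y; have := cut y z; have := cut0 x y; have := cut0 y z.
  have := mdist_tri y x z; have := mdist_ge0 x y; have := mdist_ge0 y z.
  rewrite /Num.min; do 3 (case: ltP => ?); lra.
apply/bigmax_leP; split; first by rewrite addr_ge0 // (le_trans (cut0 _ _) (cut _ _)).
move=> j _; have := sup_ge j x y; have := sup_ge j y z.
have := ler_normD (f j x - f j y) (f j y - f j z).
by rewrite addrA subrK; lra.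
Qed.

Let sup_dist_ge x y : Num.min r (mdist x y) <= sup_dist x y.
Proof. by rewrite le_max lexx. Qed.

Let sup_dist_le x y : sup_dist x y <= mdist x y.
Proof.
rewrite ge_max ge_min lexx orbT /=; apply/bigmax_leP; split => [|j _].
  exact: mdist_ge0.
exact: fl.
Qed.

Definition squeezed_sup : squeezed X :=
  Squeezed sup_dist_refl sup_dist_sym sup_dist_tri r0 sup_dist_ge sup_dist_le.

Lemma sup_dist_lb j x y : `|f j x - f j y| <= sq_dist squeezed_sup x y.
Proof. exact: sup_ge. Qed.

Lemma sup_dist_ub (b : R) x y : 0 <= b -> (forall j, `|f j x - f j y| <= b) ->
  sq_dist squeezed_sup x y <= b + r.
Proof.
move=> b0 fb; rewrite /= /sup_dist ge_max; apply/andP; split.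
  by rewrite ge_min lerDr b0.
apply/bigmax_leP; split => [|j _]; first by rewrite addr_ge0 // ltW.
by apply: le_trans (fb j) _; rewrite lerDl ltW.
Qed.

End squeezed_of_functions.

(** * Lower bound: approximation by Lipschitz images *)

Section supports.
Context {R : realType} (T : csMetricType R) (mu : probability (borel T) R)
  (s : {posnum R}).

Lemma mdist_mm_supp (x y : mm_scale s (mm_supp mu)) :
  mdist x y = s%:num * mdist (supp_val x) (supp_val y).
Proof. by []. Qed.

Let valS : mm_scale s (mm_supp mu) -> T := fun x => supp_val x.

Lemma measurable_supp_preimage (A : set T) : measurable (A : set (borel T)) ->
  measurable ([set x | A (supp_val x)] : set (borel (mm_scale s (mm_supp mu)))).
Proof.
have mv : measurable_fun setT (valS : borel (mm_scale s (mm_supp mu)) -> borel T).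
  apply: (@measurability _ _ (borel (mm_scale s (mm_supp mu))) (borel T) setT valS
    (@open T)) => //.
  move=> _ [U oU <-]; rewrite setTI; apply: measurable_open.
  apply: open_mdist => x /= Ux; move: oU; rewrite openE => /(_ _ Ux) /near_mdist[e e0 eU].
  exists (s%:num * e); first by rewrite mulr_gt0.
  by move=> y; rewrite mdist_mm_supp ltr_pM2l // => xy; exact: eU.
by move=> mA; rewrite -[X in measurable X]setTI; exact: mv.
Qed.

Lemma pr_supp_preimage (A : set T) : measurable (A : set (borel T)) ->
  pr (mm_measure (mm_scale s (mm_supp mu))) [set x | A (supp_val x)] = pr mu A.
Proof.
move=> mA; have mS := measurable_support mu.
transitivity (pr mu (A `&` Defs.support mu)).
  rewrite /pr; congr fine; rewrite -[LHS]/(mu (@supp_val R T mu @` _)); congr (mu _).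
  apply/seteqP; split => [_ [x Ax <-]|x [Ax Sx]].
    by split; [exact: Ax|exact: supp_valP].
  by exists (SigSub (mem_set Sx)).
apply/eqP; rewrite eq_le le_pr //=; last exact: measurableI.
have := prI_ge mu mA mS; rewrite {2}/pr measure_support /=; lra.
Qed.

End supports.

Section lower_bound.
Context {R : realType} (s : nat -> {posnum R}) (rho : nat -> R) (a : \bar R).
Hypothesis s_cvg : (s n)%:num @[n --> \oo] --> (0 : R).
Hypothesis rho_gt0 : forall n, (2 <= n)%N -> 0 < rho n.
Hypothesis a_lty : (a < +oo)%E.
Hypothesis a_cvg : ((s n)%:num * ln (sinh (rho n) / Num.sqrt n%:R))%:E
      @[n --> \oo] --> a.
Context (o : forall n, hyp R n) (mu : forall n, probability (borel (hyp R n)) R).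
Hypothesis mu_radial : forall n, (2 <= n)%N -> radial (o n) (mu n).
Hypothesis radius_cvg : forall e : R, 0 < e ->
      mu n [set x | e < `|(s n)%:num * (mdist (o n) x - rho n)|]
        @[n --> \oo] --> 0%E.
Local Notation alpha := (pos_part a).

(** The sets are the argmax cells of the first [N] coordinates: any two of these
   coordinates of a typical direction differ by a multiple of [1 / sqrt n], the
   scale that becomes the distance [2 * alpha]. *)
Lemma near_separated_cells (N : nat) (e : R) : (0 < N)%N -> 0 < e -> 0 < alpha ->
  \forall n \near \oo, exists C : nat -> set (hyp R n),
  [/\ forall i, measurable (C i : set (borel (hyp R n))),
      forall i, (i < N)%N -> pr (mu n) (C i) = pr (mu n) (C 0%N),
      1 - e <= N%:R * pr (mu n) (C 0%N),
      forall i j x, (i < N)%N -> (j < N)%N -> C i x -> C j x -> i = j &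
      forall i j x y, (i < N)%N -> (j < N)%N -> i != j -> C i x -> C j y ->
        2 * alpha - e <= (s n)%:num * mdist x y].
Proof.
move=> N0 e0 a0.
have N0' : 0 < N%:R :> R by rewrite ltr0n.
pose eps := e / 3 / N%:R ^+ 2.
have eps0 : 0 < eps by rewrite !divr_gt0 // exprn_gt0.
have [c c0 [n0 small]] := small_coordinate eps0.
pose eta := Num.min (e / 7) (alpha / 4).
have eta0 : 0 < eta by rewrite lt_min !divr_gt0.
have eta_e : 7 * eta <= e.
  have : eta <= e / 7 by rewrite ge_min lexx.
  lra.
have eta_a : 3 * eta <= alpha.
  have : eta <= alpha / 4 by rewrite ge_min lexx orbT.
  lra.
have e30 : 0 < e / 3 by rewrite divr_gt0.
near=> n.
have n2 : (2 <= n)%N by near: n; exact: nbhs_infty_ge.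
have nn0 : (n0 <= n)%N by near: n; exact: nbhs_infty_ge.
have nN : (N <= n)%N by near: n; exact: nbhs_infty_ge.
have sn : 0 < (s n)%:num by [].
have q0 : 0 < Num.sqrt n%:R :> R by rewrite sqrtr_gt0 ltr0n ltnW.
have ann : 1 - e / 3 <= pr (mu n) (annulus s rho o eta n).
  by near: n; exact: near_pr_annulus.
have win : forall r, 0 <= r -> `|(s n)%:num * (r - rho n)| <= eta ->
  sinh r <= Num.sqrt n%:R * expR ((alpha + 2 * eta) / (s n)%:num) /\
  (3 * eta <= alpha ->
   Num.sqrt n%:R * expR ((alpha - 3 * eta) / (s n)%:num) <= sinh r).
  by near: n; exact: near_annulus.
have cst : (s n)%:num * - (2 * ln (c / 2)) <= eta by near: n; exact: near_small_scale.
have mu_rad := mu_radial n2.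
pose W := annulus s rho o eta n.
have mW : measurable (W : set (borel (hyp R n))) by exact: measurable_annulus.
have WE x y : mdist (o n) x = mdist (o n) y -> W x -> W y.
  by rewrite /W /annulus /= => ->.
pose t := c / Num.sqrt n%:R.
have t0 : 0 < t by rewrite divr_gt0.
exists (argmax_cell (o n) W N t); split.
- by move=> i; exact: measurable_argmax_cell.
- by move=> i iN; apply: (pr_argmax_cell mu_rad mW WE).
- have po : pr (mu n) [set o n] <= e / 3.
    have : pr (mu n) [set o n] <= pr (mu n) (~` W).
      apply: le_pr; [exact: measurable_point|exact: measurableC|].
      move=> _ -> Wo; have [_ /(_ eta_a)] := win _ (mdist_ge0 (o n) (o n)) Wo.
      rewrite mdistxx /sinh oppr0 subrr mul0r leNgt.
      by rewrite mulr_gt0 // expR_gt0.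
    by rewrite prC //; lra.
  have := argmax_cells_mass mu_rad mW WE (N := N) (t := t) (eps := eps).
  rewrite N0 nN => /(_ isT (small n (o n) (mu n) mu_rad nn0)).
  have -> : N%:R ^+ 2 * eps = e / 3 by rewrite mulrC divfK // expf_neq0 // gt_eqF.
  by move: ann po; rewrite -/W; lra.
- by move=> i j x iN jN; exact: argmax_cell_disjoint.
move=> i j x y iN jN ij [Wx hx] [Wy hy].
have ain : (i < n)%N by exact: leq_trans iN nN.
have ajn : (j < n)%N by exact: leq_trans jN nN.
have ei := @axis_unit R n i ain; have ej := @axis_unit R n j ajn.
set u : 'rV[R]_n := axis i - axis j.
have u0 : u != 0.
  rewrite subr_eq0; apply: contra_neq ij => E.
  have := ei; rewrite {2}E dot_axis //; case: eqVneq => // _ /esym/eqP.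
  by rewrite oner_eq0.
have u2 : enorm u <= 2 by exact: enorm_le2.
have un := enorm_gt0 u0.
set E := expR ((alpha - 3 * eta) / (s n)%:num).
have E0 : 0 < E by exact: expR_gt0.
(* one of the two points is far on each side of the bisecting hyperplane *)
have far z : W z -> t <= dot (dir (o n) z) u ->
    E * (c / 2) <= dot (chart (o n) z) (normalize u).
  move=> Wz hz; have [_ /(_ eta_a) sz] := win _ (mdist_ge0 (o n) z) Wz.
  rewrite chart_dir dotZl /normalize dotZr.
  have -> : E * (c / 2) = (Num.sqrt n%:R * E) * (t / 2).
    by rewrite /t; field; rewrite gt_eqF.
  apply: ler_pM => //.
  - by rewrite mulr_ge0 ?ltW.
  - by rewrite divr_ge0 // ltW.
  rewrite [leRHS]mulrC; apply: ler_pM => //; first exact: ltW.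
  by rewrite lef_pV2 ?posrE.
have hx' : t <= dot (dir (o n) x) u by apply: hx => //; rewrite eq_sym.
have hy' : t <= dot (dir (o n) y) (- u) by rewrite opprB; exact: hy.
have far' z : W z -> t <= dot (dir (o n) z) (- u) ->
    dot (chart (o n) z) (normalize u) <= - (E * (c / 2)).
  move=> Wz hz; have [_ /(_ eta_a) sz] := win _ (mdist_ge0 (o n) z) Wz.
  rewrite -lerN2 opprK -dotNr chart_dir dotZl /normalize -scalerN dotZr.
  have -> : E * (c / 2) = (Num.sqrt n%:R * E) * (t / 2).
    by rewrite /t; field; rewrite gt_eqF.
  apply: ler_pM => //.
  - by rewrite mulr_ge0 ?ltW.
  - by rewrite divr_ge0 // ltW.
  rewrite [leRHS]mulrC; apply: ler_pM => //; first exact: ltW.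
  by rewrite lef_pV2 ?posrE.
have Ec0 : 0 < E * (c / 2) by rewrite mulr_gt0 // divr_gt0.
have := expR_mdist_ge (normalize_unit u0) (ltW Ec0) (far x Wx hx') (far' y Wy hy').
have -> : (E * (c / 2)) ^+ 2 = expR (2 * ((alpha - 3 * eta) / (s n)%:num + ln (c / 2))).
  by rewrite expRM_natl expRD lnK // posrE divr_gt0.
rewrite ler_expR => /(ler_wpM2l (ltW sn)); apply: le_trans.
have -> : (s n)%:num * (2 * ((alpha - 3 * eta) / (s n)%:num + ln (c / 2))) =
   2 * (alpha - 3 * eta) - (s n)%:num * - (2 * ln (c / 2)) by field.
lra.
Unshelve. all: by end_near.
Qed.

(** Separated cells are assigned to the pieces of [Y] in proportion to their
   masses. The distances to the pieces, as functions on the cells, are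
   [1]-Lipschitz because the diameter of [Y] hardly exceeds the separation; their
   extensions to the whole space define the metric of [Z]. *)
Lemma near_approximation (Y : mmSpace R) (e : R) : pyramid_le (2 * alpha) Y ->
  0 < e -> 0 < alpha -> \forall n \near \oo, exists Z,
  pyramid_of (mm_scale (s n) (mm_supp (mu n))) Z /\ (box Z Y <= e%:E)%E.
Proof.
move=> diamY e0 a0.
have diam (y y' : Y) : mdist y y' <= 2 * alpha.
  rewrite -lee_fin; apply: le_trans diamY; apply: ereal_sup_ubound.
  by exists y => //; exists y'.
have e80 : 0 < e / 8 by rewrite divr_gt0.
have [k [g [cY [mcY near_g massY]]]] := small_pieces Y e80.
(* so many cells that rounding [k] multiplicities loses mass at most [e / 8] *)
pose N := (Num.truncn (8 * k%:R / e)).+1.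
have N0 : (0 < N)%N by [].
have N0' : 0 < N%:R :> R by rewrite ltr0n.
have kN : k%:R <= N%:R * (e / 8).
  have : 8 * k%:R / e < N%:R by exact: truncnS_gt.
  by rewrite ltr_pdivrMr //; lra.
pose p (j : 'I_k.+1) := pr (mm_measure Y) [set y | cY y = j].
have p0 j : 0 <= p j by exact: pr_ge0.
pose mult (j : 'I_k.+1) := if j == ord_max then 0%N else Num.truncn (N%:R * p j).
have mult_le j : (mult j)%:R <= N%:R * p j.
  rewrite /mult; case: ifP => _; first by rewrite mulr_ge0.
  by rewrite truncn_le ?mulr_ge0.
have sump : \sum_j p j = 1.
  rewrite -(pr_bigcup (mm_measure Y) (F := fun j => [set y | cY y = j])
    (P := xpredT)) //; last by move=> i j y _ _ /= <- <-.
  rewrite -[RHS](prT (mm_measure Y)); congr pr; apply/seteqP; split => // y _.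
  by rewrite -bigcup_seq; exists (cY y) => //=; rewrite mem_index_enum.
have p_max : p ord_max <= e / 8.
  have mlt : measurable ([set y | (cY y < k)%N] : set (borel Y)).
    rewrite (_ : [set y | _] = ~` [set y | cY y = ord_max]).
      exact: measurableC.
    apply/seteqP; split => y /=; first by move=> + E; rewrite E ltnn.
    move=> ne; rewrite ltn_neqAle -ltnS ltn_ord andbT.
    by apply/eqP => E; apply: ne; apply: val_inj.
  have : p ord_max <= pr (mm_measure Y) (~` [set y | (cY y < k)%N]).
    apply: le_pr => //; first exact: measurableC.
    by move=> y /= ->; rewrite ltnn.
  by rewrite prC //; lra.
have mult_sum : (\sum_j mult j <= N)%N.
  rewrite -(ler_nat R) natr_sum; apply: (@le_trans _ _ (\sum_j N%:R * p j)).
    by apply: ler_sum => j _; exact: mult_le.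
  by rewrite -mulr_sumr sump mulr1.
have mult_ge : N%:R * (1 - e / 8) - k%:R <= \sum_j (mult j)%:R.
  rewrite (bigD1 ord_max) //= {1}/mult eqxx add0r.
  apply: (@le_trans _ _ (\sum_(j < k.+1 | j != ord_max) (N%:R * p j - 1))).
    rewrite sumrB sumr_const cardC1 card_ord /= -mulr_sumr lerD2r ler_pM2l //.
    by have := sump; rewrite (bigD1 ord_max) //=; lra.
  apply: ler_sum => j jk; rewrite /mult (negbTE jk) lerBlDr natr1.
  by apply: ltW; exact: truncnS_gt.
have multmax : mult ord_max = 0%N by rewrite /mult eqxx.
have [J JE] := assignment multmax mult_sum.
pose eta := Num.min (e / 8) alpha.
have eta0 : 0 < eta by rewrite lt_min e80.
have eta_e : eta <= e / 8 by rewrite ge_min lexx.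
have eta_a : eta <= alpha by rewrite ge_min lexx orbT.
have := near_separated_cells N0 eta0 a0; apply: filterS => n [C [mC eqC massC disC sepC]].
pose L := 2 * alpha - eta.
have L0 : 0 <= L by rewrite /L; lra.
(* the cell of a point of the hyperbolic space, [ord_max] outside all cells *)
pose cH (x : hyp R n) : 'I_k.+1 :=
  if [pick i : 'I_N | `[< C i x >]] is Some i then J i else ord_max.
have cHE (i : 'I_N) x : C i x -> cH x = J i.
  move=> Cx; rewrite /cH; case: pickP => [i' /asboolP Cx'|/(_ i)].
    by congr (J _); exact: (disC _ _ x (ltn_ord _) (ltn_ord _)).
  by rewrite asboolT.
have cHP x j : j != ord_max -> cH x = j -> exists2 i : 'I_N, J i = j & C i x.
  rewrite /cH; case: pickP => [i /asboolP Cx _ Ji|_ + E].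
    by exists i.
  by rewrite E eqxx.
have cellE j : j != ord_max -> [set x | cH x = j] =
    \big[setU/set0]_(i < N | J i == j) C i.
  move=> jk; apply/seteqP; split => x; rewrite -bigcup_seq_cond.
    by move=> /(cHP x j jk)[i Ji Cx]; exists i => //=; rewrite mem_index_enum Ji eqxx.
  by move=> [i /= /andP[_ /eqP <-] Cx]; exact: cHE.
have mcH j : measurable ([set x | cH x = j] : set (borel (hyp R n))).
  have [->|jk] := eqVneq j ord_max; last by rewrite cellE //; exact: bigsetU_measurable.
  have -> : [set x | cH x = ord_max] =
      ~` \big[setU/set0]_(j | j != ord_max) [set x | cH x = j].
    apply/seteqP; split => x /=; rewrite -bigcup_seq_cond.
      by move=> E [j' /= /andP[_ ne] Ej]; move: ne; rewrite -Ej E eqxx.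
    move=> nE; apply/eqP; apply: contraPT nE => ne; apply.
    by exists (cH x) => //=; rewrite mem_index_enum.
  apply: measurableC; apply: big_ind => //; first by move=> ? ? ? ?; exact: measurableU.
  by move=> j' jk'; rewrite cellE //; exact: bigsetU_measurable.
have prcH j : j != ord_max ->
    pr (mu n) [set x | cH x = j] = (mult j)%:R * pr (mu n) (C 0%N).
  move=> jk; rewrite cellE // pr_bigcup; first last.
  - move=> i i' x _ _ Cx Cx'; apply: val_inj.
    exact: (disC _ _ x (ltn_ord i) (ltn_ord i') Cx Cx').
  - by move=> i; exact: mC.
  rewrite (eq_bigr (fun=> pr (mu n) (C 0%N))) => [|i _]; last exact: eqC.
  by rewrite sumr_const -[LHS]mulr_natl JE.
have NC1 : N%:R * pr (mu n) (C 0%N) <= 1.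
  have <- : pr (mu n) (\big[setU/set0]_(i < N) C i) = N%:R * pr (mu n) (C 0%N).
    rewrite pr_bigcup; first last.
    - move=> i i' x _ _ Cx Cx'; apply: val_inj.
      exact: (disC _ _ x (ltn_ord i) (ltn_ord i') Cx Cx').
    - by move=> i; exact: mC.
    rewrite (eq_bigr (fun=> pr (mu n) (C 0%N))) => [|i _]; last exact: eqC.
    by rewrite sumr_const card_ord mulr_natl.
  by apply: pr_le1; exact: bigsetU_measurable.
pose X := mm_scale (s n) (mm_supp (mu n)).
pose cX (x : X) : 'I_k.+1 := cH (supp_val x).
pose good : pred 'I_k.+1 := predC1 ord_max.
(* points of different pieces lie in different cells *)
have sepX (x x' : X) : good (cX x) -> good (cX x') -> cX x != cX x' ->
    L <= mdist x x'.
  move=> gx gx' ne; have [i Ji Cx] := cHP _ _ gx erefl.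
  have [i' Ji' Cx'] := cHP _ _ gx' erefl.
  apply: le_trans (sepC i i' (supp_val x) (supp_val x') (ltn_ord i) (ltn_ord i')
    _ Cx Cx').
    by rewrite /L; lra.
  by apply: contra_neq ne => ii'; rewrite -Ji -Ji' ii'.
(* the distance to the center of piece [j], truncated at the separation of the
   cells so that it is Lipschitz on their union *)
pose h (j : 'I_k) (x : X) := Num.min (mdist (g (cX x)) (g j)) L.
have h0 j x : 0 <= h j x by rewrite le_min mdist_ge0.
have hl j (x x' : X) : good (cX x) -> good (cX x') ->
    `|h j x - h j x'| <= mdist x x'.
  move=> gx gx'; have [E|ne] := eqVneq (cX x) (cX x').
    by rewrite /h E subrr normr0 mdist_ge0.
  apply: le_trans (sepX x x' gx gx' ne).
  have := h0 j x; have := h0 j x'.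
  have : h j x <= L by rewrite ge_min lexx orbT.
  have : h j x' <= L by rewrite ge_min lexx orbT.
  by rewrite ler_norml; lra.
have /choice[f fP] : forall j : 'I_k, exists F : X -> R,
    (forall x y, `|F x - F y| <= mdist x y) /\
    forall x, good (cX x) -> F x = h j x.
  move=> j; have [F [Fl FE]] := @lipschitz_extension R X [set x | good (cX x)] (h j)
    (fun x _ => h0 j x) (hl j).
  by exists F.
pose d := squeezed_sup e80 (fun j => (fP j).1).
exists (mm_remetrize (X := X) d); split; first exact: dominates_remetrize.
pose m (j : 'I_k.+1) := (mult j)%:R * pr (mu n) (C 0%N).
have prC0 : 0 <= pr (mu n) (C 0%N) by exact: pr_ge0.
have mcX j : measurable ([set x | cX x = j] : set (borel X)).
  exact: (@measurable_supp_preimage R _ (mu n) (s n) _ (mcH j)).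
apply: (@box_le_cells R (mm_remetrize (X := X) d) Y 'I_k.+1 cX cY good m) => //.
- by move=> j; rewrite mulr_ge0.
- by move=> j; rewrite negbK => /eqP ->; rewrite /m multmax mul0r.
- move=> j jk; rewrite /m -prcH //.
  by rewrite -(@pr_supp_preimage R _ (mu n) (s n) _ (mcH j)).
- move=> j jk; rewrite /m -/(p j).
  by move: (ler_wpM2r prC0 (mult_le j)) (ler_wpM2l (p0 j) NC1); drop_comparisons; lra.
- rewrite /m -mulr_suml.
  have c1 : N%:R * pr (mu n) (C 0%N) * (1 - e / 8 - e / 8) <=
      (\sum_j (mult j)%:R) * pr (mu n) (C 0%N).
    by move: (ler_wpM2r prC0 mult_ge) (ler_wpM2r prC0 kN); drop_comparisons; lra.
  have [e4|e4] := leP 4 e.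
    apply: (@le_trans _ _ 0); first by move: e4; drop_comparisons; lra.
    by rewrite mulr_ge0 // sumr_ge0.
  by apply: le_trans c1; move: massC NC1 (eta_e) e4 (e0); drop_comparisons; nra.
move=> x x' y y' gx gx' Ey Ey'; rewrite remetrized_mdistE.
have lt_k z : good (cX z) -> (cX z < k)%N.
  move=> gz; rewrite ltn_neqAle -ltnS ltn_ord andbT.
  by apply: contraNneq gz => E; apply/eqP/val_inj.
have yg := near_g y; rewrite Ey in yg; have {}yg := yg (lt_k x gx).
have yg' := near_g y'; rewrite Ey' in yg'; have {}yg' := yg' (lt_k x' gx').
set gx1 := g (cX x) in yg *; set gx2 := g (cX x') in yg' *.
have ub : sq_dist d x x' <= mdist gx1 gx2 + e / 8.
  apply: sup_dist_ub; first exact: mdist_ge0.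
  move=> j; rewrite !(fP j).2 // /h -/gx1 -/gx2.
  have t1 := mdist_tri gx2 gx1 (g j); have t2 := mdist_tri gx1 gx2 (g j).
  rewrite (mdist_sym gx2 gx1) in t2; have m0 := mdist_ge0 gx1 gx2.
  move: t1 t2 m0; rewrite ler_norml /Num.min; drop_comparisons.
  by case: ltP => ?; case: ltP => ?; lra.
have lb : mdist gx1 gx2 - eta <= sq_dist d x x'.
  pose j := Ordinal (lt_k x gx).
  apply: le_trans (sup_dist_lb e80 (fun j => (fP j).1) j x x').
  rewrite !(fP j).2 // /h -/gx1 -/gx2 /= -/gx1 mdistxx (min_idPl L0) sub0r normrN.
  rewrite ger0_norm ?le_min ?mdist_ge0 // mdist_sym.
  by move: (diam gx2 gx1) eta0; rewrite /L /Num.min; drop_comparisons; case: ltP => ?; lra.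
have t1 := mdist_tri gx1 y y'; have t2 := mdist_tri gx2 gx1 y'.
have t3 := mdist_tri y gx1 gx2; have t4 := mdist_tri y' y gx2.
rewrite (mdist_sym y gx1) in t1; rewrite (mdist_sym y' gx2) in t4.
by rewrite ler_norml; move: ub lb t1 t2 t3 t4 yg yg' (eta_e) (e0); drop_comparisons; lra.
Qed.

(** A diagonal choice of the approximations for the precisions [1 / j]. For
   [alpha = 0] the space is a point, dominated by every space. *)
Lemma pyramid_lower_bound (Y : mmSpace R) : pyramid_le (2 * alpha) Y ->
  exists Z : nat -> mmSpace R,
    (forall n, pyramid_of (mm_scale (s n) (mm_supp (mu n))) (Z n)) /\
    box (Z n) Y @[n --> \oo] --> 0%E.
Proof.
move=> diamY; pose Q n := pyramid_of (mm_scale (s n) (mm_supp (mu n))).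
have diam (y y' : Y) : mdist y y' <= 2 * alpha.
  rewrite -lee_fin; apply: le_trans diamY; apply: ereal_sup_ubound.
  by exists y => //; exists y'.
have approx e : 0 < e -> \forall n \near \oo,
    exists Z, Q n Z /\ (box Z Y <= e%:E)%E.
  move=> e0; have := pos_part_ge0 a; rewrite le_eqVlt => /predU1P[a0|a0]; last first.
    exact: near_approximation.
  have Ypt (y y' : Y) : y = y'.
    apply: mdist_positivity; apply/eqP; rewrite eq_le mdist_ge0 andbT.
    by have := diam y y'; rewrite -a0 mulr0.
  near=> n; exists Y; split.
    exists (fun=> point); split => [x x'|A mA]; first by rewrite mdistxx mdist_ge0.
    have [Ap|nAp] := pselect (A point).
      have -> : A = setT by apply/seteqP; split => // y _; rewrite (Ypt y point).
      by rewrite preimage_setT !probability_setT.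
    have -> : A = set0.
      by apply/seteqP; split => // y Ay; apply: nAp; rewrite (Ypt point y).
    by rewrite preimage_set0 !measure0.
  apply: (@box_le_cells R Y Y unit (fun=> tt) (fun=> tt) xpredT (fun=> 1)) => //.
  - by move=> []; rewrite (_ : [set _ | _] = setT) //; apply/seteqP.
  - by move=> []; rewrite (_ : [set _ | _] = setT) //; apply/seteqP.
  - by move=> [] _; rewrite (_ : [set _ | _] = setT) ?prT //; apply/seteqP.
  - by move=> [] _; rewrite (_ : [set _ | _] = setT) ?prT //; apply/seteqP.
  - by rewrite sumr_const card_unit mulr1n; lra.
  - by move=> x x' y y' _ _ _ _; rewrite (Ypt y x) (Ypt y' x') subrr normr0 ltW.
pose P n j := exists Z, Q n Z /\ (box Z Y <= (j.+1%:R^-1)%:E)%E.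
(* realise as many of the precisions [1, 1/2, ..., 1/n] as possible at once *)
have best n m : exists Z, Q n Z /\ forall j, (j < m)%N -> P n j ->
    (box Z Y <= (j.+1%:R^-1)%:E)%E.
  elim: m => [|m [Z [QZ bZ]]].
    by exists (mm_scale (s n) (mm_supp (mu n))); split => //; exists id; split.
  have [[Z' [QZ' bZ']]|nP] := pselect (P n m).
    exists Z'; split => // j; rewrite ltnS => jm _; apply: le_trans bZ' _.
    by rewrite lee_fin lef_pV2 ?posrE // ler_nat ltnS.
  exists Z; split => // j; rewrite ltnS leq_eqVlt => /predU1P[-> /nP//|].
  exact: bZ.
have /choice[Z ZP] := fun n => best n n.
exists Z; split => [n|]; first by have [] := ZP n.
apply/fine_cvgP; split.
  near=> n; rewrite ge0_fin_numE ?box_ge0 //; apply: le_lt_trans (ltry 1%:R^-1).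
  have n0 : (0 < n)%N by near: n; exact: nbhs_infty_gt.
  by apply: ((ZP n).2 0%N n0); near: n; apply: approx; rewrite invr1.
apply/cvgrPdist_le => e e0.
have [j je] := exists_invS_lt e0.
have j0 : 0 < j.+1%:R^-1 :> R by rewrite invr_gt0.
near=> n; rewrite sub0r normrN /= ger0_norm; last by rewrite fine_ge0 // box_ge0.
apply: ltW; apply: le_lt_trans je; rewrite -lee_fin.
have bj : (box (Z n) Y <= (j.+1%:R^-1)%:E)%E.
  have jn : (j < n)%N by near: n; exact: nbhs_infty_gt.
  by apply: ((ZP n).2 j jn); near: n; exact: approx.
rewrite fineK // ge0_fin_numE ?box_ge0 //; exact: le_lt_trans bj (ltry _).
Unshelve. all: by end_near.
Qed.

End lower_bound.

(** * Convergence of the pyramids and of the signed distances *)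

Theorem theorem1p1 (R : realType) (o : forall n, hyp R n)
    (mu : forall n, probability (borel (hyp R n)) R)
    (s : nat -> {posnum R}) (rho : nat -> R) (a : \bar R)
    (mu_radial : forall n, (2 <= n)%N -> radial (o n) (mu n))
    (s_cvg : (s n)%:num @[n --> \oo] --> (0 : R))
    (rho_gt0 : forall n, (2 <= n)%N -> 0 < rho n)
    (radius_cvg : forall e : R, 0 < e ->
      mu n [set x | e < `|(s n)%:num * (mdist (o n) x - rho n)|]
        @[n --> \oo] --> 0%E)
    (a_lty : (a < +oo)%E)
    (a_cvg : ((s n)%:num * ln (sinh (rho n) / Num.sqrt n%:R))%:E
      @[n --> \oo] --> a) :
  pyramid_cvg (fun n => pyramid_of (mm_scale (s n) (mm_supp (mu n))))
    (pyramid_le (2 * pos_part a)) /\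
  forall v : forall n, 'rV[R]_n.+1,
    (forall n, (2 <= n)%N -> 0 < lform (v n) (v n) /\ hyperplane (v n) (o n)) ->
    cvg_in_distribution
      (fun n => pushforward (mu n) (fun x => (s n)%:num * signed_dist (v n) x))
      (half_dirac (- pos_part a) (pos_part a)).
Proof.
split; first split.
- move=> Y.
  exact: (pyramid_lower_bound s_cvg rho_gt0 a_lty a_cvg mu_radial radius_cvg).
- move=> k Z Y.
  exact: (limit_diameter s_cvg rho_gt0 a_lty a_cvg mu_radial radius_cvg).
move=> v hv; apply: (cvg_signed_dist mu_radial hv) => e delta e0 d0.
have n2 : \forall n \near \oo, (2 <= n)%N by exact: nbhs_infty_ge.
have := near_signed_dist s_cvg rho_gt0 a_lty a_cvg mu_radial radius_cvg e0 d0.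
apply: filterS2 n2 => n /hv[v0 vo]; exact.
Qed.
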